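(* Let $0<\alpha<1$ and let $\mu\in W^{1,2}(\mathbb{C})$ be a compactly supported Beltrami coefficient. Let $E\subset\mathbb{C}$ be compact, and assume that $\mathcal{H}^{1+\alpha}(E)=0$. Then $E$ is removable for $\operatorname{Lip}_\alpha$ $\mu$-quasiregular mappings.
   Context: A Beltrami coefficient is a measurable function $\mu:\mathbb{C}\to\mathbb{C}$ with $\|\mu\|_\infty<1$. A function $f$ is $\mu$-quasiregular on an open set $\Omega$ if $f\in W^{1,2}_{loc}(\Omega)$ and $\overline\partial f=\mu\,\partial f$ almost everywhere in $\Omega$, where $\partial=\partial_z$, $\overline\partial=\partial_{\bar z}$. $\operatorname{Lip}_\alpha(\mathbb{C})$ is the space of H\''older continuous functions with exponent $\alpha$ on $\mathbb{C}$. A compact set $E$ is removable for $\operatorname{Lip}_\alpha$ $\mu$-quasiregular mappings if every function $f\in\operatorname{Lip}_\alpha(\mathbb{C})$ that is $\mu$-quasiregular on $\mathbb{C}\setminus E$ has a $\mu$-quasiregular extension (from $\mathbb{C}\setminus E$) to $\mathbb{C}$. $\mathcal{H}^{t}$ denotes $t$-dimensional Hausdorff measure. *)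

(* Defs.v *)
From HB Require Import structures.
From mathcomp Require Import all_boot all_order all_algebra.
From mathcomp Require Import complex.
From mathcomp Require Import all_classical all_reals all_analysis.
From mathcomp Require Import ess_sup_inf.

Set Implicit Arguments.
Unset Strict Implicit.
Unset Printing Implicit Defensive.

Import Order.TTheory GRing.Theory Num.Theory.
Import numFieldNormedType.Exports.
Import Normc.

Local Open Scope classical_set_scope.
Local Open Scope ring_scope.

(* Conventions.  As the domain of functions and the ambient space of sets, the
   complex plane is R * R, the point (x, y) standing for x + iy: this gives
   access to the product topology and the product measure.  Values of functions
   are taken in R[i].  The library norm on R * R is the max norm; lengths below
   are Euclidean, i.e. moduli [normc] of complex numbers.                     *)

Section Plane.
Variable R : realType.
Local Notation plane := (R * R)%type.
Local Notation C := R[i].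

Definition area := (@lebesgue_measure R \x @lebesgue_measure R)%E.
HB.instance Definition _ := Measure.on area.

Definition cplx (p : plane) : C := Complex p.1 p.2.

Definition cdist (p q : plane) : R := normc (cplx p - cplx q).

(* The point 0 is added so that the empty set has diameter 0. *)
Definition diam (A : set plane) : \bar R :=
  ereal_sup (0%E |` [set (cdist p q)%:E | p in A & q in A]).

(* Intended for s > 0, so that empty pieces of a cover contribute 0. *)
Definition hausdorff_content (s delta : R) (A : set plane) : \bar R :=
  ereal_inf [set (\sum_(0 <= k <oo) (diam (U k) `^ s))%E | U in
    [set U : nat -> set plane |
      A `<=` \bigcup_k U k /\ forall k, (diam (U k) <= delta%:E)%E]].

(* No normalizing constant is included. *)
Definition hausdorff_measure (s : R) (A : set plane) : \bar R :=
  ereal_sup [set hausdorff_content s delta A | delta in [set d | 0 < d]].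

(* The measurable structure on R * R is the Borel one, whereas measurability is
   meant in the sense of Lebesgue (completed sigma-algebra): on D, f agrees
   almost everywhere with a Borel function. *)
Definition leb_measurable (D : set plane) (f : plane -> C) : Prop :=
  exists g : plane -> C,
    [/\ measurable_fun setT (fun z => complex.Re (g z)),
        measurable_fun setT (fun z => complex.Im (g z)) &
        {ae area, forall z, D z -> f z = g z}].

Definition L2 (D : set plane) (f : plane -> C) : Prop :=
  leb_measurable D f /\
  (\int[area]_(z in D) ((normc (f z)) ^+ 2)%:E < +oo)%E.

Definition L2loc (Omega : set plane) (f : plane -> C) : Prop :=
  forall K : set plane, compact K -> K `<=` Omega -> L2 K f.

Definition cintegral (D : set plane) (f : plane -> C) : C :=
  Complex (\int[area]_(z in D) complex.Re (f z))
          (\int[area]_(z in D) complex.Im (f z)).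

Definition dx (phi : plane -> R) : plane -> R := 'D_((1, 0) : plane) phi.
Definition dy (phi : plane -> R) : plane -> R := 'D_((0, 1) : plane) phi.

Fixpoint Ck (k : nat) (phi : plane -> R) : Prop :=
  if k is k'.+1 then
    [/\ forall z, differentiable phi z, Ck k' (dx phi) & Ck k' (dy phi)]
  else continuous phi.

Definition test_function (Omega : set plane) (phi : plane -> R) : Prop :=
  let supp := closure [set z | phi z != 0] in
  [/\ forall k, Ck k phi, compact supp & supp `<=` Omega].

(* Real test functions suffice: the identities are linear in phi. *)
Definition weak_dx (Omega : set plane) (f g : plane -> C) : Prop :=
  forall phi, test_function Omega phi ->
    cintegral Omega (fun z => f z * (dx phi z)%:C%C) =
    - cintegral Omega (fun z => g z * (phi z)%:C%C).

Definition weak_dy (Omega : set plane) (f g : plane -> C) : Prop :=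
  forall phi, test_function Omega phi ->
    cintegral Omega (fun z => f z * (dy phi z)%:C%C) =
    - cintegral Omega (fun z => g z * (phi z)%:C%C).

Definition W12 (f : plane -> C) : Prop :=
  exists fx fy : plane -> C,
    [/\ L2 setT f, L2 setT fx, L2 setT fy,
        weak_dx setT f fx & weak_dy setT f fy].

Definition W12loc_with (Omega : set plane) (f fx fy : plane -> C) : Prop :=
  [/\ L2loc Omega f, L2loc Omega fx, L2loc Omega fy,
      weak_dx Omega f fx & weak_dy Omega f fy].

(* The operators d/dz and d/dzbar. *)
Definition wirt (fx fy : plane -> C) (z : plane) : C :=
  (fx z - 'i%C * fy z) / 2%:R.
Definition wirt_bar (fx fy : plane -> C) (z : plane) : C :=
  (fx z + 'i%C * fy z) / 2%:R.

Definition beltrami_coefficient (mu : plane -> C) : Prop :=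
  leb_measurable setT mu /\
  (ess_sup area (fun z => (normc (mu z))%:E) < 1)%E.

(* Support in the sense of functions defined up to null sets. *)
Definition compactly_supported (mu : plane -> C) : Prop :=
  exists2 K : set plane, compact K & {ae area, forall z, ~ K z -> mu z = 0}.

(* The weak derivatives are unique up to null sets, so it does not matter which
   representatives fx, fy are chosen. *)
Definition quasiregular (mu : plane -> C) (Omega : set plane)
    (f : plane -> C) : Prop :=
  exists fx fy : plane -> C, W12loc_with Omega f fx fy /\
    {ae area, forall z, Omega z -> wirt_bar fx fy z = mu z * wirt fx fy z}.

(* No boundedness is required. *)
Definition Lip (alpha : R) (f : plane -> C) : Prop :=
  exists M : R, forall z w, normc (f z - f w) <= M * cdist z w `^ alpha.

Definition removable (alpha : R) (mu : plane -> C) (E : set plane) : Prop :=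
  forall f : plane -> C, Lip alpha f -> quasiregular mu (~` E) f ->
    exists g : plane -> C,
      quasiregular mu setT g /\ forall z, ~ E z -> g z = f z.

End Plane.

(* Main.v *)
Require Import Defs.
From mathcomp Require Import all_boot all_order all_algebra.
From mathcomp Require Import complex.
From mathcomp Require Import all_classical all_reals all_analysis.
From HB Require Import structures.
From mathcomp Require Import measurable_realfun ess_sup_inf ring lra.
Import Order.TTheory GRing.Theory Num.Theory.
Import numFieldNormedType.Exports.
Local Open Scope classical_set_scope.
Local Open Scope ring_scope.

(* Write [f = a + i b], [mu = p + i q], and let [T psi] be twice the real part of
   [<dbar f - d(mu f) + f dmu, psi>], so that [T psi = 0] for test functions off [E].  As
   [dmu] is in [L^2] and [f] is Hoelder, a test function of size 1 and gradient [1/r] supported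
   in a square of side [r] contributes at most [C r^(1 + alpha)] to [T]; a smooth partition of
   unity subordinate to a cover of [E] by small squares therefore gives [T psi = 0] for all
   test functions [psi].
   Mollifying, [A + i B = f * rho_e] solves the Beltrami equation up to commutators
   [(mu f) * d rho_e - mu (f * d rho_e)], which are bounded in [L^2] because [dmu] is.  Since the
   Jacobian of a compactly supported map has integral zero, [|mu| <= k < 1] yields a bound on
   the local Dirichlet energy of [f * rho_e] independent of [e].  Hence
   [|<f, d psi>| <= C |psi|_2] locally; this makes the derivatives of [f] square integrable near
   [E], and, as [E] is a null set, cut-offs vanishing near [E] show that they are the weak
   derivatives of [f] on the whole plane. *)

Set Implicit Arguments.
Unset Strict Implicit.
Unset Printing Implicit Defensive.

(** * Real-valued Lebesgue integrals *)

Section RealIntegrals.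
Context d (T : measurableType d) (R : realType) (mu : {measure set T -> \bar R}).
Implicit Types f g h : T -> R.
Local Notation integ f := (mu.-integrable setT (EFin \o f)).
Local Notation "'∫' f" := (Rintegral mu setT f) (at level 10, f at level 9).

Lemma integ_meas f : integ f -> measurable_fun setT f.
Proof. by move=> /measurable_int /measurable_EFinP. Qed.

Lemma integ_le f g : measurable_fun setT f -> integ g ->
  (forall z, `|f z| <= g z) -> integ f.
Proof.
move=> mf ig fg; apply: (le_integrable measurableT _ _ ig).
  exact/measurable_EFinP.
move=> z _ /=; rewrite lee_fin (le_trans (fg z))//; exact: ler_norm.
Qed.

Lemma integD f g : integ f -> integ g -> integ (fun z => f z + g z).
Proof. by move=> fi gi; exact: (integrableD measurableT fi gi). Qed.

Lemma integZ c f : integ f -> integ (fun z => c * f z).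
Proof. by move=> fi; exact: (integrableZl measurableT c fi). Qed.

Lemma integN f : integ f -> integ (fun z => - f z).
Proof. by move=> fi; exact: (integrableN fi). Qed.

Lemma integB f g : integ f -> integ g -> integ (fun z => f z - g z).
Proof. by move=> fi gi; apply: integD => //; exact: integN. Qed.

Lemma integ_norm f : integ f -> integ (fun z => `|f z|).
Proof. by move=> fi; exact: (integrable_norm fi). Qed.

Lemma integ_bndM C f g : measurable_fun setT f -> (forall z, `|f z| <= C) ->
  integ g -> integ (fun z => f z * g z).
Proof.
move=> mf fC ig; apply: (@integ_le _ (fun z => C * `|g z|)).
- exact: measurable_funM mf (integ_meas ig).
- exact/integZ/integ_norm.
- by move=> z; rewrite normrM ler_wpM2r.
Qed.

Lemma RintD f g : integ f -> integ g -> ∫ (fun z => f z + g z) = ∫ f + ∫ g.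
Proof. exact: RintegralD. Qed.

Lemma RintB f g : integ f -> integ g -> ∫ (fun z => f z - g z) = ∫ f - ∫ g.
Proof. exact: RintegralB. Qed.

Lemma RintZ c f : integ f -> ∫ (fun z => c * f z) = c * ∫ f.
Proof. exact: RintegralZl. Qed.

Lemma RintN f : integ f -> ∫ (fun z => - f z) = - ∫ f.
Proof.
move=> fi; rewrite -mulN1r -RintZ//; apply: eq_Rintegral => z _.
by rewrite mulN1r.
Qed.

Lemma Rint_ext f g : (forall z, f z = g z) -> ∫ f = ∫ g.
Proof. by move=> fg; apply: eq_Rintegral => z _. Qed.

Lemma Rint_le f g : integ f -> integ g -> (forall z, f z <= g z) -> ∫ f <= ∫ g.
Proof. by move=> fi gi fg; apply: le_Rintegral. Qed.

Lemma Rint_ge0 f : (forall z, 0 <= f z) -> 0 <= ∫ f.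
Proof. by move=> f0; apply: Rintegral_ge0. Qed.

Lemma Rint_abs_le f g : measurable_fun setT f -> integ g ->
  (forall z, `|f z| <= g z) -> `|∫ f| <= ∫ g.
Proof.
move=> mf gi fg; have fi := integ_le mf gi fg.
apply: le_trans (le_normr_Rintegral measurableT fi) _.
by apply: Rint_le => //; exact: integ_norm.
Qed.

Lemma Rint_ae f g : measurable_fun setT f -> measurable_fun setT g ->
  {ae mu, forall z, f z = g z} -> ∫ f = ∫ g.
Proof.
move=> mf mg fg; rewrite /Rintegral; congr fine.
apply: ae_eq_integral => //; try exact/measurable_EFinP.
by apply: filterS fg => z /= -> _.
Qed.

Lemma integ_ae f g : measurable_fun setT g -> integ f ->
  {ae mu, forall z, f z = g z} -> integ g.
Proof.
move=> mg fi fg; apply/integrableP; split; first exact/measurable_EFinP.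
have /integrableP[mf] := fi; congr (_ < _)%E; apply: ae_eq_integral => //.
- exact: measurableT_comp.
- by apply: measurableT_comp => //; exact/measurable_EFinP.
- by apply: filterS fg => z /= -> _.
Qed.

Definition sqint f := measurable_fun setT f /\ integ (fun z => f z ^+ 2).

Lemma amgm (t a b : R) : 0 < t -> `|a * b| <= t * a ^+ 2 + (4 * t)^-1 * b ^+ 2.
Proof.
move=> t0; rewrite normrM.
rewrite -(real_normK (num_real a)) -(real_normK (num_real b)) -subr_ge0.
move: `|a| `|b| => x y.
have -> : t * x ^+ 2 + (4 * t)^-1 * y ^+ 2 - x * y = t * (x - (2 * t)^-1 * y) ^+ 2.
  by field; rewrite gt_eqF.
by rewrite mulr_ge0 ?sqr_ge0 ?ltW.
Qed.

Lemma sqint_mul f g : sqint f -> sqint g -> integ (fun z => f z * g z).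
Proof.
move=> [mf fi] [mg gi].
apply: (@integ_le _ (fun z => 1 * f z ^+ 2 + (4 * 1)^-1 * g z ^+ 2)).
- exact: measurable_funM.
- by apply: integD; exact: integZ.
- by move=> z; exact: amgm.
Qed.

Lemma sqint_mul_le (t : R) f g : 0 < t -> sqint f -> sqint g ->
  `|∫ (fun z => f z * g z)| <=
    t * ∫ (fun z => f z ^+ 2) + (4 * t)^-1 * ∫ (fun z => g z ^+ 2).
Proof.
move=> t0 [mf fi] [mg gi]; rewrite -!RintZ// -RintD; [|exact: integZ..].
apply: Rint_abs_le; first exact: measurable_funM.
  by apply: integD; exact: integZ.
by move=> z; exact: amgm.
Qed.

Lemma sqint_bndM C f g : measurable_fun setT f -> (forall z, `|f z| <= C) ->
  sqint g -> sqint (fun z => f z * g z).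
Proof.
move=> mf fC [mg gi]; split; first exact: measurable_funM.
apply: (@integ_le _ (fun z => C ^+ 2 * g z ^+ 2)).
- by apply: measurable_funX; exact: measurable_funM.
- exact: integZ.
- move=> z; rewrite normrX normrM exprMn -!(normrX _ (g z)).
  rewrite [`|g z ^+ 2|]ger0_norm ?sqr_ge0// ler_wpM2r ?sqr_ge0//.
  by rewrite ler_pXn2r ?nnegrE// (le_trans _ (fC z)).
Qed.

Lemma sqintD f g : sqint f -> sqint g -> sqint (fun z => f z + g z).
Proof.
move=> [mf fi] [mg gi]; split; first exact: measurable_funD.
apply: (@integ_le _ (fun z => 2 * f z ^+ 2 + 2 * g z ^+ 2)).
- by apply: measurable_funX; exact: measurable_funD.
- by apply: integD; exact: integZ.
- move=> z; rewrite ger0_norm ?sqr_ge0// -subr_ge0.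
  have -> : 2 * f z ^+ 2 + 2 * g z ^+ 2 - (f z + g z) ^+ 2 = (f z - g z) ^+ 2 by ring.
  exact: sqr_ge0.
Qed.

Lemma sqintZ c f : sqint f -> sqint (fun z => c * f z).
Proof. by move=> fi; apply: (@sqint_bndM `|c|) => // _. Qed.

Lemma sqintN f : sqint f -> sqint (fun z => - f z).
Proof.
move=> /(sqintZ (-1)); congr sqint; apply/funext => z.
by rewrite mulN1r.
Qed.

Lemma sqintB f g : sqint f -> sqint g -> sqint (fun z => f z - g z).
Proof. by move=> fi gi; apply: sqintD => //; exact: sqintN. Qed.

End RealIntegrals.

Section TensorFubini.
Context d1 d2 (T1 : measurableType d1) (T2 : measurableType d2) (R : realType).
Variables (m1 : {sigma_finite_measure set T1 -> \bar R}).
Variables (m2 : {sigma_finite_measure set T2 -> \bar R}).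
Variables (F : T1 * T2 -> R) (u : T1 -> R) (v : T2 -> R).
Hypothesis mF : measurable_fun setT F.
Hypothesis iu : m1.-integrable setT (EFin \o u).
Hypothesis iv : m2.-integrable setT (EFin \o v).
Hypothesis Fuv : forall x y, `|F (x, y)| <= u x * v y.

Let mF1 x : measurable_fun setT (fun y => F (x, y)).
Proof. exact: measurable_fun_pair2. Qed.

Let mF2 y : measurable_fun setT (fun x => F (x, y)).
Proof. exact: measurable_fun_pair1. Qed.

Lemma tensor_section1 x : m2.-integrable setT (EFin \o (fun y => F (x, y))).
Proof. by apply: (@integ_le _ _ _ _ _ (fun y => u x * v y)) => //; exact: integZ. Qed.

Lemma tensor_section2 y : m1.-integrable setT (EFin \o (fun x => F (x, y))).
Proof.
apply: (@integ_le _ _ _ _ _ (fun x => v y * u x)) => //; first exact: integZ.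
by move=> x; rewrite mulrC.
Qed.

Lemma tensor_integrable : (m1 \x m2)%E.-integrable setT (EFin \o F).
Proof.
apply/integrable12ltyP; first exact/measurable_EFinP.
have iV : m2.-integrable setT (EFin \o (fun y => `|v y|)) by exact: integ_norm.
have iU : m1.-integrable setT (EFin \o (fun x => `|u x|)) by exact: integ_norm.
apply: (@le_lt_trans _ _ (\int[m1]_x ((\int[m2]_y `|v y|) * `|u x|)%:E)%E).
  apply: ge0_le_integral => //.
  - by move=> x _; exact: integral_ge0.
  - apply: (measurable_fun_fubini_tonelli_F (fun p => (`|(F p)%:E|)%E)) => //.
    by apply: measurableT_comp => //; exact/measurable_EFinP.
  - apply/measurable_EFinP; apply: measurable_funM => //; exact: integ_meas iU.
  - move=> x _; rewrite mulrC -RintZ// /Rintegral fineK; last first.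
      by apply: integrable_fin_num => //; exact: integZ.
    apply: ge0_le_integral => //.
    + apply: measurableT_comp => //; exact/measurable_EFinP.
    + by apply/measurable_EFinP; apply: measurable_funM => //; exact: integ_meas iV.
    + move=> y _ /=; rewrite lee_fin (le_trans (Fuv x y))// -normrM; exact: ler_norm.
apply: integrable_lty => //; exact: integZ.
Qed.

Let F1E : (fun x => (\int[m2]_y (F (x, y))%:E)%E) = EFin \o (fun x => \int[m2]_y F (x, y)).
Proof.
apply/funext => x /=; rewrite /Rintegral fineK//.
by apply: integrable_fin_num => //; exact: tensor_section1.
Qed.

Let F2E : (fun y => (\int[m1]_x (F (x, y))%:E)%E) = EFin \o (fun y => \int[m1]_x F (x, y)).
Proof.
apply/funext => y /=; rewrite /Rintegral fineK//.
by apply: integrable_fin_num => //; exact: tensor_section2.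
Qed.

Lemma tensor_integ1 : m1.-integrable setT (EFin \o (fun x => \int[m2]_y F (x, y))).
Proof. by rewrite -F1E; exact: (integrable_fubini_F tensor_integrable). Qed.

Lemma tensor_fubini : \int[m1]_x \int[m2]_y F (x, y) = \int[m2]_y \int[m1]_x F (x, y).
Proof.
have := Fubini tensor_integrable; rewrite /= F1E F2E => h.
by rewrite [LHS]/Rintegral [RHS]/Rintegral h.
Qed.

End TensorFubini.

Section Area.
Context {R : realType}.
Local Notation P := (measurableTypeR R * measurableTypeR R)%type.

Definition square (n : R) : set (R * R) := `[- n, n]%classic `*` `[- n, n]%classic.

Lemma measurable_square n : measurable (square n : set P).
Proof. by apply: measurableX; exact: measurable_itv. Qed.

Lemma area_rect (A B : set (measurableTypeR R)) : measurable A -> measurable B ->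
  area (A `*` B) = (lebesgue_measure A * lebesgue_measure B)%E.
Proof. by move=> mA mB; rewrite /area product_measure1E. Qed.

Lemma area_square n : 0 <= n -> area (square n) = ((2 * n) ^+ 2)%:E.
Proof.
move=> n0; rewrite area_rect; [|exact: measurable_itv..].
rewrite !lebesgue_measure_itv /= lte_fin.
case: ltP => h.
  by rewrite -EFinD -EFinM; congr (_%:E); ring.
by have -> : n = 0; [lra|rewrite mulr0 expr0n mul0e].
Qed.

Lemma area_sigma_finite : sigma_finite setT (@area R).
Proof.
exists (fun n => square n%:R).
  apply/esym; rewrite -subTset => -[x y] _.
  pose m := Num.max `|x| `|y|.
  exists (Num.truncn m).+1 => //=.
  have mm : m < (Num.truncn m).+1%:R by exact: Num.Theory.truncnS_gt.
  have hx : `|x| < (Num.truncn m).+1%:R by apply: le_lt_trans mm; rewrite /m le_max lexx.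
  have hy : `|y| < (Num.truncn m).+1%:R by apply: le_lt_trans mm; rewrite /m le_max lexx orbT.
  by split => /=; rewrite in_itv /= -ler_norml ltW.
move=> n; split; first exact: measurable_square.
by rewrite area_square ?ler0n ?ltry.
Qed.

HB.instance Definition _ := Measure_isSigmaFinite.Build _ P R (@area R) area_sigma_finite.

Local Notation integ f := ((@area R).-integrable setT (EFin \o f)).
Local Notation mea f := (@measurable_fun _ _ P R setT f).
Local Notation "'∫' f" := (Rintegral (@area R) setT f) (at level 10, f at level 9).
Local Notation sqi := (@sqint _ P R (@area R)).

Lemma measurable_addR (a : R) : measurable_fun setT ((fun x => x + a) : measurableTypeR R -> measurableTypeR R).
Proof. exact: (@measurable_funD _ R _ _ id (cst a)). Qed.

Lemma lebesgue_measure_translate (a : R) (A : set (measurableTypeR R)) : measurable A ->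
  pushforward (@lebesgue_measure R)
    ((fun x => x + a) : measurableTypeR R -> measurableTypeR R) A = lebesgue_measure A.
Proof.
move=> mA; apply/esym/lebesgue_measure_unique => //=.
  exact: measurable_addR.
move=> ? _ [[x y]] _ <-.
rewrite /pushforward /=.
have -> : (fun t => t + a) @^-1` `]x, y]%classic = `](x - a), (y - a)]%classic.
  by apply/seteqP; split => t /=; rewrite !in_itv /= ltrBlDr lerBrDr.
rewrite !lebesgue_measure_itv /= !lte_fin ltrD2r.
by case: ifP => // _; rewrite -!EFinD; congr (_%:E); ring.
Qed.

Lemma measurable_shift (h : R * R) :
  measurable_fun setT ((fun z => (z + h : R * R)) : P -> P).
Proof.
apply: measurable_fun_pair.
  exact: (measurableT_comp (measurable_addR h.1) measurable_fst).
exact: (measurableT_comp (measurable_addR h.2) measurable_snd).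
Qed.

Lemma area_translate (h : R * R) (A : set P) : measurable A ->
  pushforward (@area R) ((fun z => (z + h : R * R)) : P -> P) A = area A.
Proof.
move=> mA; apply/esym.
apply: (@product_measure_unique _ _ (measurableTypeR R) (measurableTypeR R) R
  (@lebesgue_measure R) (@lebesgue_measure R)) => //.
  exact: measurable_shift.
move=> ? B C mB mC; rewrite /pushforward /=.
change (area (((fun x => x + h.1) @^-1` B) `*` ((fun x => x + h.2) @^-1` C)) = (lebesgue_measure B * lebesgue_measure C)%E).
rewrite area_rect.
- by rewrite -(lebesgue_measure_translate h.1 mB) -(lebesgue_measure_translate h.2 mC).
- by rewrite -[X in measurable X]setTI; exact: measurable_addR.
- by rewrite -[X in measurable X]setTI; exact: measurable_addR.
Qed.

Lemma mea_shift (h : R * R) (f : P -> R) : mea f -> mea (fun z => f (z + h : R * R)).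
Proof. by move=> mf; exact: (measurableT_comp mf (measurable_shift h)). Qed.

Lemma integ_shift (h : R * R) (f : P -> R) : integ f -> integ (fun z => f (z + h : R * R)).
Proof.
move=> fi; have mf := integ_meas fi.
apply/integrableP; split; first by apply/measurable_EFinP; exact: mea_shift.
have /integrableP[_] := fi; congr (_ < _)%E; apply/esym.
pose tau := ((fun z => (z + h : R * R)) : P -> P).
have mh : measurable_fun setT tau := measurable_shift h.
have mabs : measurable_fun [set: P] (fun z => (`|(f z)%:E|)%E).
  by apply: measurableT_comp => //; exact/measurable_EFinP.
transitivity (\int[pushforward (@area R) tau]_z `|(f z)%:E|)%E.
  exact/esym/(ge0_integral_pushforward mh (@area R) measurableT).
by apply: eq_measure_integral => A mA _; exact: area_translate.
Qed.

Lemma Rint_shift (h : R * R) (f : P -> R) : integ f -> ∫ (fun z => f (z + h : R * R)) = ∫ f.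
Proof.
move=> fi; have mf := integ_meas fi; rewrite /Rintegral; congr fine.
pose tau := ((fun z => (z + h : R * R)) : P -> P).
have mh : measurable_fun setT tau := measurable_shift h.
transitivity (\int[pushforward (@area R) tau]_z (f z)%:E)%E.
  apply/esym/(integral_pushforward mh (mu := @area R) (D := setT)) => //.
    exact/measurable_EFinP.
  exact: integ_shift.
by apply: eq_measure_integral => A mA _; exact: area_translate.
Qed.

End Area.

(** * Smooth functions and test functions *)

Section FlatFunctions.
Context {R : realType}.
Implicit Types (p : {poly R}) (s t : R).

Definition flat p t : R := if 0 < t then p.[t^-1] * expR (- t^-1) else 0.

Lemma expn_exp_bounded n s : 0 <= s -> s ^+ n * expR (- s) <= n`!%:R.
Proof.
move=> s0; rewrite expRN ler_pdivrMr ?expR_gt0//.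
case: n => [|n]; first by rewrite expr0 fact0 mul1r (le_trans _ (expR_ge1Dx s))// lerDl.
have := expR_ge1Dxn n s0; rewrite -ler_pdivrMl ?ltr0n ?fact_gt0// => h.
by rewrite (le_trans _ h)// mulrC lerDr.
Qed.

Lemma poly_exp_bounded p : exists2 C, 0 <= C &
  forall s, 0 <= s -> `|p.[s] * expR (- s)| <= C.
Proof.
exists (\sum_(i < size p) `|p`_i| * i`!%:R).
  by apply: sumr_ge0 => i _; rewrite mulr_ge0.
move=> s s0; rewrite horner_coef mulr_suml (le_trans (ler_norm_sum _ _ _))//.
apply: ler_sum => i _; rewrite -mulrA normrM ler_wpM2l//.
rewrite ger0_norm; first exact: expn_exp_bounded.
by rewrite mulr_ge0 ?exprn_ge0 ?expR_ge0.
Qed.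

Lemma flat_bounded p : exists2 C, 0 <= C & forall t, `|flat p t| <= C.
Proof.
have [C C0 pC] := poly_exp_bounded p; exists C => // t; rewrite /flat.
by case: ltP => [t0|_]; [apply: pC; rewrite invr_ge0 ltW|rewrite normr0].
Qed.

Lemma flat_quadratic p : exists2 C, 0 <= C & forall t, `|flat p t| <= C * t ^+ 2.
Proof.
have [C C0 pC] := flat_bounded ('X^2 * p); exists C => // t.
have := pC t; rewrite /flat; case: ltP => [t0|_]; last first.
  by rewrite !normr0 mulr_ge0 ?sqr_ge0.
rewrite hornerM hornerXn -mulrA normrM => h.
rewrite -ler_pdivrMr ?exprn_gt0//; apply: le_trans h.
by rewrite mulrC exprVn [`|t ^- 2|]ger0_norm// invr_ge0 sqr_ge0.
Qed.

Lemma is_derive_flat0 p : is_derive (0 : R) 1 (flat p) 0.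
Proof.
have [C C0 pC] := flat_quadratic p.
have H : h^-1 *: (flat p (h *: 1 + 0) - flat p 0) @[h --> 0^'] --> (0 : R).
  apply/cvgrPdist_le => e e0; near=> h.
  rewrite sub0r normrN addr0 [h *: 1]mulr1 [flat p 0]/flat ltxx subr0 normrZ.
  have h0 : h != 0 by near: h; exact: nbhs_dnbhs_neq.
  rewrite normfV ler_pdivrMl ?normr_gt0// (le_trans (pC h))//.
  rewrite -(real_normK (num_real h)) expr2 mulrA (mulrC _ e) ler_wpM2r//.
  have : `|h| < e / (C + 1).
    near: h; apply: dnbhs0_lt; rewrite divr_gt0// ltr_wpDl//.
  rewrite ltr_pdivlMr ?ltr_wpDl// => h1; apply: le_trans (ltW h1).
  by rewrite mulrC ler_wpM2l// lerDl.
apply: DeriveDef; first by apply/cvg_ex; exists 0.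
exact: cvg_lim H.
Unshelve. all: by end_near. Qed.

Lemma is_derive_flat p t : is_derive t 1 (flat p) (flat ('X^2 * (p - p^`())) t).
Proof.
have [t0|t0|->] := ltgtP t 0.
- rewrite [X in is_derive _ _ _ X](_ : _ = 0); last by rewrite /flat ltNge ltW.
  apply: (@near_eq_is_derive _ _ _ (cst 0)).
    near=> s; rewrite /flat ltNge ltW//; near: s; exact: lt_nbhsl.
- rewrite {2}/flat t0.
  apply: (@near_eq_is_derive _ _ _ (fun s => p.[s^-1] * expR (- s^-1))).
    near=> s; rewrite /flat ifT//; near: s; exact: lt_nbhsr.
  have tn0 : t != 0 by rewrite gt_eqF.
  have d1 : is_derive t 1 (fun s : R => s^-1) (- t ^- 2).
    by apply: is_derive_eq (is_deriveV tn0 (is_derive_id _ _)) _; rewrite [_ *: _]mulr1.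
  have d2 : is_derive t 1 (fun s : R => p.[s^-1]) (p^`().[t^-1] * (- t ^- 2)).
    exact: (@is_derive1_comp _ (horner p) (fun s => s^-1)).
  have d3 : is_derive t 1 (fun s : R => expR (- s^-1)) (expR (- t^-1) * t ^- 2).
    apply: (@is_derive1_comp _ expR (fun s => - s^-1)).
    by apply: is_derive_eq (is_deriveN d1) _; rewrite opprK.
  apply: is_derive_eq (is_deriveM d2 d3) _.
  rewrite hornerM hornerXn hornerD hornerN exprVn /GRing.scale /=.
  ring.
- rewrite [X in is_derive _ _ _ X](_ : _ = 0); last by rewrite /flat ltxx.
  exact: is_derive_flat0.
Unshelve. all: by end_near. Qed.

End FlatFunctions.

Section SmoothPlane.
Context {R : realType}.
Implicit Types (f g phi : R * R -> R) (z : R * R).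

Lemma is_derive_line f z (v : R * R) (d : R) :
  is_derive z v f d <-> is_derive (0 : R) 1 (fun h : R => f (h *: v + z)) d.
Proof.
have E : (fun h : R => h^-1 *: ((f \o shift z) (h *: v) - f z)) =
  (fun h : R => h^-1 *: (((fun h : R => f (h *: v + z)) \o shift 0) (h *: (1:R)) -
     (fun h : R => f (h *: v + z)) 0)).
  by rewrite funeqE => h /=; rewrite addr0 scale0r add0r [_%:A]mulr1.
have E2 : 'D_v f z = 'D_1 (fun h : R => f (h *: v + z)) 0 by rewrite /derive E.
split=> -[h1 h2]; apply: DeriveDef.
- exact: (proj1 (derivable1P _ _ _) h1).
- by rewrite -E2.
- exact: (proj2 (derivable1P _ _ _) h1).
- by rewrite E2.
Qed.

Lemma is_derive_chain (h : R -> R) f z (v : R * R) (c d : R) :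
  is_derive (f z) 1 h c -> is_derive z v f d -> is_derive z v (h \o f) (c * d).
Proof.
move=> hc /is_derive_line fd; apply/is_derive_line.
apply: (@is_derive1_comp _ h (fun t : R => f (t *: v + z))).
by rewrite scale0r add0r.
Qed.

Lemma dxP f z : differentiable f z -> is_derive z ((1, 0) : R * R) f (dx f z).
Proof. by move=> df; apply: derivableP; exact: diff_derivable. Qed.

Lemma dyP f z : differentiable f z -> is_derive z ((0, 1) : R * R) f (dy f z).
Proof. by move=> df; apply: derivableP; exact: diff_derivable. Qed.

Lemma dxE f z (d : R) : is_derive z ((1, 0) : R * R) f d -> dx f z = d.
Proof. by case. Qed.

Lemma dyE f z (d : R) : is_derive z ((0, 1) : R * R) f d -> dy f z = d.
Proof. by case. Qed.

Definition smooth f := forall k, Ck k f.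

Lemma Ck_pred k f : Ck k.+1 f -> Ck k f.
Proof.
elim: k f => [|k IH] f.
  by case=> df _ _ z; exact: differentiable_continuous.
by case=> df /IH h1 /IH h2.
Qed.

Lemma Ck_cst k (c : R) : Ck k (fun=> c).
Proof.
elim: k c => [|k IH] c; first by move=> z; exact: cst_continuous.
split=> [z||]; first exact: differentiable_cst.
- have -> : dx (fun=> c) = (fun=> 0) :> (R * R -> R); last exact: IH.
  by apply/funext => z; apply: dxE; exact: is_derive_cst.
- have -> : dy (fun=> c) = (fun=> 0) :> (R * R -> R); last exact: IH.
  by apply/funext => z; apply: dyE; exact: is_derive_cst.
Qed.

Lemma CkD k f g : Ck k f -> Ck k g -> Ck k (fun z => f z + g z).
Proof.
elim: k f g => [|k IH] f g; first by move=> fc gc z; exact: cvgD (fc z) (gc z).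
move=> [df fx fy] [dg gx gy]; split=> [z||]; first exact: differentiableD.
- have -> : dx (fun z => f z + g z) = (fun z => dx f z + dx g z); last exact: IH.
  by apply/funext => z; apply: dxE; exact: (is_deriveD (dxP (df z)) (dxP (dg z))).
- have -> : dy (fun z => f z + g z) = (fun z => dy f z + dy g z); last exact: IH.
  by apply/funext => z; apply: dyE; exact: (is_deriveD (dyP (df z)) (dyP (dg z))).
Qed.

Lemma dxM f g z : differentiable f z -> differentiable g z ->
  dx (fun z => f z * g z) z = f z * dx g z + g z * dx f z.
Proof. by move=> df dg; apply: dxE; exact: (is_deriveM (dxP df) (dxP dg)). Qed.

Lemma dyM f g z : differentiable f z -> differentiable g z ->
  dy (fun z => f z * g z) z = f z * dy g z + g z * dy f z.
Proof. by move=> df dg; apply: dyE; exact: (is_deriveM (dyP df) (dyP dg)). Qed.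

Lemma CkM k f g : Ck k f -> Ck k g -> Ck k (fun z => f z * g z).
Proof.
elim: k f g => [|k IH] f g; first by move=> fc gc z; exact: cvgM (fc z) (gc z).
move=> cf cg; have [f0 g0] := (Ck_pred cf, Ck_pred cg).
case: cf cg => df fx fy [dg gx gy].
split=> [z||]; first exact: differentiableM.
- have -> : dx (fun z => f z * g z) = (fun z => f z * dx g z + g z * dx f z).
    by apply/funext => z; exact: dxM.
  by apply: CkD; exact: IH.
- have -> : dy (fun z => f z * g z) = (fun z => f z * dy g z + g z * dy f z).
    by apply/funext => z; exact: dyM.
  by apply: CkD; exact: IH.
Qed.

Section Composition.
Variables (D : set R) (h : nat -> R -> R).
Hypothesis dh : forall n t, D t -> is_derive t 1 (h n) (h n.+1 t).

Lemma Ck_comp k n f : (forall z, D (f z)) -> Ck k f -> Ck k (h n \o f).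
Proof.
move=> Df; elim: k n => [|k IH] n cf.
  move=> z; apply: continuous_comp; first exact: cf.
  have [hd _] := dh n (Df z).
  exact/differentiable_continuous/derivable1_diffP.
have f0 := Ck_pred cf; case: cf => df fx fy; split=> [z||].
- apply: differentiable_comp => //; have [hd _] := dh n (Df z).
  exact/derivable1_diffP.
- have -> : dx (h n \o f) = (fun z => (h n.+1 \o f) z * dx f z).
    apply/funext => z; apply: dxE; apply: is_derive_chain; [exact: dh|exact: dxP].
  by apply: CkM => //; exact: IH.
- have -> : dy (h n \o f) = (fun z => (h n.+1 \o f) z * dy f z).
    apply/funext => z; apply: dyE; apply: is_derive_chain; [exact: dh|exact: dyP].
  by apply: CkM => //; exact: IH.
Qed.

End Composition.

Lemma smooth_cst (c : R) : smooth (fun=> c).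
Proof. by move=> k; exact: Ck_cst. Qed.

Lemma smoothD f g : smooth f -> smooth g -> smooth (fun z => f z + g z).
Proof. by move=> sf sg k; exact: CkD. Qed.

Lemma smoothM f g : smooth f -> smooth g -> smooth (fun z => f z * g z).
Proof. by move=> sf sg k; exact: CkM. Qed.

Lemma smoothZ (c : R) f : smooth f -> smooth (fun z => c * f z).
Proof. by move=> sf; apply: smoothM => //; exact: smooth_cst. Qed.

Lemma smoothN f : smooth f -> smooth (fun z => - f z).
Proof.
move=> sf; have -> : (fun z => - f z) = (fun z => -1 * f z).
  by apply/funext => z; rewrite mulN1r.
exact: smoothZ.
Qed.

Lemma smoothB f g : smooth f -> smooth g -> smooth (fun z => f z - g z).
Proof. by move=> sf sg; apply: smoothD => //; exact: smoothN. Qed.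

Lemma smooth_sum (I : Type) (s : seq I) (F : I -> R * R -> R) :
  (forall i, smooth (F i)) -> smooth (fun z => \sum_(i <- s) F i z).
Proof.
move=> sF; elim: s => [|i s IH].
  under eq_fun do rewrite big_nil; exact: smooth_cst.
by under eq_fun do rewrite big_cons; exact: smoothD.
Qed.

Lemma is_derive_fst z (v : R * R) : is_derive z v (fst : R * R -> R) v.1.
Proof.
apply/is_derive_line.
have -> : (fun h : R => (h *: v + z).1) = (fun h : R => h * v.1 + z.1) by [].
apply: is_derive_eq (is_deriveD (is_deriveM (is_derive_id _ _) (is_derive_cst _ _ _)) (is_derive_cst _ _ _)) _.
by rewrite /GRing.scale /=; ring.
Qed.

Lemma is_derive_snd z (v : R * R) : is_derive z v (snd : R * R -> R) v.2.
Proof.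
apply/is_derive_line.
have -> : (fun h : R => (h *: v + z).2) = (fun h : R => h * v.2 + z.2) by [].
apply: is_derive_eq (is_deriveD (is_deriveM (is_derive_id _ _) (is_derive_cst _ _ _)) (is_derive_cst _ _ _)) _.
by rewrite /GRing.scale /=; ring.
Qed.

Lemma smooth_fst : smooth (fst : R * R -> R).
Proof.
case=> [|k]; first by move=> z; exact: cvg_fst.
split=> [z||]; first by apply: linear_differentiable => ?; exact: cvg_fst.
- have -> : dx (fst : R * R -> R) = (fun=> 1); last exact: Ck_cst.
  by apply/funext => z; apply: dxE; exact: is_derive_fst.
- have -> : dy (fst : R * R -> R) = (fun=> 0); last exact: Ck_cst.
  by apply/funext => z; apply: dyE; exact: is_derive_fst.
Qed.

Lemma smooth_snd : smooth (snd : R * R -> R).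
Proof.
case=> [|k]; first by move=> z; exact: cvg_snd.
split=> [z||]; first by apply: linear_differentiable => ?; exact: cvg_snd.
- have -> : dx (snd : R * R -> R) = (fun=> 0); last exact: Ck_cst.
  by apply/funext => z; apply: dxE; exact: is_derive_snd.
- have -> : dy (snd : R * R -> R) = (fun=> 1); last exact: Ck_cst.
  by apply/funext => z; apply: dyE; exact: is_derive_snd.
Qed.

Lemma smooth_flat (p : {poly R}) f : smooth f -> smooth (flat p \o f).
Proof.
move=> sf k; pose h n := flat (iter n (fun p : {poly R} => 'X^2 * (p - p^`())) p).
by apply: (@Ck_comp setT h _ k 0) => // n t _; exact: is_derive_flat.
Qed.

Lemma smooth_exp f : smooth f -> smooth (expR \o f).
Proof.
move=> sf k.
by apply: (@Ck_comp setT (fun=> expR) _ k 0) => // n t _; exact: is_derive_expR.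
Qed.

Let invs n (t : R) := (-1) ^+ n * n`!%:R * t ^- n.+1.

Let is_derive_invs n (t : R) : 0 < t -> is_derive t 1 (invs n) (invs n.+1 t).
Proof.
move=> t0; have tn0 : t != 0 by rewrite gt_eqF.
have dX : is_derive t 1 (fun s : R => s ^+ n.+1) (n.+1%:R * t ^+ n).
  by apply: DeriveDef; [exact: exprn_derivable|rewrite exp_derive [_ *: _]mulr1].
have dV : is_derive t 1 (fun s : R => (s ^+ n.+1)^-1) _ := @is_deriveV _ (fun s : R => s ^+ n.+1) t _ _ (expf_neq0 n.+1 tn0) dX.
rewrite {1}/invs; apply: is_derive_eq (is_deriveM (is_derive_cst ((-1) ^+ n * n`!%:R : R) _ _) dV) _.
rewrite /invs /GRing.scale /= factS natrM !exprS.
by field; rewrite tn0 expf_neq0.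
Qed.

Lemma smooth_inv f : (forall z, 0 < f z) -> smooth f -> smooth (fun z => (f z)^-1).
Proof.
move=> f0 sf k.
have -> : (fun z => (f z)^-1) = invs 0 \o f.
  by apply/funext => z /=; rewrite /invs expr0 fact0 !mul1r expr1.
by apply: (@Ck_comp [set t | 0 < t] invs _ k 0) => // n t; exact: is_derive_invs.
Qed.

Lemma smooth_ln f : (forall z, 0 < f z) -> smooth f -> smooth (fun z => ln (f z)).
Proof.
move=> f0 sf k.
pose h n := if n is n'.+1 then invs n' else @ln R.
apply: (@Ck_comp [set t | 0 < t] h _ k 0) => // -[|n] t t0; last exact: is_derive_invs.
rewrite /= /invs expr0 fact0 !mul1r expr1; exact: is_derive1_ln.
Qed.

Lemma smooth_differentiable f z : smooth f -> differentiable f z.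
Proof. by move=> /(_ 1%N) []. Qed.

Lemma smooth_continuous f : smooth f -> continuous f.
Proof. by move=> /(_ 0%N). Qed.

Lemma smooth_dx f : smooth f -> smooth (dx f).
Proof. by move=> sf k; have [] := sf k.+1. Qed.

Lemma smooth_dy f : smooth f -> smooth (dy f).
Proof. by move=> sf k; have [] := sf k.+1. Qed.

End SmoothPlane.

Section LocallyIntegrable.
Context {R : realType}.
Local Notation P := (measurableTypeR R * measurableTypeR R)%type.
Local Notation integ f := ((@area R).-integrable setT (EFin \o f)).
Local Notation mea f := (@measurable_fun _ _ P R setT f).
Local Notation "'∫' f" := (Rintegral (@area R) setT f) (at level 10, f at level 9).
Local Notation sqi := (@sqint _ P R (@area R)).
Local Notation ile g := (@integ_le _ P R (@area R) _ g).
Local Notation ibnd C := (@integ_bndM _ P R (@area R) C).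
Implicit Types (f g phi : R * R -> R) (z : R * R) (n : R).

Lemma ball_plane z w (e : R) :
  ball z e w <-> `|z.1 - w.1| < e /\ `|z.2 - w.2| < e.
Proof. by []. Qed.

Lemma open_measurable_plane (U : set (R * R)) : open U -> measurable (U : set P).
Proof.
move=> oU.
pose box (i : rat * rat * nat) : set P := ball (ratr i.1.1 : R) i.2.+1%:R^-1 `*` ball (ratr i.1.2 : R) i.2.+1%:R^-1.
have -> : U = \bigcup_(i in [set: rat * rat * nat]) (if pselect (box i `<=` U) then box i else set0).
  apply/seteqP; split => z.
    move=> Uz; have [e e0 zU] : exists2 e : R, 0 < e & ball z e `<=` U.
      by move: oU => /(_ _ Uz) /nbhs_ballP [e e0 ?]; exists e.
    have [k ke] : exists k : nat, (k.+1%:R)^-1 < e / 2.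
      have e2 : 0 < e / 2 by rewrite divr_gt0.
      exists (Num.truncn (e / 2)^-1); rewrite invf_plt ?posrE//.
      exact: truncnS_gt.
    have k0 : 0 < (k.+1%:R)^-1 :> R by rewrite invr_gt0.
    have ex (x : R) : exists q : rat, `|ratr q - x| < (k.+1%:R)^-1.
      have xk : x - k.+1%:R^-1 < x + k.+1%:R^-1 by rewrite ltrBlDr -addrA ltrDl addr_gt0.
      have [q] := rat_in_itvoo xk; rewrite in_itv /= => /andP[h1 h2]; exists q; rewrite ltr_norml ltrBrDr ltrBlDr.
      by rewrite (addrC _ x) h1 addrC h2.
    have [[q1 h1] [q2 h2]] := (ex z.1, ex z.2).
    exists ((q1, q2), k) => //; case: pselect => [?|] /=; first by split.
    case=> w [/= w1 w2]; apply: zU; split => /=.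
      change (`|z.1 - w.1| < e); rewrite (_ : z.1 - w.1 = - (ratr q1 - z.1) + (ratr q1 - w.1)); last by ring.
      rewrite (le_lt_trans (ler_normD _ _))// normrN (splitr e) ltrD//; exact: lt_trans ke.
    change (`|z.2 - w.2| < e); rewrite (_ : z.2 - w.2 = - (ratr q2 - z.2) + (ratr q2 - w.2)); last by ring.
    rewrite (le_lt_trans (ler_normD _ _))// normrN (splitr e) ltrD//; exact: lt_trans ke.
  by case=> i _; case: pselect => /= [iU /iU|].
apply: countable_bigcupT_measurable; first exact: countableP.
move=> i; case: pselect => ? /=; last exact: measurable0.
apply: measurableX; exact: measurable_ball.
Qed.

Lemma closed_measurable_plane (F : set (R * R)) : closed F -> measurable (F : set P).
Proof.
move=> cF; rewrite -(setCK F); apply: measurableC; apply: open_measurable_plane.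
exact: closed_openC.
Qed.

Lemma continuous_mea f : continuous f -> mea f.
Proof.
move=> /continuousP cf; apply: (measurability _ (RGenOpens.measurableE R)).
move=> _ [_ [a [b ->] <-]]; rewrite setTI; apply: open_measurable_plane; apply: cf.
exact: interval_open.
Qed.

Lemma smooth_mea f : smooth f -> mea f.
Proof. by move=> sf; apply: continuous_mea; exact: smooth_continuous. Qed.

Definition bounded_on (D : set (R * R)) f := exists C, forall z, D z -> `|f z| <= C.

Lemma squareE n z : square n z <-> `|z.1| <= n /\ `|z.2| <= n.
Proof. by rewrite /square /= !in_itv /= !ler_norml; split=> -[]. Qed.

Lemma squareS n m : n <= m -> square n `<=` square m.
Proof.
by move=> nm z /squareE[h1 h2]; apply/squareE; split; [exact: le_trans h1 nm|exact: le_trans h2 nm].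
Qed.

Lemma compact_square n : compact (square n : set (R * R)).
Proof. by apply: compact_setX; exact: segment_compact. Qed.

Lemma closed_square n : closed (square n : set (R * R)).
Proof. by apply: (@compact_closed (R * R)%type); [exact: norm_hausdorff|exact: compact_square]. Qed.

Lemma compact_in_square (K : set (R * R)) : compact K -> exists2 n, 0 <= n & K `<=` square n.
Proof.
move=> /compact_bounded [M [_ hM]].
exists (`|M| + 1); first by rewrite addr_ge0.
move=> z Kz; have MM : M < `|M| + 1 by rewrite (le_lt_trans (ler_norm M))// ltrDl.
have : Num.max `|z.1| `|z.2| <= `|M| + 1 := hM _ MM z Kz.
by rewrite ge_max => /andP h; apply/squareE.
Qed.

Lemma continuous_bounded_on (K : set (R * R)) f : continuous f -> compact K -> bounded_on K f.
Proof.
move=> cf cK.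
have : compact (f @` K) by apply: continuous_compact => //; exact: continuous_subspaceT.
move=> /compact_bounded [M [_ hM]]; exists (`|M| + 1) => z Kz.
apply: (hM (`|M| + 1)); last by exists z.
by rewrite (le_lt_trans (ler_norm M))// ltrDl.
Qed.

Definition tame n f := [/\ mea f, bounded_on setT f & forall z, ~ square n z -> f z = 0].

Definition locint f := mea f /\ forall n, 0 <= n -> integ (fun z => \1_(square n) z * f z).

Lemma mea_indic (A : set P) : measurable A -> mea (\1_A : P -> R).
Proof. exact: measurable_indic. Qed.

Lemma mea_square n : mea (\1_(square n) : R * R -> R).
Proof. by apply: mea_indic; exact: measurable_square. Qed.

Lemma integ_indic_square n : 0 <= n -> integ (\1_(square n) : R * R -> R).
Proof.
move=> n0; have mS := measurable_square n.
apply/integrableP; split; first by apply/measurable_EFinP; exact: mea_indic mS.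
rewrite (eq_integral (fun z : P => (\1_(square n : set P) z)%:E)); last first.
  by move=> t _; rewrite gee0_abs// lee_fin.
by rewrite integral_indic// setIT [X in (X < _)%E](area_square n0) ltry.
Qed.

Lemma indic_norm_le1 (A : set P) z : `|\1_A z : R| <= 1.
Proof. by rewrite indicE; case: (_ \in _); rewrite ?normr1 ?normr0. Qed.

Lemma integ_locint f : integ f -> locint f.
Proof.
move=> fi; split=> [|n n0]; first exact: integ_meas fi.
apply: (ibnd 1) => //; first exact: mea_square.
by move=> z; exact: indic_norm_le1.
Qed.

Lemma bounded_locint f : mea f -> (forall n, bounded_on (square n) f) -> locint f.
Proof.
move=> mf bf; split=> // n n0; have [C hC] := bf n.
apply: (ile (fun z => C * \1_(square n) z)).
- by apply: measurable_funM => //; exact: mea_square.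
- exact/integZ/integ_indic_square.
- move=> z; rewrite indicE; case: (boolP (z \in _)) => h; last by rewrite mul0r normr0 mulr0.
  by rewrite mul1r mulr1; apply: hC; exact: set_mem.
Qed.

Lemma continuous_locint f : continuous f -> locint f.
Proof.
move=> cf; apply: bounded_locint; first exact: continuous_mea.
by move=> n; apply: continuous_bounded_on => //; exact: compact_square.
Qed.

Lemma locintM C f g : mea f -> (forall z, `|f z| <= C) -> locint g ->
  locint (fun z => f z * g z).
Proof.
move=> mf fC [mg gi]; split=> [|n n0]; first exact: measurable_funM.
have -> : (fun z => \1_(square n) z * (f z * g z)) = (fun z => f z * (\1_(square n) z * g z)).
  by apply/funext => z; rewrite mulrCA.
apply: (ibnd C) => //; exact: gi.
Qed.

Lemma locint_bndM f g : mea f -> (forall n, bounded_on (square n) f) -> locint g ->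
  locint (fun z => f z * g z).
Proof.
move=> mf bf [mg gi]; split=> [|n n0]; first exact: measurable_funM.
have [C hC] := bf n.
apply: (ile (fun z => `|C| * `|\1_(square n) z * g z|)).
- apply: measurable_funM; first exact: mea_square.
  exact: measurable_funM.
- exact/integZ/integ_norm/gi.
- move=> z; rewrite mulrCA normrM; case: (pselect (square n z)) => h.
    by rewrite ler_wpM2r// (le_trans (hC z h)) ?ler_norm.
  by rewrite indicE memNset// mul0r normr0 !mulr0.
Qed.

Lemma locintD f g : locint f -> locint g -> locint (fun z => f z + g z).
Proof.
move=> [mf fi] [mg gi]; split=> [|n n0]; first exact: measurable_funD.
have -> : (fun z => \1_(square n) z * (f z + g z)) =
    (fun z => \1_(square n) z * f z + \1_(square n) z * g z).
  by apply/funext => z; rewrite mulrDr.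
by apply: integD; [exact: fi|exact: gi].
Qed.

Lemma locintZ c f : locint f -> locint (fun z => c * f z).
Proof. by move=> fi; apply: (@locintM `|c|) => // z. Qed.

Lemma sqi_locint f : sqi f -> locint f.
Proof.
move=> [mf fi]; split=> // n n0; apply: sqint_mul; last by split.
split; first exact: mea_square.
apply: (ile (\1_(square n))); last 1 first.
- move=> z; rewrite indicE; case: (_ \in _); rewrite ?expr1n ?expr0n ?normr1 ?normr0//.
- apply: measurable_funX; exact: mea_square.
- exact: integ_indic_square.
Qed.

Lemma tameS n m f : n <= m -> tame n f -> tame m f.
Proof.
move=> nm [mf bf f0]; split => // z zm; apply: f0 => /(squareS nm); exact: zm.
Qed.

Lemma tame_mul n f g : 0 <= n -> tame n f -> locint g -> integ (fun z => f z * g z).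
Proof.
move=> n0 [mf [C fC] f0] [mg /(_ n n0) gi].
have -> : (fun z => f z * g z) = (fun z => f z * (\1_(square n) z * g z)).
  apply/funext => z; rewrite indicE; case: (boolP (z \in _)) => h; first by rewrite mul1r.
  by rewrite f0 ?mul0r// => /mem_set; apply/negP.
by apply: (ibnd C) => // z; exact: fC.
Qed.

Lemma tame_integ n f : 0 <= n -> tame n f -> integ f.
Proof.
move=> n0 tf; have := tame_mul n0 tf (continuous_locint (@cst_continuous _ _ (1 : R))).
have -> : (fun z => f z * 1) = f by apply/funext => z; rewrite mulr1.
exact.
Qed.

Lemma tameM n f g : mea f -> bounded_on (square n) f -> tame n g -> tame n (fun z => f z * g z).
Proof.
move=> mf [C fC] [mg [D gD] g0]; split; first exact: measurable_funM.
- exists (`|C| * `|D|) => z _; rewrite normrM; case: (pselect (square n z)) => h.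
    by rewrite ler_pM// ?(le_trans (fC _ h)) ?(le_trans (gD _ I)) ?ler_norm.
  by rewrite g0// normr0 mulr0 mulr_ge0.
- by move=> z h; rewrite g0// mulr0.
Qed.

Lemma tameD n f g : tame n f -> tame n g -> tame n (fun z => f z + g z).
Proof.
move=> [mf [C fC] f0] [mg [D gD] g0]; split; first exact: measurable_funD.
- by exists (C + D) => z _; rewrite (le_trans (ler_normD _ _))// lerD ?fC ?gD.
- by move=> z h; rewrite f0// g0// addr0.
Qed.

Lemma tameZ n c f : tame n f -> tame n (fun z => c * f z).
Proof. by apply: tameM => //; exists `|c|. Qed.

Lemma tame_sq n f : tame n f -> tame n (fun z => f z ^+ 2).
Proof.
move=> tf; have [mf [C fC] f0] := tf.
have -> : (fun z => f z ^+ 2) = (fun z => f z * f z) by apply/funext => z; rewrite expr2.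
by apply: tameM => //; exists C => z _; exact: fC.
Qed.

Lemma tame_sqi n f : 0 <= n -> tame n f -> sqi f.
Proof. by move=> n0 tf; split; [case: tf|apply: tame_integ n0 _; exact: tame_sq]. Qed.

End LocallyIntegrable.

Section TestFunctions.
Context {R : realType}.
Local Notation P := (measurableTypeR R * measurableTypeR R)%type.
Local Notation integ f := ((@area R).-integrable setT (EFin \o f)).
Local Notation mea f := (@measurable_fun _ _ P R setT f).
Local Notation "'∫' f" := (Rintegral (@area R) setT f) (at level 10, f at level 9).
Local Notation sqi := (@sqint _ P R (@area R)).
Local Notation ile g := (@integ_le _ P R (@area R) _ g).
Local Notation ibnd C := (@integ_bndM _ P R (@area R) C).
Implicit Types (f g phi psi : P -> R) (z : R * R) (n : R) (Om : set (R * R)).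

Local Notation supp f := (closure [set z : R * R | f z != 0]).

Lemma supp_zero phi z : ~ supp phi z -> \forall w \near (z : R * R), phi w = 0.
Proof.
move=> nz; have oS : open (~` (supp phi)) by rewrite openC; exact: closed_closure.
have /= : nbhs z (~` (supp phi)) by exact: open_nbhs_nbhs.
apply: filterS => w /= nw; apply/eqP/negPn/negP => h; apply: nw; exact: subset_closure.
Qed.

Lemma supp0 phi z : ~ supp phi z -> phi z = 0.
Proof. by move=> /supp_zero /nbhs_singleton. Qed.

Lemma deriv_off_supp phi z (v : R * R) : ~ supp phi z -> 'D_v phi z = 0.
Proof.
move=> /supp_zero h; rewrite (@near_eq_derive _ _ _ _ (cst 0)) ?derive_cst//.
Qed.

Lemma test_smooth Om phi : test_function Om phi -> smooth phi.
Proof. by case. Qed.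

Lemma smooth_tame n phi : smooth phi -> (forall z, ~ square n z -> phi z = 0) -> tame n phi.
Proof.
move=> sp h; split => //; first exact: smooth_mea.
have [C hC] := continuous_bounded_on (smooth_continuous sp) (@compact_square R n).
exists `|C| => z _; case: (pselect (square n z)) => [/hC h1|/h ->]; last by rewrite normr0.
exact: le_trans h1 (ler_norm C).
Qed.

Lemma test_tame Om phi : test_function Om phi -> exists2 n, 0 <= n & tame n phi.
Proof.
move=> tp; have [n n0 sn] := compact_in_square (let: And3 _ c _ := tp in c).
exists n => //; apply: smooth_tame; first exact: test_smooth tp.
by move=> z nz; apply: supp0 => /sn; exact: nz.
Qed.

Lemma tame_dxy n phi : smooth phi -> (forall z, ~ square n z -> phi z = 0) ->
  tame n (dx phi) /\ tame n (dy phi).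
Proof.
move=> sp h.
have sub z : ~ square n z -> ~ supp phi z.
  move=> nz; apply: contra_not nz; rewrite (closure_id (square n)).1; last exact: closed_square.
  by apply: closureS => w /= /eqP pw; apply: contrapT => /h.
split; apply: smooth_tame.
- exact: smooth_dx.
- by move=> z /sub; exact: deriv_off_supp.
- exact: smooth_dy.
- by move=> z /sub; exact: deriv_off_supp.
Qed.

Lemma smooth_test Om (K : set (R * R)) phi : smooth phi -> compact K -> K `<=` Om ->
  (forall z, ~ K z -> phi z = 0) -> test_function Om phi.
Proof.
move=> sp cK KO h.
have clK : closed K by apply: (@compact_closed (R * R)%type) => //; exact: norm_hausdorff.
have sub : supp phi `<=` K.
  rewrite (closure_id K).1//; apply: closureS => z /= /eqP pz; by apply: contrapT => /h.
split=> //; last exact: subset_trans sub KO.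
by apply: subclosed_compact sub => //; exact: closed_closure.
Qed.

Lemma tame_shift n (h : R * R) f : 0 <= n -> tame n f ->
  tame (n + `|h.1| + `|h.2|) (fun z => f (z + h : R * R)).
Proof.
move=> n0 [mf [C fC] f0]; split; first exact: mea_shift.
- by exists C => z _; exact: fC.
- move=> z nz; apply: f0 => /squareE /= [h1 h2]; apply: nz; apply/squareE; split.
    have -> : z.1 = z.1 + h.1 - h.1 by ring.
    by rewrite (le_trans (ler_normB _ _))// -addrA lerD// lerDl.
  have -> : z.2 = z.2 + h.2 - h.2 by ring.
  by rewrite (le_trans (ler_normB _ _))// lerD// (le_trans h2)// lerDl.
Qed.

Lemma is_derive_opp_dir f z (v : R * R) (d : R) :
  is_derive z v f d -> is_derive z (- v) f (- d).
Proof.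
move=> /is_derive_line fd; apply/is_derive_line.
have -> : (fun h : R => f (h *: - v + z : R * R)) = (fun h : R => f (h *: v + z : R * R)) \o -%R.
  by apply/funext => h /=; rewrite scalerN scaleNr.
rewrite -mulrN1; by apply: is_derive1_comp; rewrite oppr0.
Qed.

Lemma is_derive_under n (c H Hv : P -> R) (v : R * R) (s : R) : 0 <= n -> locint c ->
  tame n H -> tame n Hv -> (forall z : R * R, is_derive z v H (Hv z)) ->
  is_derive s 1 (fun s : R => ∫ (fun z => c z * H (z + s *: v : R * R)))
    (∫ (fun z => c z * Hv (z + s *: v : R * R))).
Proof.
move=> n0 lc tH tHv dH.
have [mHv [C hC] Hv0] := tHv.
have C0 : 0 <= C by apply: le_trans (normr_ge0 _) (hC (0, 0) I).
pose f (t : R) (z : P) := c z * H (z + t *: v : R * R).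
pose m := n + (`|s| + 1) * (`|v.1| + `|v.2|).
have m0 : 0 <= m by rewrite addr_ge0// mulr_ge0// addr_ge0.
have s1 : s \in `](s - 1), (s + 1)[ by rewrite in_itv /= ltrBlDr ltrDl ltr01.
have df (t : R) z : is_derive t 1 (f ^~ z) (c z * Hv (z + t *: v : R * R)).
  have dHt : is_derive t 1 (fun t : R => H (z + t *: v : R * R)) (Hv (z + t *: v : R * R)).
    have /is_derive_line h := dH (z + t *: v : R * R).
    have -> : (fun t : R => H (z + t *: v : R * R)) =
      (fun h : R => H (h *: v + (z + t *: v) : R * R)) \o (fun r => r - t).
      by apply/funext => r /=; congr H; rewrite addrCA -scalerDl addrNK.
    rewrite -[X in is_derive _ _ _ X]mulr1; apply: is_derive1_comp; first by rewrite subrr.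
    by apply: is_derive_eq (is_deriveB (is_derive_id _ _) (is_derive_cst _ _ _)) _; rewrite subr0.
  apply: is_derive_eq (is_deriveM (is_derive_cst (c z) _ _) dHt) _.
  by rewrite /GRing.scale /= mulr0 addr0.
have d1f (t : R) z : partial1of2 f t z = c z * Hv (z + t *: v : R * R).
  by rewrite partial1of2E; have [_ ->] := df t z.
pose G (z : P) := C * `|\1_(square m) z * c z|.
have iG : integ G by apply: integZ; apply: integ_norm; exact: (lc.2 m m0).
have icH (t : R) : integ (f t).
  have := tame_mul _ (tame_shift (t *: v) n0 tH) lc.
  have -> : (fun z : P => H (z + t *: v : R * R) * c z) = f t.
    by apply/funext => z; rewrite mulrC.
  by apply; rewrite !addr_ge0.
have Gub (t : R) z : `](s - 1), (s + 1)[%classic t -> `|partial1of2 f t z| <= G z.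
  rewrite /= in_itv /= => /andP[t1 t2]; rewrite d1f /G.
  have ts : `|t| <= `|s| + 1.
    have h : `|t - s| <= 1 by rewrite ler_norml; apply/andP; split; lra.
    have -> : t = s + (t - s) by ring.
    by rewrite (le_trans (ler_normD _ _))// lerD2l.
  case: (pselect (square m z)) => sz.
    by rewrite indicE mem_set// mul1r normrM mulrC ler_wpM2r ?hC.
  rewrite Hv0 ?mulr0 ?normr0 ?mulr_ge0// => /squareE /= [h1 h2]; apply: sz; apply/squareE.
  have key (a b w : R) : `|a + t * w| <= n -> `|w| <= b -> `|a| <= n + (`|s| + 1) * b.
    move=> h w1; have -> : a = a + t * w - t * w by ring.
    rewrite (le_trans (ler_normB _ _))// lerD// normrM ler_pM//.
  by split; [apply: key h1 _|apply: key h2 _]; rewrite ?lerDl ?lerDr.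
have Gge0 z : 0 <= G z by rewrite mulr_ge0.
have := @cvg_differentiation_under_integral R _ P (@area R) f setT measurableT s (s - 1) (s + 1) s1
  (fun t _ => icH t) (fun t z _ _ => let: DeriveDef h _ := df t z in h) G Gge0 iG (fun t z h _ => Gub t z h).
set F := (fun x' : R => \int[@area R]_y f x' y).
have -> : (\int[@area R]_y partial1of2 f s y) = \int[@area R]_z (c z * Hv (z + s *: v : R * R)).
  by apply: eq_Rintegral => z _; exact: d1f.
move=> cv.
have cv' : h^-1 *: ((F \o shift s) (h *: (1:R)) - F s) @[h --> 0^'] -->
   \int[@area R]_z (c z * Hv (z + s *: v : R * R)).
  have -> : (fun h : R => h^-1 *: ((F \o shift s) (h *: (1:R)) - F s)) =
     (fun h : R => h^-1 *: (F (h + s) - F s)).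
    by apply/funext => h /=; rewrite [_ *: 1]mulr1.
  exact: cv.
by apply: DeriveDef; [apply/cvg_ex; exists (\int[@area R]_z (c z * Hv (z + s *: v : R * R)))|exact: cvg_lim cv'].
Qed.

End TestFunctions.

(** * Bump functions and mollifiers *)

Section Bumps.
Context {R : realType}.
Local Notation P := (measurableTypeR R * measurableTypeR R)%type.
Local Notation integ f := ((@area R).-integrable setT (EFin \o f)).
Local Notation mea f := (@measurable_fun _ _ P R setT f).
Local Notation "'∫' f" := (Rintegral (@area R) setT f) (at level 10, f at level 9).
Local Notation sqi := (@sqint _ P R (@area R)).
Local Notation ile g := (@integ_le _ P R (@area R) _ g).
Local Notation ibnd C := (@integ_bndM _ P R (@area R) C).
Implicit Types (s t e : R).

Lemma flat1E t : 0 < t -> flat 1 t = expR (- t^-1).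
Proof. by move=> t0; rewrite /flat t0 hornerC mul1r. Qed.

Lemma flat_le0 (p : {poly R}) t : t <= 0 -> flat p t = 0.
Proof. by move=> t0; rewrite /flat ltNge t0. Qed.

Lemma flat1_ge0 t : 0 <= flat 1 t.
Proof. by case: (ltP 0 t) => t0; [rewrite flat1E// expR_ge0|rewrite flat_le0]. Qed.

Lemma flat1_gt0 t : 0 < t -> 0 < flat 1 t.
Proof. by move=> t0; rewrite flat1E// expR_gt0. Qed.

Lemma flat1_lb t : 2^-1 <= t -> expR (- 2) <= flat 1 t.
Proof.
move=> t2; have t0 : 0 < t by lra.
by rewrite flat1E// ler_expR lerN2 -(invrK 2) lef_pV2 ?posrE.
Qed.

Lemma is_derive_flat_comp (p : {poly R}) (f : R -> R) t (d : R) : is_derive t 1 f d ->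
  is_derive t 1 (fun s => flat p (f s)) (flat ('X^2 * (p - p^`())) (f t) * d).
Proof. by move=> df; apply: (@is_derive1_comp _ (flat p) f); exact: is_derive_flat. Qed.

Let q1 : {poly R} := 'X^2 * (1 - 1^`()).

Definition bump t : R := flat 1 (1 + t) * flat 1 (1 - t).
Definition dbump t : R := flat q1 (1 + t) * flat 1 (1 - t) - flat 1 (1 + t) * flat q1 (1 - t).

Lemma is_derive_bump t : is_derive t 1 bump (dbump t).
Proof.
have d1 : is_derive t 1 (fun s : R => 1 + s) 1.
  by apply: is_derive_eq (is_deriveD (is_derive_cst _ _ _) (is_derive_id _ _)) _; rewrite add0r.
have d2 : is_derive t 1 (fun s : R => 1 - s) (-1).
  by apply: is_derive_eq (is_deriveB (is_derive_cst _ _ _) (is_derive_id _ _)) _; rewrite sub0r.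
apply: is_derive_eq (is_deriveM (is_derive_flat_comp 1 d1) (is_derive_flat_comp 1 d2)) _.
rewrite /dbump /q1 /GRing.scale /=; ring.
Qed.

Lemma bump_ge0 t : 0 <= bump t.
Proof. by rewrite mulr_ge0 ?flat1_ge0. Qed.

Lemma bump0 t : 1 <= `|t| -> bump t = 0.
Proof.
rewrite ler_normr => /orP[h|h].
  by rewrite /bump (@flat_le0 _ (1 - t)) ?mulr0// subr_le0.
by rewrite /bump (@flat_le0 _ (1 + t)) ?mul0r//; lra.
Qed.

Lemma bump_lb t : `|t| <= 2^-1 -> expR (- 4) <= bump t.
Proof.
rewrite ler_norml => /andP[h1 h2]; have -> : - 4 = - 2 + - 2 :> R by ring.
by rewrite expRD ler_pM ?expR_ge0// flat1_lb//; lra.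
Qed.

Lemma bumpN t : bump (- t) = bump t.
Proof. by rewrite /bump opprK mulrC. Qed.

Lemma bump_bounded : exists2 C : R, 0 <= C & forall t, `|bump t| <= C /\ `|dbump t| <= C.
Proof.
have [C C0 hC] := flat_bounded (1 : {poly R}); have [D D0 hD] := flat_bounded q1.
exists (C * C + D * C + C * D); first by rewrite !addr_ge0// mulr_ge0.
move=> t; split.
  rewrite -addrA ler_wpDr ?addr_ge0 ?mulr_ge0//.
  by rewrite normrM ler_pM.
rewrite -addrA ler_wpDl ?mulr_ge0// (le_trans (ler_normB _ _))//.
by rewrite !normrM lerD// ler_pM.
Qed.

Lemma smooth_bump (f : R * R -> R) : smooth f -> smooth (fun z => bump (f z)).
Proof.
move=> sf; apply: smoothM; apply: (smooth_flat 1).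
  by apply: smoothD => //; exact: smooth_cst.
by apply: smoothB => //; exact: smooth_cst.
Qed.

Let den t : R := flat 1 (2 * t - 1) + flat 1 (2 - 2 * t).

Definition step t : R := flat 1 (2 * t - 1) / den t.

Let den_lb t : expR (- 2) <= den t.
Proof.
have [h|h] := leP t (3 / 4).
  by rewrite ler_wpDl ?flat1_ge0// flat1_lb//; lra.
by rewrite ler_wpDr ?flat1_ge0// flat1_lb//; lra.
Qed.

Let den_gt0 t : 0 < den t.
Proof. exact: lt_le_trans (expR_gt0 _) (den_lb t). Qed.

Lemma step_le t : t <= 2^-1 -> step t = 0.
Proof. by move=> h; rewrite /step flat_le0 ?mul0r//; lra. Qed.

Lemma step_ge t : 1 <= t -> step t = 1.
Proof.
move=> h; rewrite /step /den (@flat_le0 _ (2 - 2 * t)); last lra.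
by rewrite addr0 divff// gt_eqF// flat1_gt0//; lra.
Qed.

Lemma step_bounds t : 0 <= step t <= 1.
Proof.
rewrite divr_ge0 ?flat1_ge0 ?(ltW (den_gt0 t))//=.
by rewrite ler_pdivrMr// mul1r lerDl flat1_ge0.
Qed.

Lemma step_lipschitz : exists2 C : R, 0 <= C &
  forall t, exists2 d : R, is_derive t 1 step d & `|d| <= C.
Proof.
have [C C0 hC] := flat_bounded (1 : {poly R}); have [D D0 hD] := flat_bounded q1.
pose m : R := expR (-2); have m0 : 0 < m by exact: expR_gt0.
exists ((2 * D) * m^-1 + C * (m^-1 ^+ 2 * (2 * D + 2 * D))).
  by rewrite !(addr_ge0, mulr_ge0) ?exprn_ge0 ?invr_ge0 ?(ltW m0).
move=> t.
have d1 : is_derive t 1 (fun s : R => 2 * s - 1) 2.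
  apply: is_derive_eq (is_deriveB (is_deriveM (is_derive_cst (2 : R) _ _) (is_derive_id _ _)) (is_derive_cst _ _ _)) _.
  by rewrite /GRing.scale /=; ring.
have d2 : is_derive t 1 (fun s : R => 2 - 2 * s) (-2).
  apply: is_derive_eq (is_deriveB (is_derive_cst _ _ _) (is_deriveM (is_derive_cst (2 : R) _ _) (is_derive_id _ _))) _.
  by rewrite /GRing.scale /=; ring.
have e1 := is_derive_flat_comp 1 d1; have e2 := is_derive_flat_comp 1 d2.
have e3 : is_derive t 1 den (flat q1 (2 * t - 1) * 2 + flat q1 (2 - 2 * t) * (-2)) := is_deriveD e1 e2.
have dn0 : den t != 0 by rewrite gt_eqF.
have e4 := is_deriveV dn0 e3.
exists (flat 1 (2 * t - 1) * (- den t ^- 2 * (flat q1 (2 * t - 1) * 2 + flat q1 (2 - 2 * t) * (-2))) +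
   (den t)^-1 * (flat q1 (2 * t - 1) * 2)).
  exact: is_deriveM e1 e4.
rewrite (le_trans (ler_normD _ _))// addrC lerD//.
  rewrite !normrM mulrC ler_pM ?mulr_ge0//.
    by rewrite (ger0_norm (_ : 0 <= 2))// mulrC ler_wpM2l.
  by rewrite ger0_norm ?invr_ge0 ?(ltW (den_gt0 t))// lef_pV2 ?posrE// den_lb.
rewrite !normrM ler_pM ?mulr_ge0// ler_pM//.
  rewrite normrN -exprVn ger0_norm ?exprn_ge0 ?invr_ge0 ?(ltW (den_gt0 t))//.
  rewrite ler_pXn2r ?nnegrE ?invr_ge0 ?(ltW (den_gt0 t)) ?(ltW m0)//.
  by rewrite lef_pV2 ?posrE// den_lb.
rewrite (le_trans (ler_normD _ _))// !normrM normrN (ger0_norm (_ : 0 <= 2))//.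
by rewrite lerD// mulrC ler_wpM2l.
Qed.

Lemma smooth_step (f : R * R -> R) : smooth f -> smooth (fun z => step (f z)).
Proof.
move=> sf.
have s1 : smooth (fun z => flat 1 (2 * f z - 1)).
  apply: (smooth_flat 1); apply: smoothB; [exact: smoothZ|exact: smooth_cst].
have s2 : smooth (fun z => flat 1 (2 - 2 * f z)).
  apply: (smooth_flat 1); apply: smoothB; [exact: smooth_cst|exact: smoothZ].
apply: smoothM => //; apply: smooth_inv => [z|]; first exact: den_gt0.
exact: smoothD.
Qed.

End Bumps.

Section Mollifier.
Context {R : realType}.
Local Notation P := (measurableTypeR R * measurableTypeR R)%type.
Local Notation integ f := ((@area R).-integrable setT (EFin \o f)).
Local Notation mea f := (@measurable_fun _ _ P R setT f).
Local Notation "'∫' f" := (Rintegral (@area R) setT f) (at level 10, f at level 9).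
Local Notation sqi := (@sqint _ P R (@area R)).
Local Notation ile g := (@integ_le _ P R (@area R) _ g).
Local Notation ibnd C := (@integ_bndM _ P R (@area R) C).
Implicit Types (x y z h : R * R).
Variable e : R.
Hypothesis e0 : 0 < e.

Let bs (t : R) := bump (t / e).
Let dbs (t : R) := dbump (t / e) / e.

Definition mass := ∫ (fun h : P => bs h.1 * bs h.2).
Definition moll h := mass^-1 * (bs h.1 * bs h.2).
Definition mollx h := mass^-1 * (dbs h.1 * bs h.2).
Definition molly h := mass^-1 * (bs h.1 * dbs h.2).
Definition mollxy h := mass^-1 * (dbs h.1 * dbs h.2).

Let is_derive_bs (t : R) : is_derive t 1 bs (dbs t).
Proof.
apply: (@is_derive1_comp _ bump (fun t => t / e)); first exact: is_derive_bump.
apply: is_derive_eq (is_deriveM (is_derive_id _ _) (is_derive_cst e^-1 _ _)) _.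
by rewrite /GRing.scale /=; ring.
Qed.

Let smooth_bs (f : R * R -> R) : smooth f -> smooth (fun z => bs (f z)).
Proof.
move=> sf; apply: smooth_bump; apply: smoothM => //; exact: smooth_cst.
Qed.

Let scale_ge1 (t : R) : e < `|t| -> 1 <= `|t / e|.
Proof.
by move=> h; rewrite normrM normfV (gtr0_norm e0) ler_pdivlMr// mul1r ltW.
Qed.

Let bs0 t : e < `|t| -> bs t = 0.
Proof. by move=> /scale_ge1/bump0. Qed.

Let bs_ge0 t : 0 <= bs t. Proof. exact: bump_ge0. Qed.

Let off_square h : ~ square e h -> e < `|h.1| \/ e < `|h.2|.
Proof.
move=> hs; case: (ltP e `|h.1|) => h1; first by left.
case: (ltP e `|h.2|) => h2; first by right.
by exfalso; apply: hs; apply/squareE.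
Qed.

Let smooth_k : smooth (fun h : R * R => bs h.1 * bs h.2).
Proof. by apply: smoothM; apply: smooth_bs; [exact: smooth_fst|exact: smooth_snd]. Qed.

Let k0 h : ~ square e h -> bs h.1 * bs h.2 = 0.
Proof. by move=> /off_square[/bs0 ->|/bs0 ->]; rewrite ?mul0r ?mulr0. Qed.

Let tame_k : tame e (fun h : R * R => bs h.1 * bs h.2).
Proof. exact: smooth_tame smooth_k k0. Qed.

Lemma mass_lb : expR (- 8) * e ^+ 2 <= mass.
Proof.
have e2 : 0 <= e / 2 by rewrite divr_ge0 ?(ltW e0).
have -> : expR (- 8) * e ^+ 2 = ∫ (fun h : P => expR (- 8) * \1_(square (e / 2)) h).
  rewrite RintZ; last exact: integ_indic_square.
  congr (_ * _); rewrite /Rintegral.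
  rewrite integral_indic//; last exact: measurable_square.
  rewrite setIT [X in fine X](area_square e2) /=.
  by rewrite mulrCA mulfV ?mulr1.
apply: Rint_le.
- exact/integZ/integ_indic_square.
- exact: tame_integ (ltW e0) tame_k.
- move=> h; rewrite indicE; case: (boolP (h \in _)) => hs; last first.
    by rewrite mulr0 mulr_ge0.
  have -> : - 8 = - 4 + - 4 :> R by ring.
  move: hs; rewrite inE => /squareE[h1 h2].
  have hb t : `|t| <= e / 2 -> expR (- 4) <= bs t.
    by move=> ht; apply: bump_lb; rewrite normrM normfV (gtr0_norm e0) ler_pdivrMr// mulrC.
  by rewrite mulr1 expRD ler_pM ?expR_ge0// hb.
Qed.

Lemma mass_gt0 : 0 < mass.
Proof. by apply: lt_le_trans mass_lb; rewrite mulr_gt0 ?expR_gt0 ?exprn_gt0. Qed.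

Lemma moll_ge0 h : 0 <= moll h.
Proof. by rewrite mulr_ge0 ?invr_ge0 ?(ltW mass_gt0)// mulr_ge0. Qed.

Lemma smooth_moll : smooth (moll : R * R -> R).
Proof. exact: smoothZ. Qed.

Lemma mollN h : moll (- h) = moll h.
Proof. by rewrite /moll /bs /= !mulNr !bumpN. Qed.

Lemma moll0 h : ~ square e h -> moll h = 0.
Proof. by move=> hs; rewrite /moll k0// mulr0. Qed.

Lemma Rint_moll : ∫ moll = 1.
Proof.
rewrite /moll RintZ; last exact: tame_integ (ltW e0) tame_k.
by rewrite mulVf// gt_eqF// mass_gt0.
Qed.

Lemma is_derive_mollx h : is_derive h ((1, 0) : R * R) (moll : R * R -> R) (mollx h).
Proof.
have d1 : is_derive h ((1, 0) : R * R) (fun h : R * R => bs h.1) (dbs h.1 * 1).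
  by apply: (@is_derive_chain _ bs fst); [exact: is_derive_bs|exact: is_derive_fst].
have d2 : is_derive h ((1, 0) : R * R) (fun h : R * R => bs h.2) (dbs h.2 * 0).
  by apply: (@is_derive_chain _ bs snd); [exact: is_derive_bs|exact: is_derive_snd].
apply: is_derive_eq (is_deriveM (is_derive_cst mass^-1 _ _) (is_deriveM d1 d2)) _.
by rewrite /mollx /GRing.scale /=; ring.
Qed.

Lemma is_derive_molly h : is_derive h ((0, 1) : R * R) (moll : R * R -> R) (molly h).
Proof.
have d1 : is_derive h ((0, 1) : R * R) (fun h : R * R => bs h.1) (dbs h.1 * 0).
  by apply: (@is_derive_chain _ bs fst); [exact: is_derive_bs|exact: is_derive_fst].
have d2 : is_derive h ((0, 1) : R * R) (fun h : R * R => bs h.2) (dbs h.2 * 1).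
  by apply: (@is_derive_chain _ bs snd); [exact: is_derive_bs|exact: is_derive_snd].
apply: is_derive_eq (is_deriveM (is_derive_cst mass^-1 _ _) (is_deriveM d1 d2)) _.
by rewrite /molly /GRing.scale /=; ring.
Qed.

Lemma dx_moll : dx (moll : R * R -> R) = mollx.
Proof. by apply/funext => h; rewrite (dxE (is_derive_mollx h)). Qed.

Lemma dy_moll : dy (moll : R * R -> R) = molly.
Proof. by apply/funext => h; rewrite (dyE (is_derive_molly h)). Qed.

Lemma is_derive_mollx_y h : is_derive h ((0, 1) : R * R) (mollx : R * R -> R) (mollxy h).
Proof.
have d1 : is_derive h ((0, 1) : R * R) (fun h : R * R => dbs h.1) 0.
  apply/is_derive_line; rewrite [X in is_derive _ _ X](_ : _ = cst (dbs h.1)).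
    exact: is_derive_cst.
  by apply/funext => t /=; rewrite [_ *: _]mulr0 add0r.
have d2 : is_derive h ((0, 1) : R * R) (fun h : R * R => bs h.2) (dbs h.2 * 1).
  by apply: (@is_derive_chain _ bs snd); [exact: is_derive_bs|exact: is_derive_snd].
apply: is_derive_eq (is_deriveM (is_derive_cst mass^-1 _ _) (is_deriveM d1 d2)) _.
by rewrite /mollxy /GRing.scale /=; ring.
Qed.

Lemma is_derive_molly_x h : is_derive h ((1, 0) : R * R) (molly : R * R -> R) (mollxy h).
Proof.
have d1 : is_derive h ((1, 0) : R * R) (fun h : R * R => dbs h.2) 0.
  apply/is_derive_line; rewrite [X in is_derive _ _ X](_ : _ = cst (dbs h.2)).
    exact: is_derive_cst.
  by apply/funext => t /=; rewrite [_ *: _]mulr0 add0r.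
have d2 : is_derive h ((1, 0) : R * R) (fun h : R * R => bs h.1) (dbs h.1 * 1).
  by apply: (@is_derive_chain _ bs fst); [exact: is_derive_bs|exact: is_derive_fst].
apply: is_derive_eq (is_deriveM (is_derive_cst mass^-1 _ _) (is_deriveM d2 d1)) _.
by rewrite /mollxy /GRing.scale /=; ring.
Qed.

Lemma tame_moll : tame e moll.
Proof. exact: smooth_tame smooth_moll moll0. Qed.

Lemma tame_mollx : tame e mollx.
Proof. by rewrite -dx_moll; have [] := tame_dxy smooth_moll moll0. Qed.

Lemma tame_molly : tame e molly.
Proof. by rewrite -dy_moll; have [] := tame_dxy smooth_moll moll0. Qed.

Lemma tame_mollxy : tame e mollxy.
Proof.
have -> : mollxy = dy (mollx : R * R -> R).
  by apply/funext => h; rewrite (dyE (is_derive_mollx_y h)).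
have [_ _ h] := tame_mollx; rewrite -dx_moll in h *.
by have [] := tame_dxy (smooth_dx smooth_moll) h.
Qed.

End Mollifier.

Lemma moll_grad_bound {R : realType} : exists2 K : R, 0 <= K & forall e : R, 0 < e ->
  forall h, `|mollx e h| <= K / e ^+ 3 /\ `|molly e h| <= K / e ^+ 3.
Proof.
have [C C0 hC] := @bump_bounded R.
exists (expR 8 * (C * C)); first by rewrite !mulr_ge0 ?expR_ge0.
move=> e e0 h.
have e2 : 0 < e ^+ 2 by rewrite exprn_gt0.
have mi : `|(mass e)^-1| <= expR 8 * e ^- 2.
  rewrite ger0_norm ?invr_ge0 ?(ltW (mass_gt0 e0))//.
  have -> : expR 8 * e ^- 2 = (expR (- 8) * e ^+ 2)^-1.
    by rewrite [expR (- 8)]expRN [RHS]invfM invrK.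
  by rewrite lef_pV2 ?posrE ?mass_gt0 ?mulr_gt0 ?expR_gt0// mass_lb.
have key (a b : R) : `|a| <= C -> `|b| <= C -> `|(mass e)^-1 * (a / e * b)| <= expR 8 * (C * C) / e ^+ 3.
  move=> ha hb; have -> : expR 8 * (C * C) / e ^+ 3 = (expR 8 * e ^- 2) * ((C / e) * C).
    by field; rewrite gt_eqF.
  rewrite normrM ler_pM// normrM ler_pM// normrM ler_pM//.
  by rewrite ger0_norm// invr_ge0 ltW.
rewrite /mollx /molly; split; first by apply: key; have [] := hC (h.1 / e); have [] := hC (h.2 / e).
by rewrite (mulrC (bump _)); apply: key; have [] := hC (h.1 / e); have [] := hC (h.2 / e).
Qed.

Section Convolution.
Context {R : realType}.
Local Notation P := (measurableTypeR R * measurableTypeR R)%type.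
Local Notation integ f := ((@area R).-integrable setT (EFin \o f)).
Local Notation mea f := (@measurable_fun _ _ P R setT f).
Local Notation "'∫' f" := (Rintegral (@area R) setT f) (at level 10, f at level 9).
Local Notation sqi := (@sqint _ P R (@area R)).
Local Notation ile g := (@integ_le _ P R (@area R) _ g).
Local Notation ibnd C := (@integ_bndM _ P R (@area R) C).
Implicit Types (x y z h : R * R) (n m : R).

Lemma Rint0 : ∫ (fun=> 0) = 0.
Proof. by rewrite /Rintegral integral0. Qed.

Definition conv (c H : P -> R) x := ∫ (fun y : P => c y * H (y - x : R * R)).

Section Kernel.
Variables (c H : P -> R) (n : R).
Hypotheses (n0 : 0 <= n) (lc : locint c) (tH : tame n H).

Lemma conv_integrand x : integ (fun y : P => c y * H (y - x : R * R)).
Proof.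
have := tame_mul _ (tame_shift (- x) n0 tH) lc.
have -> : (fun z : P => H (z - x : R * R) * c z) = (fun y : P => c y * H (y - x : R * R)).
  by apply/funext => z; rewrite mulrC.
by apply; rewrite !addr_ge0.
Qed.

Lemma mea_kernel : measurable_fun setT (fun w : P * P => c w.2 * H (w.2 - w.1 : R * R)).
Proof.
have [mH _ _] := tH; have [mc _] := lc.
apply: measurable_funM; first exact: (measurableT_comp mc measurable_snd).
have msub : measurable_fun setT (fun w : P * P => (w.2 - w.1 : R * R) : P).
  apply: measurable_fun_pair; apply: measurable_funB.
  - exact: (measurableT_comp measurable_fst measurable_snd).
  - exact: (measurableT_comp measurable_fst measurable_fst).
  - exact: (measurableT_comp measurable_snd measurable_snd).
  - exact: (measurableT_comp measurable_snd measurable_fst).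
exact: (measurableT_comp mH msub).
Qed.

Lemma kernel_bound : exists2 C : R, 0 <= C & forall m x y, square m x ->
  `|c y * H (y - x)| <= C * `|\1_(square (m + n)) y * c y|.
Proof.
have [_ [C hC] H0] := tH.
have C0 : 0 <= C by apply: le_trans (normr_ge0 _) (hC (0, 0) I).
exists C => // m x y /squareE[x1 x2].
case: (pselect (square (m + n) y)) => sy.
  by rewrite indicE mem_set// mul1r normrM mulrC ler_wpM2r ?hC.
rewrite H0 ?mulr0 ?normr0 ?mulr_ge0// => /squareE /= [h1 h2]; apply: sy; apply/squareE.
have key (a b : R) : `|a - b| <= n -> `|b| <= m -> `|a| <= m + n.
  move=> h k; have -> : a = b + (a - b) by ring.
  by rewrite (le_trans (ler_normD _ _))// lerD.
by split; [apply: key h1 x1|apply: key h2 x2].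
Qed.

Let tensor (g : P -> R) m (g0 : forall z, ~ square m z -> g z = 0) : exists2 C : R, 0 <= C & forall x y,
  `|g x * (c y * H (y - x))| <= `|g x| * (C * `|\1_(square (m + n)) y * c y|).
Proof.
have [C C0 hC] := kernel_bound; exists C => // x y.
case: (pselect (square m x)) => sx; first by rewrite normrM ler_wpM2l// hC.
by rewrite g0// normr0 !mul0r normr0.
Qed.

Let mea_tensor (g : P -> R) : mea g ->
  measurable_fun setT (fun w : P * P => g w.1 * (c w.2 * H (w.2 - w.1 : R * R))).
Proof.
move=> mg; apply: measurable_funM; first exact: (measurableT_comp mg measurable_fst).
exact: mea_kernel.
Qed.

Let integ_tensor (C m : R) : 0 <= m -> integ (fun y : P => C * `|\1_(square (m + n)) y * c y|).
Proof. by move=> m0; apply: integZ; apply: integ_norm; apply: lc.2; rewrite addr_ge0. Qed.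

Lemma supp_conv_integ (g : P -> R) m : 0 <= m -> integ g ->
  (forall z, ~ square m z -> g z = 0) -> integ (fun x => g x * conv c H x).
Proof.
move=> m0 ig g0; have mg := integ_meas ig; have [C C0 hC] := tensor g0.
have := @tensor_integ1 _ _ P P R (@area R) (@area R) _ _ _ (mea_tensor mg)
  (integ_norm ig) (integ_tensor C m0) hC.
congr (_.-integrable _ (EFin \o _)); apply/funext => x.
by rewrite /= RintZ//; exact: conv_integrand.
Qed.

Lemma conv_fubini (g : P -> R) m : 0 <= m -> integ g ->
  (forall z, ~ square m z -> g z = 0) ->
  ∫ (fun x => g x * conv c H x) = ∫ (fun y => c y * ∫ (fun x : P => g x * H (y - x : R * R))).
Proof.
move=> m0 ig g0; have mg := integ_meas ig; have [C C0 hC] := tensor g0.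
have := @tensor_fubini _ _ P P R (@area R) (@area R) _ _ _ (mea_tensor mg)
  (integ_norm ig) (integ_tensor C m0) hC.
rewrite (_ : \int[area (R:=R)]_x _ = ∫ (fun x => g x * conv c H x)); last first.
  by apply: Rint_ext => x /=; rewrite RintZ//; exact: conv_integrand.
move=> ->; apply: Rint_ext => y /=.
case: (eqVneq (c y) 0) => [->|cy0].
  by rewrite mul0r -[RHS]Rint0; apply: Rint_ext => x; rewrite mul0r mulr0.
rewrite -RintZ; first by apply: Rint_ext => x; rewrite mulrCA.
have := @tensor_section2 _ _ P P R (@area R) _ _ _ (mea_tensor mg)
  (integ_norm ig) hC y.
move=> /(integZ (c y)^-1); congr (_.-integrable _ (EFin \o _)); apply/funext => x /=.
by rewrite mulrCA mulKf.
Qed.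

Lemma mea_conv : mea (conv c H).
Proof.
have h (k : nat) : mea (fun x => \1_(square k%:R) x * conv c H x).
  apply: integ_meas; apply: (@supp_conv_integ _ k%:R) => //.
    exact: integ_indic_square.
  by move=> z nz; rewrite indicE memNset.
apply: (@measurable_fun_cvg _ P R setT (fun k x => \1_(square k%:R) x * conv c H x)) => // x _.
apply: (@cvg_trans _ (cst (conv c H x) @ \oo)); last exact: cvg_cst.
apply: near_eq_cvg; near=> k => /=.
rewrite indicE mem_set ?mul1r//; apply/squareE.
have : Num.max `|x.1| `|x.2| <= k%:R by near: k; exact: nbhs_infty_ger.
by rewrite ge_max => /andP.
Unshelve. all: by end_near. Qed.

Lemma conv_bounded m : 0 <= m -> bounded_on (square m) (conv c H).
Proof.
move=> m0; have [C C0 hC] := kernel_bound.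
exists (∫ (fun y : P => C * `|\1_(square (m + n)) y * c y|)) => x sx.
apply: Rint_abs_le; [exact: integ_meas (conv_integrand x)|exact: integ_tensor|].
by move=> y; exact: hC.
Qed.

Lemma conv_locint : locint (conv c H).
Proof.
apply: bounded_locint; first exact: mea_conv.
move=> m; case: (leP 0 m) => m0; first exact: conv_bounded.
exists 0 => z /squareE[z1 _]; have := le_trans (normr_ge0 _) z1; by rewrite leNgt m0.
Qed.

Lemma conv_shift x : conv c H x = ∫ (fun h : P => c (h + x : R * R) * H h).
Proof.
rewrite /conv -(Rint_shift x (conv_integrand x)); apply: Rint_ext => h.
by rewrite addrK.
Qed.

(* The change of variables [y = x + h]. *)
Lemma conv_swap (g : P -> R) m : 0 <= m -> tame m g -> bounded_on (square (m + n)) c ->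
  ∫ (fun x => g x * conv c H x) = ∫ (fun h => H h * ∫ (fun x : P => g x * c (x + h : R * R))).
Proof.
move=> m0 tg [C hC]; have [mg [D hD] g0] := tg; have [mH _ H0] := tH; have [mc _] := lc.
pose F (w : P * P) := g w.1 * (c (w.2 + w.1 : R * R) * H w.2).
have mF : measurable_fun setT F.
  apply: measurable_funM; first exact: (measurableT_comp mg measurable_fst).
  apply: measurable_funM; last exact: (measurableT_comp mH measurable_snd).
  have mad : measurable_fun setT (fun w : P * P => (w.2 + w.1 : R * R) : P).
    apply: measurable_fun_pair; apply: measurable_funD.
    - exact: (measurableT_comp measurable_fst measurable_snd).
    - exact: (measurableT_comp measurable_fst measurable_fst).
    - exact: (measurableT_comp measurable_snd measurable_snd).
    - exact: (measurableT_comp measurable_snd measurable_fst).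
  exact: (measurableT_comp mc mad).
have hF x h : `|F (x, h)| <= (`|C| * `|g x|) * `|H h|.
  rewrite /F /= !normrM mulrCA mulrA.
  case: (pselect (square m x)) => sx; last by rewrite g0// normr0 !(mulr0, mul0r).
  case: (pselect (square n h)) => sh; last by rewrite H0// normr0 !(mulr0, mul0r).
  rewrite ler_wpM2r// ler_wpM2r// (le_trans (hC _ _)) ?ler_norm//; apply/squareE.
  move: sx sh => /squareE[x1 x2] /squareE[h1 h2].
  by split; rewrite /= (le_trans (ler_normD _ _))// addrC lerD.
have ig : integ (fun x : P => `|C| * `|g x|) by exact/integZ/integ_norm/(tame_integ m0 tg).
have iH : integ (fun h : P => `|H h|) by exact/integ_norm/(tame_integ n0 tH).
have := tensor_fubini mF ig iH hF.
rewrite (_ : \int[area (R:=R)]_x _ = ∫ (fun x => g x * conv c H x)); last first.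
  apply: Rint_ext => x; rewrite conv_shift /F /= RintZ//.
  have := integ_shift x (conv_integrand x).
  by congr (_.-integrable _ (EFin \o _)); apply/funext => h; rewrite addrK.
move=> ->; apply: Rint_ext => h /=.
case: (eqVneq (H h) 0) => [h0|hn0].
  by rewrite h0 mul0r -[RHS]Rint0; apply: Rint_ext => x; rewrite /F /= h0 !mulr0.
rewrite -RintZ; first by apply: Rint_ext => x; rewrite /F /= (addrC h) mulrA mulrC.
have := @tensor_section2 _ _ P P R (@area R) F _ _ mF ig hF h.
move=> /(integZ (H h)^-1); congr (_.-integrable _ (EFin \o _)); apply/funext => x /=.
by rewrite /F /= (addrC h); field.
Qed.

End Kernel.

Lemma conv_derive (c H Hv : P -> R) n (v : R * R) x : 0 <= n -> locint c ->
  tame n H -> tame n Hv -> (forall z : R * R, is_derive z v H (Hv z)) ->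
  is_derive x v (conv c H) (- conv c Hv x).
Proof.
move=> n0 lc tH tHv dH; apply/is_derive_line.
have nn : 0 <= n + `|(- x).1| + `|(- x).2| by rewrite !addr_ge0.
have dH' z : is_derive z (- v) (fun z : R * R => H (z - x : R * R)) (- Hv (z - x : R * R)).
  apply: is_derive_opp_dir; apply/is_derive_line.
  have /is_derive_line := dH (z - x : R * R).
  by congr is_derive; apply/funext => t; rewrite addrA.
have tHv' : tame (n + `|(- x).1| + `|(- x).2|) (fun z : R * R => - Hv (z - x : R * R)).
  have := tameZ (-1) (tame_shift (- x) n0 tHv).
  by congr tame; apply/funext => z; rewrite mulN1r.
have := is_derive_under 0 nn lc (tame_shift (- x) n0 tH) tHv' dH'.
have -> : (fun h : R => conv c H (h *: v + x)) =
  (fun s : R => ∫ (fun z => c z * H (z + s *: - v - x : R * R))).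
  apply/funext => s; apply: Rint_ext => z; congr (_ * H _).
  by rewrite scalerN opprD addrA.
congr is_derive; rewrite -RintN; last exact: conv_integrand n0 lc tHv x.
by apply: Rint_ext => z; rewrite scale0r addr0 mulrN.
Qed.

End Convolution.

(** * Density of smooth functions *)

Section Density.
Context {R : realType}.
Local Notation P := (measurableTypeR R * measurableTypeR R)%type.
Local Notation integ f := ((@area R).-integrable setT (EFin \o f)).
Local Notation mea f := (@measurable_fun _ _ P R setT f).
Local Notation "'∫' f" := (Rintegral (@area R) setT f) (at level 10, f at level 9).
Local Notation sqi := (@sqint _ P R (@area R)).
Local Notation ile g := (@integ_le _ P R (@area R) _ g).
Local Notation ibnd C := (@integ_bndM _ P R (@area R) C).
Implicit Types (x y z : R * R) (f g : P -> R).

#[export] Instance area_ae_filter : Filter (almost_everywhere (@area R)).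
Proof. exact: (ae_filter_ringOfSetsType (@area R)). Qed.

Lemma dct0 (F : nat -> P -> R) (G : P -> R) : (forall k, mea (F k)) -> integ G ->
  (forall k z, `|F k z| <= G z) ->
  {ae (@area R), forall z, F k z @[k --> \oo] --> (0 : R)} ->
  ∫ (F k) @[k --> \oo] --> (0 : R).
Proof.
move=> mF iG FG F0.
have [||||_ _] := @dominated_convergence _ P R (@area R) setT measurableT
  (fun k z => (F k z)%:E) (cst 0%E) (EFin \o G) _ _ _ iG.
- by move=> k; exact/measurable_EFinP.
- exact: measurable_cst.
- by apply: filterS F0 => z h _ /=; apply: cvg_EFin => //; exact: nearW.
- by apply: aeW => z k _ /=; rewrite lee_fin.
by rewrite integral0 => /fine_cvg.
Qed.

Variables (th : P -> R) (n : R).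
Hypotheses (n0 : 0 <= n) (tth : tame n th).

Let D f := ∫ (fun z => (f z * th z) ^+ 2).
Let good f := mea f /\ sqi (fun z => f z * th z).

Let Dge0 f : 0 <= D f.
Proof. by apply: Rint_ge0 => z; exact: sqr_ge0. Qed.

Let good_bounded f : mea f -> bounded_on (square n) f -> good f.
Proof. by move=> mf bf; split=> //; apply: tame_sqi n0 _; exact: tameM. Qed.

Let good_smooth f : smooth f -> good f.
Proof.
move=> sf; apply: good_bounded; first exact: smooth_mea.
by apply: continuous_bounded_on; [exact: smooth_continuous|exact: compact_square].
Qed.

Let goodD f g : good f -> good g -> good (fun z => f z + g z).
Proof.
move=> [mf sf] [mg sg]; split; first exact: measurable_funD.
have -> : (fun z => (f z + g z) * th z) = (fun z => f z * th z + g z * th z).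
  by apply/funext => z; rewrite mulrDl.
exact: sqintD.
Qed.

Let goodZ c f : good f -> good (fun z => c * f z).
Proof.
move=> [mf sf]; split; first exact: measurable_funM.
have -> : (fun z => (c * f z) * th z) = (fun z => c * (f z * th z)).
  by apply/funext => z; rewrite mulrA.
exact: sqintZ.
Qed.

Let goodB f g : good f -> good g -> good (fun z => f z - g z).
Proof.
move=> gf /(goodZ (-1)) gg.
have -> : (fun z => f z - g z) = (fun z => f z + -1 * g z).
  by apply/funext => z; rewrite mulN1r.
exact: goodD.
Qed.

Let D_le f g h : mea f -> good g -> good h ->
  (forall z, `|f z| <= `|g z| + `|h z|) -> D f <= 2 * D g + 2 * D h.
Proof.
move=> mf [mg sg] [mh sh] fgh.
have key z : (f z * th z) ^+ 2 <= 2 * (g z * th z) ^+ 2 + 2 * (h z * th z) ^+ 2.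
  have k2 : f z ^+ 2 <= 2 * g z ^+ 2 + 2 * h z ^+ 2.
    rewrite -[f z ^+ 2](real_normK (num_real _)) -[g z ^+ 2](real_normK (num_real _)).
    rewrite -[h z ^+ 2](real_normK (num_real _)).
    apply: (@le_trans _ _ ((`|g z| + `|h z|) ^+ 2)).
      by rewrite ler_pXn2r ?nnegrE ?addr_ge0.
    rewrite -subr_ge0; move: `|g z| `|h z| => a b.
    have -> : 2 * a ^+ 2 + 2 * b ^+ 2 - (a + b) ^+ 2 = (a - b) ^+ 2 by ring.
    exact: sqr_ge0.
  have := ler_wpM2r (sqr_ge0 (th z)) k2; rewrite !exprMn mulrDl !mulrA.
  exact.
have ii : integ (fun z => 2 * (g z * th z) ^+ 2 + 2 * (h z * th z) ^+ 2).
  by apply: integD; apply: integZ; [exact: sg.2|exact: sh.2].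
rewrite /D -!RintZ; [|exact: sh.2|exact: sg.2].
rewrite -RintD; [|exact/integZ/sg.2|exact/integZ/sh.2].
apply: Rint_le => //; apply: (ile _ _ ii).
- by apply: measurable_funX; apply: measurable_funM => //; case: tth.
- by move=> z; rewrite ger0_norm ?sqr_ge0.
Qed.

Definition approximable f := forall e : R, 0 < e -> exists2 g : P -> R, smooth g &
  D (fun z => f z - g z) <= e.

Let appr_lim f : good f -> (forall e : R, 0 < e -> exists2 g : P -> R, good g /\ approximable g &
  D (fun z => f z - g z) <= e) -> approximable f.
Proof.
move=> gf h e e0; have e4 : 0 < e / 4 by rewrite divr_gt0.
have [g [gg ag] fg] := h _ e4; have [u su gu] := ag _ e4; exists u => //.
have gu' := good_smooth su.
have := @D_le (fun z => f z - u z) (fun z => f z - g z) (fun z => g z - u z)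
  (goodB gf gu').1 (goodB gf gg) (goodB gg gu').
have tri z : `|f z - u z| <= `|f z - g z| + `|g z - u z|.
  by have -> : f z - u z = (f z - g z) + (g z - u z); [ring|exact: ler_normD].
by move=> /(_ tri) k; apply: le_trans k _; lra.
Qed.

Let apprD f g : good f -> good g -> approximable f -> approximable g ->
  approximable (fun z => f z + g z).
Proof.
move=> gf gg af ag e e0; have e4 : 0 < e / 4 by rewrite divr_gt0.
have [u su fu] := af _ e4; have [v sv gv] := ag _ e4.
exists (fun z => u z + v z); first exact: smoothD.
have [gu gv'] := (good_smooth su, good_smooth sv).
have := @D_le (fun z => f z + g z - (u z + v z)) (fun z => f z - u z) (fun z => g z - v z)
  (goodB (goodD gf gg) (goodD gu gv')).1 (goodB gf gu) (goodB gg gv').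
have tri z : `|f z + g z - (u z + v z)| <= `|f z - u z| + `|g z - v z|.
  by have -> : f z + g z - (u z + v z) = (f z - u z) + (g z - v z); [ring|exact: ler_normD].
by move=> /(_ tri) k; apply: le_trans k _; lra.
Qed.

Let apprZ c f : good f -> approximable f -> approximable (fun z => c * f z).
Proof.
move=> gf af e e0; have c0 : 0 < c ^+ 2 + 1 by rewrite ltr_wpDl ?sqr_ge0.
have e4 : 0 < e / (c ^+ 2 + 1) by rewrite divr_gt0.
have [u su fu] := af _ e4; exists (fun z => c * u z); first exact: smoothZ.
have [_ [_ ii]] := goodB gf (good_smooth su).
have -> : D (fun z => c * f z - c * u z) = c ^+ 2 * D (fun z => f z - u z).
  by rewrite /D -RintZ//; apply: Rint_ext => z; ring.
move: fu; rewrite ler_pdivlMr// => fu; apply: le_trans fu.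
by rewrite mulrC ler_wpM2l// lerDl.
Qed.

Let apprI (A : set P) := measurable A /\ forall e : R, 0 < e ->
  exists chi : P -> R, [/\ smooth chi, forall z, 0 <= chi z <= 1 &
    D (fun z => \1_A z - chi z) <= e].

Let good_indic A : measurable A -> good (\1_A : P -> R).
Proof.
move=> mA; apply: good_bounded; first exact: mea_indic.
by exists 1 => z _; exact: indic_norm_le1.
Qed.

Let apprI_C A : apprI A -> apprI (~` A).
Proof.
move=> [mA h]; split; first exact: measurableC.
move=> e /h [chi [s b d]]; exists (fun z => 1 - chi z); split.
- by apply: smoothB => //; exact: smooth_cst.
- by move=> z; have /andP[? ?] := b z; apply/andP; split; lra.
- apply: le_trans d; rewrite le_eqVlt; apply/orP; left; apply/eqP.
  apply: Rint_ext => z; rewrite -[LHS]sqrrN; congr (_ ^+ 2).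
  by rewrite !indicE in_setC; case: (z \in A) => /=; ring.
Qed.

Let apprI_I A B : apprI A -> apprI B -> apprI (A `&` B).
Proof.
move=> [mA hA] [mB hB]; split; first exact: measurableI.
move=> e e0; have e4 : 0 < e / 4 by rewrite divr_gt0.
have [u [su bu du]] := hA _ e4; have [v [sv bv dv]] := hB _ e4.
exists (fun z => u z * v z); split; first exact: smoothM.
  move=> z; have /andP[? ?] := bu z; have /andP[? ?] := bv z.
  by rewrite mulr_ge0//= mulr_ile1.
have [gA gB gu gv] := And4 (good_indic mA) (good_indic mB) (good_smooth su) (good_smooth sv).
have := @D_le (fun z => \1_(A `&` B) z - u z * v z) (fun z => \1_A z - u z) (fun z => \1_B z - v z)
  (goodB (good_indic (measurableI _ _ mA mB)) (good_smooth (smoothM su sv))).1 (goodB gA gu) (goodB gB gv).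
have tri z : `|\1_(A `&` B) z - u z * v z| <= `|\1_A z - u z| + `|\1_B z - v z|.
  rewrite (_ : \1_(A `&` B) z = \1_A z * \1_B z); last first.
    by rewrite !indicE in_setI; case: (_ \in A); case: (_ \in B); rewrite /= ?(mul0r, mulr0, mul1r).
  have -> : \1_A z * \1_B z - u z * v z = (\1_A z - u z) * \1_B z + u z * (\1_B z - v z) by ring.
  rewrite (le_trans (ler_normD _ _))// !normrM lerD//.
    by rewrite ler_piMr// indic_norm_le1.
  have /andP[? ?] := bu z; by rewrite ler_piMl// ger0_norm.
by move=> /(_ tri) k; apply: le_trans k _; lra.
Qed.

Let apprI_lim A (B : nat -> set P) : measurable A -> (forall k, apprI (B k)) ->
  (forall z, \1_(B k) z @[k --> \oo] --> (\1_A z : R)) -> apprI A.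
Proof.
move=> mA hB cB; split=> // e e0; have e4 : 0 < e / 4 by rewrite divr_gt0.
have mth : mea th by case: tth.
have cvD : D (fun z => \1_A z - \1_(B k) z) @[k --> \oo] --> (0 : R).
  apply: (@dct0 _ (fun z => 4 * th z ^+ 2)).
  - move=> k; apply: measurable_funX; apply: measurable_funM => //.
    by apply: measurable_funB; apply: mea_indic => //; have [] := hB k.
  - by apply: integZ; apply: tame_integ n0 _; exact: tame_sq.
  - move=> k z; rewrite ger0_norm ?sqr_ge0// exprMn ler_wpM2r ?sqr_ge0//.
    rewrite !indicE; case: (_ \in _); case: (_ \in _); rewrite /=; nra.
  - apply: aeW => z.
    have c1 : (\1_A z - \1_(B k) z) * th z @[k --> \oo] --> ((\1_A z - \1_A z) * th z : R).
      by apply: cvgMr_tmp; apply: cvgB; [exact: cvg_cst|exact: cB].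
    have -> : (fun k => ((\1_A z - \1_(B k) z) * th z) ^+ 2) =
      (fun k => ((\1_A z - \1_(B k) z) * th z) * ((\1_A z - \1_(B k) z) * th z)).
      by apply/funext => k; rewrite expr2.
    have c2 := cvgM c1 c1; rewrite subrr !mul0r in c2; exact: c2.
have [k hk] : exists k, D (fun z => \1_A z - \1_(B k) z) <= e / 4.
  move/cvgrPdist_le : cvD => /(_ _ e4)[N _ h]; exists N; have := h N (leqnn N).
  by rewrite sub0r normrN ger0_norm.
have [mBk /(_ _ e4) [u [su bu du]]] := hB k.
exists u; split => //; have [gA gB gu] := And3 (good_indic mA) (good_indic mBk) (good_smooth su).
have := @D_le (fun z => \1_A z - u z) (fun z => \1_A z - \1_(B k) z) (fun z => \1_(B k) z - u z)
  (goodB gA gu).1 (goodB gA gB) (goodB gB gu).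
have tri z : `|\1_A z - u z| <= `|\1_A z - \1_(B k) z| + `|\1_(B k) z - u z|.
  by have -> : \1_A z - u z = (\1_A z - \1_(B k) z) + (\1_(B k) z - u z); [ring|exact: ler_normD].
by move=> /(_ tri) q; apply: le_trans q _; lra.
Qed.

Let apprI_setU A B : apprI A -> apprI B -> apprI (A `|` B).
Proof.
move=> hA hB; rewrite -(setCK (A `|` B)) setCU.
by apply: apprI_C; apply: apprI_I; apply: apprI_C.
Qed.

Let apprI_set0 : apprI set0.
Proof.
split=> // e e0; exists (fun=> 0); split; first exact: smooth_cst.
  by move=> z; rewrite lexx ler01.
rewrite (_ : D _ = 0) ?ltW// -[RHS]Rint0; apply: Rint_ext => z.
by rewrite indic0 subrr mul0r expr0n.
Qed.

Let apprI_bigcup (A : nat -> set P) : (forall k, apprI (A k)) -> apprI (\bigcup_k A k).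
Proof.
move=> hA; apply: (@apprI_lim _ (fun k => \big[setU/set0]_(i < k) A i)).
- by apply: bigcup_measurable => k _; have [] := hA k.
- by move=> k; apply: big_ind.
- move=> z; case: (pselect ((\bigcup_k A k) z)) => [[j _ Aj]|nA].
    apply: (@cvg_trans _ (cst (\1_(\bigcup_k A k) z) @ \oo)); last exact: cvg_cst.
    apply: near_eq_cvg; near=> k => /=.
    have jk : (j < k)%N by near: k; exact: nbhs_infty_gt.
    rewrite !indicE !mem_set//; last by exists j.
    by rewrite -bigcup_mkord; exists j.
  apply: (@cvg_trans _ (cst (\1_(\bigcup_k A k) z) @ \oo)); last exact: cvg_cst.
  apply: near_eq_cvg; near=> k => /=.
  rewrite !indicE !memNset// -bigcup_mkord => -[i _ Ai]; apply: nA; by exists i.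
Unshelve. all: by end_near. Qed.

Let apprI_pos (phi : P -> R) : smooth phi -> apprI [set z | 0 < phi z].
Proof.
move=> sp; have mA : measurable [set z : P | 0 < phi z].
  apply: open_measurable_plane; apply: (@open_comp _ _ phi [set t | 0 < t]); last exact: open_gt.
  by move=> z _; exact: smooth_continuous.
have sfl : smooth (fun z => flat 1 (phi z)) by exact: (smooth_flat 1 sp).
pose chi (k : nat) (z : P) : R := 1 - expR (- k%:R * flat 1 (phi z)).
have schi k : smooth (chi k).
  apply: smoothB; [exact: smooth_cst|apply: smooth_exp; exact: smoothZ].
have bchi k z : 0 <= chi k z <= 1.
  rewrite subr_ge0 expR_le1 mulNr oppr_le0 mulr_ge0 ?flat1_ge0//=.
  by rewrite gerBl expR_ge0.
split=> // e e0.
have mth : mea th by case: tth.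
have cvD : D (fun z => \1_[set z | 0 < phi z] z - chi k z) @[k --> \oo] --> (0 : R).
  apply: (@dct0 _ (fun z => 4 * th z ^+ 2)).
  - move=> k; apply: measurable_funX; apply: measurable_funM => //.
    by apply: measurable_funB; [exact: mea_indic|exact: smooth_mea].
  - by apply: integZ; apply: tame_integ n0 _; exact: tame_sq.
  - move=> k z; rewrite ger0_norm ?sqr_ge0// exprMn ler_wpM2r ?sqr_ge0//.
    rewrite !indicE; have /andP[] := bchi k z; case: (_ \in _); rewrite /=; nra.
  - apply: aeW => z.
    have c1 : \1_[set z | 0 < phi z] z - chi k z @[k --> \oo] --> (0 : R).
      rewrite indicE; case: (ltP 0 (phi z)) => p0.
        have -> : (fun k => (z \in [set z | 0 < phi z])%:R - chi k z) =
            (fun k => (expR (- flat 1 (phi z))) ^+ k).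
          apply/funext => k; rewrite mem_set// /chi opprB addrC subrK.
          by rewrite mulNr -mulrN expRM_natl.
        apply: cvg_expr; rewrite ger0_norm ?expR_ge0// expR_lt1 oppr_lt0.
        exact: flat1_gt0.
      have -> : (fun k => (z \in [set z | 0 < phi z])%:R - chi k z) = cst 0.
        apply/funext => k; rewrite memNset /=; last by apply/negP; rewrite -leNgt.
        by rewrite /chi flat_le0// mulr0 expR0 !subrr.
      exact: cvg_cst.
    have c2 : (\1_[set z | 0 < phi z] z - chi k z) * th z @[k --> \oo] --> (0 * th z : R).
      by apply: cvgMr_tmp; exact: c1.
    have -> : (fun k => ((\1_[set z | 0 < phi z] z - chi k z) * th z) ^+ 2) =
      (fun k => ((\1_[set z | 0 < phi z] z - chi k z) * th z) * ((\1_[set z | 0 < phi z] z - chi k z) * th z)).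
      by apply/funext => k; rewrite expr2.
    have c3 := cvgM c2 c2; rewrite !mul0r in c3; exact: c3.
move/cvgrPdist_le : cvD => /(_ _ e0)[N _ h]; exists (chi N); split => //.
by have := h N (leqnn N); rewrite /= sub0r normrN ger0_norm.
Qed.

Let apprI_preimage (p : P -> R) : smooth p ->
  forall B : set (measurableTypeR R), measurable B -> apprI (p @^-1` B).
Proof.
move=> sp B; have -> : @measurable _ (measurableTypeR R) = <<s @RGenOInfty.G R >>.
  exact: (RGenOInfty.measurableE R).
apply: (@smallest_sub _ _ _ [set B | apprI (p @^-1` B)]); last first.
  move=> _ [a ->]; rewrite /= (_ : _ @^-1` _ = [set z | 0 < p z - a]).
    by apply: apprI_pos; apply: smoothB => //; exact: smooth_cst.
  by apply/seteqP; split => z /=; rewrite in_itv /= andbT subr_gt0.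
split => /=.
- by rewrite preimage_set0.
- by move=> A hA; rewrite setTD preimage_setC; exact: apprI_C.
- by move=> A hA; rewrite preimage_bigcup; exact: apprI_bigcup.
Qed.

Let apprI_measurable (A : set P) : measurable A -> apprI A.
Proof.
apply: (@smallest_sub _ _ _ [set A : set P | apprI A]).
  split => [|B hB|B hB] /=; first exact: apprI_set0.
    by rewrite setTD; exact: apprI_C.
  by apply: (apprI_bigcup (A := B)).
move=> _ [[B mB <-]|[B mB <-]] /=; rewrite setTI.
  by apply: (apprI_preimage (@smooth_fst R)).
by apply: (apprI_preimage (@smooth_snd R)).
Qed.

Let appr_smooth f : smooth f -> approximable f.
Proof.
move=> sf e e0; exists f => //; rewrite (_ : D _ = 0) ?ltW// -[RHS]Rint0.
by apply: Rint_ext => z; rewrite subrr mul0r expr0n.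
Qed.

Let appr_indic A : measurable A -> approximable (\1_A : P -> R).
Proof.
move=> /apprI_measurable [_ h] e /h [chi [s _ d]]; by exists chi.
Qed.

(* Binary expansion of a function with values in [0, 1]. *)
Let appr_unit f : mea f -> (forall z, 0 <= f z <= 1) -> approximable f.
Proof.
move=> mf f01.
pose A (q : P -> R) (k : nat) : set P := [set z | q z + 2^-1 ^+ k.+1 <= f z].
pose fix q (k : nat) : P -> R := if k is k'.+1 then
  (fun z => q k' z + 2^-1 ^+ k'.+1 * \1_(A (q k') k') z) else fun=> 0.
have p2 k : 0 < (2^-1 : R) ^+ k by rewrite exprn_gt0// invr_gt0.
have inv k : [/\ mea (q k), approximable (q k), bounded_on setT (q k) &
    forall z, 0 <= f z - q k z <= 2^-1 ^+ k].
  elim: k => [|k [mq aq [C hC] bq]].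
    split; [exact: measurable_cst|apply: appr_smooth; exact: smooth_cst| |].
      by exists 0 => z _; rewrite normr0.
    by move=> z; rewrite /= subr0 expr0.
  have mA : measurable (A (q k) k).
    have mm : mea (fun z => f z - (q k z + 2^-1 ^+ k.+1)).
      by apply: measurable_funB => //; apply: measurable_funD.
    rewrite (_ : A _ _ = (fun z => f z - (q k z + 2^-1 ^+ k.+1)) @^-1` `[0, +oo[%classic).
      by rewrite -[X in measurable X]setTI; apply: mm => //; exact: measurable_itv.
    by apply/seteqP; split => z /=; rewrite /A /= in_itv /= andbT subr_ge0.
  have m1 := mea_indic mA.
  have gq : good (q k) by apply: good_bounded => //; exists C => z _; exact: hC.
  split=> /=.
  - by apply: measurable_funD => //; apply: measurable_funM.
  - apply: apprD => //; first exact/goodZ/good_indic.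
    by apply: apprZ; [exact: good_indic|exact: appr_indic].
  - exists (C + 1) => z _; rewrite (le_trans (ler_normD _ _))// lerD ?hC//.
    have h1 : `|2^-1 ^+ k.+1 : R| <= 1.
      by rewrite ger0_norm ?(ltW (p2 _))// exprn_ile1// ?invr_ge0// invf_le1// ler1n.
    by rewrite normrM mulr_ile1 ?indic_norm_le1.
  - move=> z; have /andP[b1 b2] := bq z; have := p2 k; rewrite indicE exprS in b2 *.
    case: (boolP (z \in A (q k) k)); rewrite /A ?inE ?notin_setE /= exprS => h p0.
      by apply/andP; split; lra.
    have {}h : f z < q k z + 2^-1 * 2^-1 ^+ k by rewrite ltNge; apply/negP.
    by apply/andP; split; lra.
have gf : good f.
  by apply: good_bounded => //; exists 1 => z _; have /andP[? ?] := f01 z; rewrite ger0_norm.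
apply: appr_lim => // e e0.
pose I2 := ∫ (fun z => th z ^+ 2).
have I20 : 0 <= I2 by apply: Rint_ge0 => z; exact: sqr_ge0.
have I2p : 0 < I2 + 1 by rewrite ltr_wpDl.
have [k hk] : exists k : nat, 2^-1 ^+ k <= e / (I2 + 1).
  have /cvgrPdist_le /(_ (e / (I2 + 1))) : (2^-1 : R) ^+ k @[k --> \oo] --> (0 : R).
    by apply: cvg_expr; rewrite ger0_norm ?invr_ge0// invf_lt1// ltr1n.
  rewrite divr_gt0// => /(_ isT) [N _ h]; exists N; have := h N (leqnn N).
  by rewrite sub0r normrN ger0_norm// ltW.
have [mq aq [C hC] bq] := inv k.
have gq : good (q k) by apply: good_bounded => //; exists C => z _; exact: hC.
exists (q k) => //; apply: (@le_trans _ _ (2^-1 ^+ k * I2)).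
  have iT : integ (fun z => th z ^+ 2) by apply: tame_integ n0 _; exact: tame_sq.
  rewrite /I2 -RintZ//; apply: Rint_le; [exact: (goodB gf gq).2.2|exact: integZ|].
  move=> z; rewrite exprMn ler_wpM2r ?sqr_ge0//; have /andP[b1 b2] := bq z.
  have q1 : (2^-1 : R) ^+ k <= 1 by rewrite exprn_ile1// ?invr_ge0// invf_le1// ler1n.
  by rewrite expr2 (le_trans _ b2)// ler_piMl// (le_trans b2).
move: hk; rewrite ler_pdivlMr// => hk; apply: le_trans hk.
by rewrite ler_wpM2l// ?lerDl// ltW.
Qed.

Let appr_bounded f (C : R) : mea f -> (forall z, `|f z| <= C) -> approximable f.
Proof.
move=> mf hC; have C0 : 0 <= C by apply: le_trans (hC (0, 0)).
pose u z := (2 * C + 2)^-1 * (f z + (C + 1)).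
have C2 : 0 < 2 * C + 2 by lra.
have mu : mea u by apply: measurable_funM => //; apply: measurable_funD.
have bu z : 0 <= u z <= 1.
  have := hC z; rewrite ler_norml => /andP[h1 h2].
  apply/andP; split; rewrite /u; first by rewrite mulr_ge0 ?invr_ge0 ?(ltW C2)//; lra.
  rewrite mulrC ler_pdivrMr//; lra.
have gu : good u.
  by apply: good_bounded => //; exists 1 => z _; have /andP[? ?] := bu z; rewrite ger0_norm.
have -> : f = (fun z => (2 * C + 2) * u z + (- (C + 1))).
  by apply/funext => z; rewrite /u; field; rewrite gt_eqF.
apply: apprD; [exact: goodZ|exact/good_smooth/smooth_cst| |exact/appr_smooth/smooth_cst].
by apply: apprZ => //; exact: appr_unit.
Qed.

Lemma smooth_dense (G : P -> R) (e : R) : sqi G -> 0 < e ->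
  exists2 g : P -> R, smooth g & ∫ (fun z => (G z * th z - g z * th z) ^+ 2) <= e.
Proof.
move=> sG e0; have [mG iG] := sG.
have [mth [B hB] _] := tth.
have gG : good G.
  split=> //; have := sqint_bndM mth (fun z => hB z I) sG.
  by congr sqint; apply/funext => z; rewrite mulrC.
suff /(_ e e0) [g sg hg] : approximable G.
  by exists g => //; apply: le_trans hg; rewrite le_eqVlt; apply/orP; left; apply/eqP;
     apply: Rint_ext => z; rewrite mulrBl.
apply: appr_lim => // d d0.
pose Gk (k : nat) (z : P) : R := G z * \1_[set z | `|G z| <= k%:R] z.
have mAk k : measurable [set z : P | `|G z| <= k%:R].
  have mn : mea (fun z => `|G z|) by exact: measurableT_comp.
  rewrite (_ : [set z | _] = (fun z => `|G z|) @^-1` `]-oo, k%:R]%classic).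
    by rewrite -[X in measurable X]setTI; apply: mn => //; exact: measurable_itv.
  by apply/seteqP; split => z /=; rewrite in_itv.
have mGk k : mea (Gk k) by apply: measurable_funM => //; exact: mea_indic.
have bGk k z : `|Gk k z| <= k%:R.
  rewrite /Gk indicE; case: (boolP (z \in _)) => h; last by rewrite mulr0 normr0.
  by rewrite mulr1; move: h; rewrite inE.
have gGk k : good (Gk k) by apply: good_bounded => //; exists k%:R => z _; exact: bGk.
have cvD : D (fun z => G z - Gk k z) @[k --> \oo] --> (0 : R).
  apply: (@dct0 _ (fun z => (G z * th z) ^+ 2)).
  - move=> k; apply: measurable_funX; apply: measurable_funM => //.
    by apply: measurable_funB.
  - exact: gG.2.2.
  - move=> k z; rewrite ger0_norm ?sqr_ge0// !exprMn ler_wpM2r ?sqr_ge0//.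
    rewrite /Gk indicE; case: (_ \in _); first by rewrite mulr1 subrr expr0n sqr_ge0.
    by rewrite mulr0 subr0.
  - apply: aeW => z; apply: (@cvg_trans _ (cst 0 @ \oo)); last exact: cvg_cst.
    apply: near_eq_cvg; near=> k => /=.
    rewrite /Gk indicE mem_set ?mulr1 ?subrr ?mul0r ?expr0n//=.
    by near: k; exact: nbhs_infty_ger.
move/cvgrPdist_le : cvD => /(_ _ d0)[N _ h]; exists (Gk N).
  by split => //; exact: appr_bounded (bGk N).
by have := h N (leqnn N); rewrite /= sub0r normrN ger0_norm.
Unshelve. all: by end_near. Qed.

End Density.

(** * Weak derivatives and the commutator estimate *)

Section WeakDerivatives.
Context {R : realType}.
Local Notation P := (measurableTypeR R * measurableTypeR R)%type.
Local Notation integ f := ((@area R).-integrable setT (EFin \o f)).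
Local Notation mea f := (@measurable_fun _ _ P R setT f).
Local Notation "'∫' f" := (Rintegral (@area R) setT f) (at level 10, f at level 9).
Local Notation sqi := (@sqint _ P R (@area R)).
Local Notation ile g := (@integ_le _ P R (@area R) _ g).
Local Notation ibnd C := (@integ_bndM _ P R (@area R) C).
Implicit Types (x y z h : R * R) (f g p c : P -> R) (n m : R).

Lemma mvt_bound (F dF : R -> R) (C s : R) : (forall t : R, is_derive t 1 F (dF t)) ->
  (forall t, `|dF t| <= C) -> `|F s - F 0| <= C * `|s|.
Proof.
move=> hF hC.
have cF : continuous F.
  by move=> t; apply: differentiable_continuous; apply/derivable1_diffP; have [] := hF t.
have key (a b : R) : a <= b -> `|F b - F a| <= C * (b - a).
  move=> ab; have [t _ ->] := MVT_segment ab (fun t _ => hF t) (continuous_subspaceT cF).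
  by rewrite normrM (ger0_norm (_ : 0 <= b - a)) ?subr_ge0// ler_wpM2r ?subr_ge0.
case: (leP 0 s) => s0.
  by have := key _ _ s0; rewrite subr0 (ger0_norm s0).
by have := key _ _ (ltW s0); rewrite sub0r (ltr0_norm s0) distrC.
Qed.

Definition cut m (t : R) : R := step (m + 1 - t) * step (m + 1 + t).
Definition cutoff m z : R := cut m z.1 * cut m z.2.

Lemma cutoff1 m z : square m z -> cutoff m z = 1.
Proof.
by move=> /squareE[]; rewrite !ler_norml => /andP[? ?] /andP[? ?];
  rewrite /cutoff /cut !step_ge ?mulr1//; lra.
Qed.

Lemma cut0 m t : m + 1 < `|t| -> cut m t = 0.
Proof.
rewrite lter_normr => /orP[h|h]; rewrite /cut.
  by rewrite step_le ?mul0r//; lra.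
by rewrite (@step_le _ (m + 1 + t)) ?mulr0//; lra.
Qed.

Lemma cutoff0 m z : ~ square (m + 1) z -> cutoff m z = 0.
Proof.
move=> nz; rewrite /cutoff; case: (leP `|z.1| (m + 1)) => h1; last by rewrite cut0 ?mul0r.
case: (leP `|z.2| (m + 1)) => h2; last by rewrite (@cut0 _ z.2) ?mulr0.
by exfalso; apply: nz; apply/squareE.
Qed.

Lemma smooth_cut m f : smooth f -> smooth (fun z => cut m (f z)).
Proof.
move=> sf; apply: smoothM; apply: smooth_step.
  by apply: smoothB => //; exact: smooth_cst.
by apply: smoothD => //; exact: smooth_cst.
Qed.

Lemma smooth_cutoff m : smooth (cutoff m).
Proof. by apply: smoothM; apply: smooth_cut; [exact: smooth_fst|exact: smooth_snd]. Qed.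

Lemma tame_cutoff m : tame (m + 1) (cutoff m).
Proof. exact: smooth_tame (@smooth_cutoff m) (@cutoff0 m). Qed.

Definition offzero m f := forall z, ~ square m z -> f z = 0.

Lemma smooth_test_square m f : smooth f -> offzero m f -> test_function setT f.
Proof. by move=> sf f0; apply: (smooth_test sf (@compact_square R m)). Qed.

Lemma smooth_approx (G : P -> R) m (e : R) : 0 <= m -> sqi G -> offzero m G -> 0 < e ->
  exists g : P -> R, [/\ smooth g, offzero (m + 1) g & ∫ (fun z => (G z - g z) ^+ 2) <= e].
Proof.
move=> m0 sG G0 e0; have m1 : 0 <= m + 1 by rewrite addr_ge0.
have [g sg hg] := smooth_dense m1 (@tame_cutoff m) sG e0.
exists (fun z => g z * cutoff m z); split.
- by apply: smoothM => //; exact: smooth_cutoff.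
- by move=> z /cutoff0 ->; rewrite mulr0.
- apply: le_trans hg; rewrite le_eqVlt; apply/orP; left; apply/eqP; apply: Rint_ext => z.
  case: (pselect (square m z)) => sz; first by rewrite !(cutoff1 sz) !mulr1.
  by rewrite G0// mul0r.
Qed.

Lemma offzero_sqiM m (W G : P -> R) : sqi (fun z => \1_(square m) z * W z) -> sqi G ->
  offzero m G -> integ (fun z => W z * G z).
Proof.
move=> sW sG G0; have := sqint_mul sW sG; congr (_.-integrable _ (EFin \o _)).
apply/funext => z; case: (pselect (square m z)) => sz; last by rewrite G0// !mulr0.
by rewrite indicE mem_set// mul1r.
Qed.

Lemma extend_bound (W : P -> R) m (A B : R) : 0 <= m -> 0 <= A ->
  sqi (fun z => \1_(square (m + 1)) z * W z) ->
  (forall g : P -> R, smooth g -> offzero (m + 1) g ->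
     `|∫ (fun z => W z * g z)| <= A * ∫ (fun z => g z ^+ 2) + B) ->
  forall G : P -> R, sqi G -> offzero m G ->
     `|∫ (fun z => W z * G z)| <= A * ∫ (fun z => G z ^+ 2) + B.
Proof.
move=> m0 A0 sW hW G sG G0; have m1 : 0 <= m + 1 by rewrite addr_ge0.
apply/ler_addgt0Pr => e e0.
set SW := ∫ (fun z => (\1_(square (m + 1)) z * W z) ^+ 2).
set SG := ∫ (fun z => G z ^+ 2).
have SW0 : 0 <= SW by apply: Rint_ge0 => z; exact: sqr_ge0.
have SG0 : 0 <= SG by apply: Rint_ge0 => z; exact: sqr_ge0.
pose K := SW + 2 * A * SG + 1; have K0 : 0 < K by rewrite ltr_wpDl ?addr_ge0 ?mulr_ge0.
pose t := e / (2 * K); have t0 : 0 < t by rewrite divr_gt0 ?mulr_gt0.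
pose L := (4 * t)^-1 + 2 * A * (4 * t)^-1 + A + 1.
have i4 : 0 <= (4 * t)^-1 by rewrite invr_ge0 mulr_ge0 ?(ltW t0).
have L0 : 0 < L.
  by rewrite ltr_wpDl//; apply: addr_ge0 => //; apply: addr_ge0 => //; rewrite mulr_ge0// mulr_ge0.
pose d := e / (2 * L); have d0 : 0 < d by rewrite divr_gt0 ?mulr_gt0.
have [g [sg g0 gd]] := smooth_approx m0 sG G0 d0.
have tg : tame (m + 1) g by exact: smooth_tame.
have sqg := tame_sqi m1 tg.
have G0' : offzero (m + 1) G.
  move=> z nz; apply: G0 => sz; apply: nz; apply: squareS sz; by rewrite lerDl.
have sD := sqintB sG sqg.
have D0 : offzero (m + 1) (fun z => G z - g z) by move=> z nz; rewrite G0'// g0// subrr.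
have iWg := offzero_sqiM sW sqg g0; have iWD := offzero_sqiM sW sD D0.
have e1 : ∫ (fun z => W z * G z) = ∫ (fun z => W z * g z) + ∫ (fun z => W z * (G z - g z)).
  by rewrite -RintD//; apply: Rint_ext => z; ring.
have e2 : ∫ (fun z => W z * (G z - g z)) =
    ∫ (fun z => (\1_(square (m + 1)) z * W z) * (G z - g z)).
  apply: Rint_ext => z; case: (pselect (square (m + 1) z)) => sz; last by rewrite D0// !mulr0.
  by rewrite indicE mem_set// mul1r.
have b1 := hW g sg g0.
have b2 := sqint_mul_le t0 sW sD; rewrite -/SW -e2 in b2.
have e3 : ∫ (fun z => g z ^+ 2) =
    SG - 2 * ∫ (fun z => G z * (G z - g z)) + ∫ (fun z => (G z - g z) ^+ 2).
  have i1 := sqint_mul sG sD.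
  rewrite -RintZ// -RintB//; [|exact: sG.2|exact: integZ].
  rewrite -RintD//; [|apply: integB; [exact: sG.2|exact: integZ]|exact: sD.2].
  by apply: Rint_ext => z; ring.
have b3 := sqint_mul_le t0 sG sD; rewrite -/SG in b3.
rewrite e1; apply: le_trans (ler_normD _ _) _.
move: b1 b2 b3 gd e3.
set Ig := ∫ (fun z => g z ^+ 2); set ID := ∫ (fun z => (G z - g z) ^+ 2).
set IGD := ∫ (fun z => G z * (G z - g z)); set IWg := ∫ (fun z => W z * g z).
set IWD := ∫ (fun z => W z * (G z - g z)).
move=> b1 b2 b3 gd e3.
have ID0 : 0 <= ID by apply: Rint_ge0 => z; exact: sqr_ge0.
have b4 : Ig <= SG + 2 * (t * SG + (4 * t)^-1 * ID) + ID.
  rewrite e3; move: b3; rewrite ler_norml => /andP[b3 _]; lra.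
have b5 : A * Ig <= A * (SG + 2 * (t * SG + (4 * t)^-1 * ID) + ID) by rewrite ler_wpM2l.
have hd : L * ID <= e / 2.
  apply: (@le_trans _ _ (L * d)); first by rewrite ler_wpM2l// ltW.
  by rewrite le_eqVlt; apply/orP; left; apply/eqP; rewrite /d; field; rewrite gt_eqF.
have ht : t * K = e / 2 by rewrite /t; field; rewrite gt_eqF.
have tm : t * (SW + 2 * A * SG) <= e / 2 by rewrite -ht ler_wpM2l ?(ltW t0)// lerDl.
have Lm : ((4 * t)^-1 + 2 * A * (4 * t)^-1 + A) * ID <= e / 2.
  by apply: le_trans hd; rewrite ler_wpM2r// lerDl.
have -> : A * SG + B + e = (A * SG + B) + (e / 2 + e / 2) by field.
apply: le_trans (lerD b1 b2) _.
apply: le_trans (lerD (lerD b5 (lexx B)) (lexx _)) _.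
apply: le_trans (lerD (lexx (A * SG + B)) (lerD tm Lm)).
rewrite le_eqVlt; apply/orP; left; apply/eqP; ring.
Qed.

Definition wd (v : R * R) (Om : set (R * R)) p (pv : P -> R) :=
  forall psi : P -> R, test_function Om psi ->
    ∫ (fun z => p z * 'D_v (psi : R * R -> R) z) = - ∫ (fun z => pv z * psi z).

Lemma smooth_dirP f z (v : R * R) : smooth f -> is_derive z v (f : R * R -> R) ('D_v (f : R * R -> R) z).
Proof. by move=> sf; apply: derivableP; apply: diff_derivable; exact: smooth_differentiable. Qed.

Definition isdir (v : R * R) := v = (1, 0) \/ v = (0, 1).

Lemma tame_dir m f (v : R * R) : isdir v -> smooth f -> offzero m f ->
  tame m ('D_v (f : R * R -> R)).
Proof. by move=> + sf f0; case: (tame_dxy sf f0) => ? ? [] ->. Qed.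

Lemma smooth_shift f h : smooth f -> smooth (fun z => f (z + h : R * R)).
Proof.
suff H k : forall f : R * R -> R, Ck k f -> Ck k (fun z : R * R => f (z + h : R * R)) by move=> sf k; exact: H.
elim: k => [|k IH] {}f /=.
  move=> cf z; apply: (@continuous_comp _ _ _ (fun z : R * R => z + h : R * R) f); last exact: cf.
  by apply: cvgD; [exact: cvg_id|exact: cvg_cst].
have sh z (v : R * R) (d : R) : is_derive (z + h : R * R) v f d ->
    is_derive z v (fun z : R * R => f (z + h : R * R)) d.
  move=> /is_derive_line H; apply/is_derive_line; move: H; congr is_derive.
  by apply/funext => t; rewrite addrA.
case=> df fx fy; split.
- move=> z; apply: (@differentiable_comp _ _ _ _ (fun z : R * R => z + h : R * R) f) => //.
- have -> : dx (fun z : R * R => f (z + h : R * R)) = (fun z : R * R => dx f (z + h : R * R)).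
    by apply/funext => z; apply: dxE; apply: sh; exact: dxP.
  exact: IH.
- have -> : dy (fun z : R * R => f (z + h : R * R)) = (fun z : R * R => dy f (z + h : R * R)).
    by apply/funext => z; apply: dyE; apply: sh; exact: dyP.
  exact: IH.
Qed.

Lemma dir_shift f h z (v : R * R) : smooth f ->
  'D_v (fun z : R * R => f (z + h : R * R)) z = 'D_v (f : R * R -> R) (z + h : R * R).
Proof.
move=> sf; have /is_derive_line H := smooth_dirP (z + h : R * R) v sf.
have : is_derive z v (fun z : R * R => f (z + h : R * R)) ('D_v (f : R * R -> R) (z + h : R * R)).
  by apply/is_derive_line; move: H; congr is_derive; apply/funext => t; rewrite addrA.
by case.
Qed.

End WeakDerivatives.

Section Commutator.
Context {R : realType}.
Local Notation P := (measurableTypeR R * measurableTypeR R)%type.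
Local Notation integ f := ((@area R).-integrable setT (EFin \o f)).
Local Notation mea f := (@measurable_fun _ _ P R setT f).
Local Notation "'∫' f" := (Rintegral (@area R) setT f) (at level 10, f at level 9).
Local Notation sqi := (@sqint _ P R (@area R)).
Local Notation ile g := (@integ_le _ P R (@area R) _ g).
Local Notation ibnd C := (@integ_bndM _ P R (@area R) C).
Implicit Types (x y z h : R * R) (f g c : P -> R) (n m e t : R).

Lemma conv_exchange (c H g : P -> R) n m : 0 <= n -> 0 <= m -> locint c -> tame n H -> tame m g ->
  bounded_on (square (m + n)) c ->
  ∫ (fun x => g x * conv c H x) = ∫ (fun h => H h * conv c g h).
Proof.
move=> n0 m0 lc tH tg bc; rewrite (conv_swap n0 lc tH m0 tg bc); apply: Rint_ext => h.
congr (_ * _); rewrite (conv_shift m0 lc tg); apply: Rint_ext => x.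
by rewrite mulrC.
Qed.

Lemma sqi_shift g h : sqi g -> sqi (fun z => g (z + h : R * R)).
Proof. by move=> [mg ig]; split; [exact: mea_shift|exact: (integ_shift h ig)]. Qed.

Section Translation.
Variables (p px py : P -> R).
Hypotheses (mp : mea p) (bp : forall z, `|p z| <= 1).
Hypotheses (spx : sqi px) (spy : sqi py).
Hypotheses (wpx : wd (1, 0) setT p px) (wpy : wd (0, 1) setT p py).

Lemma bounded1_locint : locint p.
Proof. by apply: bounded_locint => // k; exists 1 => z _; exact: bp. Qed.

Let pdiff_sqi m h : 0 <= m -> sqi (fun z => \1_(square m) z * (p (z + h : R * R) - p z)).
Proof.
move=> m0; have mW : mea (fun z => p (z + h : R * R) - p z).
  by apply: measurable_funB => //; exact: mea_shift.
apply: (tame_sqi m0); split.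
- by apply: measurable_funM => //; exact: mea_square.
- exists (1 * (1 + 1)) => z _; rewrite normrM ler_pM ?indic_norm_le1//.
  by rewrite (le_trans (ler_normB _ _))// lerD.
- by move=> z nz; rewrite indicE memNset// mul0r.
Qed.

Lemma translate_dir (v : R * R) (pv G : P -> R) m t (s : R) : isdir v -> sqi pv ->
  wd v setT p pv -> 0 <= m -> 0 < t -> sqi G -> offzero m G ->
  `|∫ (fun z => (p (z + s *: v : R * R) - p z) * G z)| <=
    t * `|s| * ∫ (fun z => G z ^+ 2) + (4 * t)^-1 * ∫ (fun z => pv z ^+ 2) * `|s|.
Proof.
move=> dv spv wpv m0 t0 sG G0; have m1 : 0 <= m + 1 by rewrite addr_ge0.
have lp := bounded1_locint.
apply: (extend_bound m0) => //; first by rewrite mulr_ge0 ?(ltW t0).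
  by apply: pdiff_sqi; rewrite addr_ge0.
move=> g sg g0; have tg : tame (m + 1) g := smooth_tame sg g0.
have tdg := tame_dir dv sg g0.
pose F (s : R) := ∫ (fun z => p z * g (z + s *: - v : R * R)).
pose psi (s : R) z := g (z + s *: - v : R * R).
have dF (r : R) : is_derive r 1 F (∫ (fun z => pv z * psi r z)).
  have tdg' : tame (m + 1) (fun z => - 'D_v (g : R * R -> R) z).
    by have := tameZ (-1) tdg; congr tame; apply/funext => z; rewrite mulN1r.
  have := is_derive_under r m1 lp tg tdg' (fun z => is_derive_opp_dir (smooth_dirP z v sg)).
  congr is_derive.
  have tpsi : test_function setT (psi r).
    apply: (@smooth_test_square _ (m + 1 + `|(r *: - v).1| + `|(r *: - v).2|)).
      exact: smooth_shift.
    by have [] := tame_shift (r *: - v) m1 tg.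
  rewrite -[RHS]opprK -(wpv (psi r) tpsi).
  rewrite -RintN; last first.
    have := tame_mul _ (tame_shift (r *: - v) m1 tdg) lp.
    have -> : (fun z : P => 'D_v (g : R * R -> R) (z + r *: - v : R * R) * p z) =
      (fun z : P => p z * 'D_v (psi r : R * R -> R) z).
      by apply/funext => z; rewrite mulrC /psi dir_shift.
    by apply; rewrite !addr_ge0.
  by apply: Rint_ext => z; rewrite /psi dir_shift// mulrN.
have bF (r : R) : `|∫ (fun z => pv z * psi r z)| <=
    t * ∫ (fun z => g z ^+ 2) + (4 * t)^-1 * ∫ (fun z => pv z ^+ 2).
  have sqg := tame_sqi m1 tg.
  have := sqint_mul_le t0 (sqi_shift (r *: - v) sqg) spv.
  rewrite (Rint_shift (r *: - v) sqg.2).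
  have -> : ∫ (fun z => pv z * psi r z) = ∫ (fun z => g (z + r *: - v : R * R) * pv z).
    by apply: Rint_ext => z; rewrite mulrC.
  exact.
have := mvt_bound s dF bF; rewrite /F.
have i1 (r : R) : integ (fun z => p z * g (z + r *: - v : R * R)).
  have := tame_mul _ (tame_shift (r *: - v) m1 tg) lp.
  have -> : (fun z : P => g (z + r *: - v : R * R) * p z) = (fun z : P => p z * g (z + r *: - v : R * R)).
    by apply/funext => z; rewrite mulrC.
  by apply; rewrite !addr_ge0.
have e1 : ∫ (fun z => p z * g (z + s *: - v : R * R)) = ∫ (fun z => p (z + s *: v : R * R) * g z).
  rewrite -(Rint_shift (s *: v) (i1 s)); apply: Rint_ext => z; congr (_ * g _).
  by rewrite scalerN addrK.
have e2 : ∫ (fun z => p z * g (z + 0 *: - v : R * R)) = ∫ (fun z => p z * g z).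
  by apply: Rint_ext => z; rewrite scale0r addr0.
have i2 : integ (fun z => p (z + s *: v : R * R) * g z).
  have := integ_shift (s *: v) (i1 s); congr (_.-integrable _ (EFin \o _)); apply/funext => z.
  by congr (_ * g _); rewrite scalerN addrK.
have i3 : integ (fun z => p z * g z).
  have := i1 0; congr (_.-integrable _ (EFin \o _)); apply/funext => z.
  by rewrite scale0r addr0.
rewrite e1 e2 -RintB//.
have -> : ∫ (fun z => p (z + s *: v : R * R) * g z - p z * g z) =
    ∫ (fun z => (p (z + s *: v : R * R) - p z) * g z).
  by apply: Rint_ext => z; rewrite mulrBl.
move=> h; apply: le_trans h _; rewrite le_eqVlt; apply/orP; left; apply/eqP; ring.
Qed.

Lemma translate_bound (G : P -> R) m t h : 0 <= m -> 0 < t -> sqi G -> offzero m G ->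
  `|∫ (fun z => (p (z + h : R * R) - p z) * G z)| <= (`|h.1| + `|h.2|) *
    (t * ∫ (fun z => G z ^+ 2) + (4 * t)^-1 * (∫ (fun z => px z ^+ 2) + ∫ (fun z => py z ^+ 2))).
Proof.
move=> m0 t0 sG G0.
pose h1 : R * R := h.1 *: ((1, 0) : R * R); pose h2 : R * R := h.2 *: ((0, 1) : R * R).
have hE : h = h1 + h2.
  by case: h @h1 @h2 => a b; rewrite /= -[RHS]/(a * 1 + b * 0, a * 0 + b * 1) !mulr1 !mulr0 addr0 add0r.
have h1E : - h1 = (- h.1, 0) by rewrite -[LHS]/(- (h.1 * 1), - (h.1 * 0)) mulr1 mulr0 oppr0.
have b1 := translate_dir h.1 (or_introl erefl) spx wpx m0 t0 sG G0.
have sG' := sqi_shift (- h1) sG.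
have mm : 0 <= m + `|h.1| by rewrite addr_ge0.
have G0' : offzero (m + `|h.1|) (fun z => G (z - h1 : R * R)).
  move=> z nz; apply: G0 => /squareE; rewrite h1E /= addr0 => -[z1 z2]; apply: nz; apply/squareE; split.
    have -> : z.1 = z.1 - h.1 + h.1 by ring.
    by rewrite (le_trans (ler_normD _ _))// lerD.
  by rewrite (le_trans z2)// lerDl.
have b2 := translate_dir h.2 (or_intror erefl) spy wpy mm t0 sG' G0'.
rewrite (Rint_shift (- h1) sG.2) -/h2 in b2; rewrite -/h1 in b1.
have i1 : integ (fun z => (p (z + h1 : R * R) - p z) * G z).
  exact: offzero_sqiM (pdiff_sqi h1 m0) sG G0.
have i2 : integ (fun z => (p (z + h2 : R * R) - p z) * G (z - h1 : R * R)).
  exact: offzero_sqiM (pdiff_sqi h2 mm) sG' G0'.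
have e2 := Rint_shift h1 i2.
have i2' := integ_shift h1 i2.
have -> : ∫ (fun z => (p (z + h : R * R) - p z) * G z) =
   ∫ (fun z => (p (z + h1 : R * R) - p z) * G z) + ∫ (fun z => (p (z + h2 : R * R) - p z) * G (z - h1 : R * R)).
  rewrite -e2 -RintD//; apply: Rint_ext => z; rewrite addrK hE addrA; ring.
apply: le_trans (ler_normD _ _) _; apply: le_trans (lerD b1 b2) _.
have S1 : 0 <= ∫ (fun z => px z ^+ 2) by apply: Rint_ge0 => z; exact: sqr_ge0.
have S2 : 0 <= ∫ (fun z => py z ^+ 2) by apply: Rint_ge0 => z; exact: sqr_ge0.
have i4 : 0 <= (4 * t)^-1 by rewrite invr_ge0 mulr_ge0 ?(ltW t0).
move: S1 S2 i4; set a := ∫ _; set b := ∫ _; set d := ∫ _; move: (4 * t)^-1 => T S1 S2 i4.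
rewrite -subr_ge0; have -> : (`|h.1| + `|h.2|) * (t * d + T * (a + b)) -
   (t * `|h.1| * d + T * a * `|h.1| + (t * `|h.2| * d + T * b * `|h.2|)) =
   T * b * `|h.1| + T * a * `|h.2| by ring.
by rewrite addr_ge0// mulr_ge0// mulr_ge0.
Qed.

Lemma commutator_bound (K : R) (c g : P -> R) (H : P -> R) (M m e t : R) :
  0 < e -> e <= 1 -> 0 <= m -> 0 < t -> 0 <= K ->
  tame e H -> (forall h, `|H h| <= K / e ^+ 3) ->
  locint c -> 0 <= M -> (forall z, square (m + 1) z -> `|c z| <= M) -> tame m g ->
  `|∫ (fun x => g x * (conv (fun y => c y * p y) H x - p x * conv c H x))| <=
    8 * K * (t * (M ^+ 2 * ∫ (fun z => g z ^+ 2)) +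
       (4 * t)^-1 * (∫ (fun z => px z ^+ 2) + ∫ (fun z => py z ^+ 2))).
Proof.
move=> e0 e1 m0 t0 K0 tH bH lc M0 bc tg; have e0' := ltW e0.
have lp := bounded1_locint.
have lcp : locint (fun y => c y * p y).
  have := locintM mp bp lc; congr locint; apply/funext => y; exact: mulrC.
have bc' : bounded_on (square (m + e)) c.
  by exists M => z sz; apply: bc; apply: squareS sz; rewrite lerD2l.
have bcp : bounded_on (square (m + e)) (fun y => c y * p y).
  exists M => z sz; rewrite normrM -[M]mulr1 ler_pM// bc//; apply: squareS sz; by rewrite lerD2l.
have tgp : tame m (fun x => g x * p x).
  have := @tameM _ _ p g mp _ tg; have -> : (fun z => p z * g z) = (fun x => g x * p x).
    by apply/funext => z; exact: mulrC.
  by apply; exists 1 => z _; exact: bp.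
have [_ _ g0] := tg; have [_ _ gp0] := tgp; have [_ _ H0] := tH.
have ig := tame_integ m0 tg; have igp := tame_integ m0 tgp; have iH := tame_integ e0' tH.
have -> : ∫ (fun x => g x * (conv (fun y => c y * p y) H x - p x * conv c H x)) =
    ∫ (fun h => H h * (conv (fun y => c y * p y) g h - conv c (fun x => g x * p x) h)).
  transitivity (∫ (fun x => g x * conv (fun y => c y * p y) H x) - ∫ (fun x => (g x * p x) * conv c H x)).
    rewrite -RintB; first by apply: Rint_ext => x; ring.
      by apply: (supp_conv_integ e0' lcp tH m0).
    by apply: (supp_conv_integ e0' lc tH m0).
  rewrite (conv_exchange e0' m0 lcp tH tg bcp) (conv_exchange e0' m0 lc tH tgp bc').
  rewrite -RintB; first by apply: Rint_ext => x; ring.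
    by apply: (supp_conv_integ m0 lcp tg e0').
  by apply: (supp_conv_integ m0 lc tgp e0').
pose S := ∫ (fun z => px z ^+ 2) + ∫ (fun z => py z ^+ 2).
pose B := t * (M ^+ 2 * ∫ (fun z => g z ^+ 2)) + (4 * t)^-1 * S.
have S0 : 0 <= S by rewrite addr_ge0//; apply: Rint_ge0 => z; exact: sqr_ge0.
have g20 : 0 <= ∫ (fun z => g z ^+ 2) by apply: Rint_ge0 => z; exact: sqr_ge0.
have B0 : 0 <= B.
  rewrite addr_ge0 ?mulr_ge0 ?(ltW t0) ?exprn_ge0//.
  by rewrite invr_ge0 mulr_ge0 ?(ltW t0).
have key h : square e h ->
    `|conv (fun y => c y * p y) g h - conv c (fun x => g x * p x) h| <= 2 * e * B.
  move=> /squareE[h1 h2].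
  rewrite (conv_shift m0 lcp tg) (conv_shift m0 lc tgp).
  have bcx x : square m x -> `|c (x + h : R * R)| <= M.
    move=> /squareE[x1 x2]; apply: bc; apply/squareE.
    by split; rewrite /= (le_trans (ler_normD _ _))// lerD// (le_trans _ e1).
  have mcs : mea (fun x => c (x + h : R * R)) by apply: mea_shift; case: lc.
  have tG : tame m (fun x => c (x + h : R * R) * g x).
    by apply: tameM => //; exists M => x sx; exact: bcx.
  have sG := tame_sqi m0 tG; have [_ _ G0] := tG.
  have j1 : integ (fun x => c (x + h : R * R) * p (x + h : R * R) * g x).
    have lps : locint (fun x => p (x + h : R * R)).
      by apply: bounded_locint => [|k]; [exact: mea_shift|exists 1 => z _; exact: bp].
    have := tame_mul m0 tG lps.
    by congr (_.-integrable _ (EFin \o _)); apply/funext => x; ring.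
  have j2 : integ (fun x => c (x + h : R * R) * (g x * p x)).
    have := tame_mul m0 tG lp.
    by congr (_.-integrable _ (EFin \o _)); apply/funext => x; ring.
  have e3 : ∫ (fun x => c (x + h : R * R) * p (x + h : R * R) * g x) -
      ∫ (fun x => c (x + h : R * R) * (g x * p x)) =
      ∫ (fun x => (p (x + h : R * R) - p x) * (c (x + h : R * R) * g x)).
    by rewrite -RintB//; apply: Rint_ext => x; ring.
  have -> : ∫ (fun h0 : P => c (h0 + h : R * R) * p (h0 + h : R * R) * g h0) - ∫ (fun h0 : P => c (h0 + h : R * R) * (g h0 * p h0)) =
     ∫ (fun x => (p (x + h : R * R) - p x) * (c (x + h : R * R) * g x)) := e3.
  apply: le_trans (translate_bound h m0 t0 sG G0) _; rewrite -/S.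
  have G2 : ∫ (fun z => (c (z + h : R * R) * g z) ^+ 2) <= M ^+ 2 * ∫ (fun z => g z ^+ 2).
    rewrite -RintZ; last exact: (tame_sqi m0 tg).2.
    apply: Rint_le; [exact: sG.2|exact/integZ/(tame_sqi m0 tg).2|move=> x].
    rewrite exprMn; case: (pselect (square m x)) => sx; last by rewrite g0// expr0n !mulr0.
    rewrite ler_wpM2r ?sqr_ge0// -(real_normK (num_real (c _))) ler_pXn2r ?nnegrE//.
    exact: bcx.
  apply: ler_pM; rewrite ?addr_ge0//.
  - rewrite mulr_ge0 ?(ltW t0)//; apply: Rint_ge0 => z; exact: sqr_ge0.
  - by rewrite mulr_ge0// invr_ge0 mulr_ge0 ?(ltW t0).
  - by rewrite mulr_natl mulr2n lerD.
  - by rewrite /B lerD2r ler_wpM2l ?(ltW t0).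
have -> : 8 * K * (t * (M ^+ 2 * ∫ (fun z => g z ^+ 2)) + (4 * t)^-1 * S) =
    ∫ (fun h => (K / e ^+ 3 * (2 * e * B)) * \1_(square e) h).
  rewrite RintZ; last exact: integ_indic_square.
  rewrite {2}/Rintegral integral_indic//; last exact: measurable_square.
  rewrite setIT [X in fine X](area_square e0') /= -/B.
  by field; rewrite gt_eqF.
apply: Rint_abs_le.
- have [mH _ _] := tH; apply: measurable_funM => //; apply: measurable_funB.
    exact: mea_conv m0 lcp tg.
  exact: mea_conv m0 lc tgp.
- exact/integZ/integ_indic_square.
- move=> h; case: (pselect (square e h)) => sh; last first.
    by rewrite H0// mul0r normr0 indicE memNset// mulr0.
  by rewrite indicE mem_set// mulr1 normrM ler_pM// key.
Qed.

End Translation.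
End Commutator.

(** * Mollification and the weak product rule *)

Section ProductRule.
Context {R : realType}.
Local Notation P := (measurableTypeR R * measurableTypeR R)%type.
Local Notation integ f := ((@area R).-integrable setT (EFin \o f)).
Local Notation mea f := (@measurable_fun _ _ P R setT f).
Local Notation "'∫' f" := (Rintegral (@area R) setT f) (at level 10, f at level 9).
Local Notation sqi := (@sqint _ P R (@area R)).
Local Notation ile g := (@integ_le _ P R (@area R) _ g).
Local Notation ibnd C := (@integ_bndM _ P R (@area R) C).
Implicit Types (x y z h : R * R) (f g c u : P -> R) (n m e t : R) (v : R * R).

Lemma conv_unif c e x (w : R) : 0 < e -> locint c -> 0 <= w ->
  (forall h, square e h -> `|c (x + h : R * R) - c x| <= w) -> `|conv c (moll e) x - c x| <= w.
Proof.
move=> e0 lc w0 hw; have tm := tame_moll e0; have [mm _ m0] := tm.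
have im := tame_integ (ltW e0) tm.
have i1 : integ (fun h : P => c (h + x : R * R) * moll e h).
  have := integ_shift x (conv_integrand (ltW e0) lc tm x).
  by congr (_.-integrable _ (EFin \o _)); apply/funext => h; rewrite addrK.
have -> : conv c (moll e) x - c x = ∫ (fun h : P => (c (h + x : R * R) - c x) * moll e h).
  rewrite (conv_shift (ltW e0) lc tm) -[c x in LHS]mulr1 -(Rint_moll e0) -RintZ//.
  by rewrite -RintB//; [apply: Rint_ext => h; ring|exact: integZ].
rewrite -[w]mulr1 -(Rint_moll e0) -RintZ//; apply: Rint_abs_le.
- have := integ_meas (integB i1 (integZ (c x) im)); congr measurable_fun.
  by apply/funext => h; ring.
- exact: integZ.
- move=> h; rewrite normrM (ger0_norm (moll_ge0 e0 h)).
  case: (pselect (square e h)) => sh; last by rewrite m0// !mulr0.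
  by rewrite ler_wpM2r ?moll_ge0// (addrC h) hw.
Qed.

Lemma vec_decomp h : h = h.1 *: ((1, 0) : R * R) + h.2 *: ((0, 1) : R * R).
Proof.
by case: h => a b; rewrite /= -[RHS]/(a * 1 + b * 0, a * 0 + b * 1) !mulr1 !mulr0 addr0 add0r.
Qed.

Lemma smooth_lipschitz u m : smooth u -> offzero m u -> exists2 L : R, 0 <= L &
  forall z h, `|u (z + h : R * R) - u z| <= L * (`|h.1| + `|h.2|).
Proof.
move=> su u0.
have dirb v : isdir v -> exists2 C : R, 0 <= C & forall z (s : R), `|u (z + s *: v : R * R) - u z| <= C * `|s|.
  move=> dv; have [_ [C hC] _] := tame_dir dv su u0; exists `|C| => // z s.
  have dF (r : R) : is_derive r 1 (fun r : R => u (z + r *: v : R * R)) ('D_v (u : R * R -> R) (z + r *: v : R * R)).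
    have /is_derive_line H := smooth_dirP (z + r *: v : R * R) v su.
    have -> : (fun t : R => u (z + t *: v : R * R)) =
      (fun h : R => u (h *: v + (z + r *: v) : R * R)) \o (fun q => q - r).
      by apply/funext => q /=; congr u; rewrite addrCA -scalerDl addrNK.
    rewrite -[X in is_derive _ _ _ X]mulr1; apply: is_derive1_comp; first by rewrite subrr.
    by apply: is_derive_eq (is_deriveB (is_derive_id _ _) (is_derive_cst _ _ _)) _; rewrite subr0.
  have := mvt_bound s dF (fun r => le_trans (hC _ I) (ler_norm C)).
  by rewrite scale0r addr0.
have [C C0 hC] := dirb _ (or_introl erefl); have [D D0 hD] := dirb _ (or_intror erefl).
exists (C + D); first exact: addr_ge0.
move=> z h; pose z1 : R * R := z + h.1 *: ((1, 0) : R * R).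
have e1 : z + h = z1 + h.2 *: ((0, 1) : R * R).
  by rewrite /z1 -addrA; congr (_ + _); exact: vec_decomp.
have -> : u (z + h : R * R) - u z = (u (z + h : R * R) - u z1) + (u z1 - u z) by ring.
apply: le_trans (ler_normD _ _) _; rewrite e1.
have := lerD (hD z1 h.2) (hC z h.1); rewrite -/z1 => H; apply: le_trans H _.
rewrite -subr_ge0.
have -> : (C + D) * (`|h.1| + `|h.2|) - (D * `|h.2| + C * `|h.1|) = C * `|h.2| + D * `|h.1| by ring.
by rewrite addr_ge0// mulr_ge0.
Qed.

Lemma L1_approx f n (d : R) : 0 <= n -> sqi f -> offzero n f -> 0 < d ->
  exists u : P -> R, [/\ smooth u, offzero (n + 1) u & ∫ (fun z => `|f z - u z|) <= d].
Proof.
move=> n0 sf f0 d0; have n1 : 0 <= n + 1 by rewrite addr_ge0.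
pose A := ∫ (\1_(square (n + 1)) : P -> R).
have A0 : 0 <= A by apply: Rint_ge0.
have A1 : 0 < A + 1 by rewrite ltr_wpDl.
pose t := (A + 1) / (2 * d); have t0 : 0 < t by apply: divr_gt0 => //; apply: mulr_gt0.
pose r := d / (2 * t); have r0 : 0 < r by apply: divr_gt0 => //; apply: mulr_gt0.
have [u [su u0 hu]] := smooth_approx n0 sf f0 r0; exists u; split => //.
have squ := tame_sqi n1 (smooth_tame su u0).
have f0' : offzero (n + 1) f.
  by move=> z nz; apply: f0 => sz; apply: nz; apply: squareS sz; rewrite lerDl.
have sD := sqintB sf squ; have iA := integ_indic_square n1.
apply: (@le_trans _ _ (t * ∫ (fun z => (f z - u z) ^+ 2) + (4 * t)^-1 * A)).
  rewrite /A -!RintZ//; last exact: sD.2.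
  rewrite -RintD//; [|exact/integZ/sD.2|exact: integZ].
  have ii : integ (fun z => t * (f z - u z) ^+ 2 + (4 * t)^-1 * \1_(square (n + 1)) z).
    by apply: integD; apply: integZ => //; exact: sD.2.
  have bnd z : `|f z - u z| <= t * (f z - u z) ^+ 2 + (4 * t)^-1 * \1_(square (n + 1)) z.
    case: (pselect (square (n + 1) z)) => sz.
      by have := amgm (f z - u z) 1 t0; rewrite mulr1 expr1n indicE mem_set.
    by rewrite f0'// u0// subrr normr0 expr0n mulr0 add0r indicE memNset// mulr0.
  apply: Rint_le => //; apply: (ile _ _ ii).
    by apply: measurableT_comp => //; apply: measurable_funB; [case: sf|case: squ].
  by move=> z; rewrite normr_id.
have h1 : t * ∫ (fun z => (f z - u z) ^+ 2) <= d / 2.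
  apply: (@le_trans _ _ (t * r)); first by rewrite ler_wpM2l// ltW.
  by rewrite le_eqVlt; apply/orP; left; apply/eqP; rewrite /r; field; rewrite gt_eqF.
have h2 : (4 * t)^-1 * A <= d / 2.
  have -> : (4 * t)^-1 * A = (d / 2) * (A / (A + 1)).
    by rewrite /t; field; rewrite !gt_eqF.
  by rewrite ler_piMr ?divr_ge0 ?(ltW d0) ?(ltW A1)// ler_pdivrMr// mul1r lerDl.
by apply: le_trans (lerD h1 h2) _; lra.
Qed.

Lemma conv_sub c u (H : P -> R) n x : 0 <= n -> locint c -> locint u -> tame n H ->
  conv (fun y => c y - u y) H x = conv c H x - conv u H x.
Proof.
move=> n0 lc lu tH; rewrite /conv -RintB; [|exact: conv_integrand n0 lc tH x|exact: conv_integrand n0 lu tH x].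
by apply: Rint_ext => y; ring.
Qed.

Lemma conv_tame g (H : P -> R) n m : 0 <= n -> 0 <= m -> locint g -> offzero m g -> tame n H ->
  tame (m + n) (conv g H).
Proof.
move=> n0 m0 lg g0 tH; have [_ _ H0] := tH.
have off x : ~ square (m + n) x -> conv g H x = 0.
  move=> nx; rewrite -[RHS]Rint0; apply: Rint_ext => y.
  case: (pselect (square m y)) => sy; last by rewrite g0// mul0r.
  rewrite H0 ?mulr0// => /squareE /= [h1 h2]; apply: nx; apply/squareE.
  move: sy => /squareE[y1 y2].
  have key (a b : R) : `|a| <= m -> `|a - b| <= n -> `|b| <= m + n.
    move=> k1 k2; have -> : b = a - (a - b) by ring.
    by rewrite (le_trans (ler_normB _ _))// lerD.
  by split; [apply: key y1 h1|apply: key y2 h2].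
split => //; first exact: mea_conv n0 lg tH.
have [C hC] := conv_bounded n0 lg tH (addr_ge0 m0 n0); exists `|C| => x _.
case: (pselect (square (m + n) x)) => sx; first by rewrite (le_trans (hC _ sx)) ?ler_norm.
by rewrite off// normr0.
Qed.

(* [s = 1] for an even kernel, [s = -1] for an odd one. *)
Lemma conv_transpose c g (H : P -> R) n m (s : R) : 0 <= n -> 0 <= m -> locint c -> tame n H ->
  integ g -> offzero m g -> (forall h, H (- h) = s * H h) ->
  ∫ (fun x => g x * conv c H x) = s * ∫ (fun y => c y * conv g H y).
Proof.
move=> n0 m0 lc tH ig g0 Hs; have lg := integ_locint ig.
have ii : integ (fun y => c y * conv g H y).
  have := tame_mul (addr_ge0 m0 n0) (conv_tame n0 m0 lg g0 tH) lc.
  by congr (_.-integrable _ (EFin \o _)); apply/funext => y; exact: mulrC.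
rewrite (conv_fubini n0 lc tH m0 ig g0) -RintZ//; apply: Rint_ext => y.
rewrite mulrCA; congr (_ * _); rewrite /conv -RintZ; last exact: conv_integrand n0 lg tH y.
by apply: Rint_ext => x; rewrite mulrCA -Hs opprB.
Qed.

Lemma moll_L1 g (w : P -> R) e m (B : R) : 0 < e -> 0 <= m -> tame m g -> (forall z, `|g z| <= B) ->
  integ w -> `|∫ (fun x => g x * conv w (moll e) x)| <= B * ∫ (fun z => `|w z|).
Proof.
move=> e0 m0 tg gB iw; have tm := tame_moll e0; have [_ _ g0] := tg.
have lw := integ_locint iw; have ig := tame_integ m0 tg; have lg := integ_locint ig.
have even h : moll e (- h) = 1 * moll e h by rewrite mollN mul1r.
rewrite (conv_transpose (ltW e0) m0 lw tm ig g0 even) mul1r.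
have iw' := integ_norm iw; rewrite -RintZ//; apply: Rint_abs_le.
- apply: measurable_funM; [exact: integ_meas iw|exact: mea_conv (ltW e0) lg tm].
- exact: integZ.
- move=> y; rewrite normrM mulrC ler_wpM2r//.
  have im := tame_integ (ltW e0) tm.
  rewrite (conv_shift (ltW e0) lg tm) -[B]mulr1 -(Rint_moll e0) -RintZ//.
  apply: Rint_abs_le; last 1 first.
  + by move=> h; rewrite normrM (ger0_norm (moll_ge0 e0 h)) ler_wpM2r ?moll_ge0.
  + have [mg _ _] := tg; have [mm _ _] := tm; apply: measurable_funM => //; exact: mea_shift.
  + exact: integZ.
Qed.

Lemma moll_weak_cvg f g n m (d : R) : 0 <= n -> sqi f -> offzero n f -> 0 <= m -> tame m g -> 0 < d ->
  exists2 r : R, 0 < r & forall e, 0 < e -> e <= r ->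
    `|∫ (fun x => g x * conv f (moll e) x) - ∫ (fun x => g x * f x)| <= d.
Proof.
move=> n0 sf f0 m0 tg d0; have n1 : 0 <= n + 1 by rewrite addr_ge0.
have [mg [B0 hB0] g0] := tg.
pose B := `|B0| + 1; have B1 : 0 < B by rewrite ltr_wpDl.
have hB z : `|g z| <= B by rewrite (le_trans (hB0 z I))// (le_trans (ler_norm _))// lerDl.
have d3 : 0 < d / (3 * B) by rewrite divr_gt0 ?mulr_gt0.
have [u [su u0 hu]] := L1_approx n0 sf f0 d3.
have [L L0 hL] := smooth_lipschitz su u0.
have ig := tame_integ m0 tg; have iga := integ_norm ig.
pose Ig := ∫ (fun x => `|g x|); have Ig0 : 0 <= Ig by apply: Rint_ge0.
pose r := d / (3 * (2 * L + 1) * (Ig + 1)).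
have L1 : 0 < 2 * L + 1 by rewrite ltr_wpDl// mulr_ge0.
have Ig1 : 0 < Ig + 1 by rewrite ltr_wpDl.
have r0 : 0 < r by apply: divr_gt0 => //; apply: mulr_gt0 => //; apply: mulr_gt0.
exists r => // e e0 er.
have tm := tame_moll e0; have tu := smooth_tame su u0; have squ := tame_sqi n1 tu.
have lf := sqi_locint sf; have lu := sqi_locint squ.
have f0' : offzero (n + 1) f.
  by move=> z nz; apply: f0 => sz; apply: nz; apply: squareS sz; rewrite lerDl.
have iu := tame_integ n1 tu.
have onf : integ f.
  have := tame_mul n1 (@tame_cutoff R n) lf.
  congr (_.-integrable _ (EFin \o _)); apply/funext => z.
  case: (pselect (square n z)) => sz; first by rewrite cutoff1// mul1r.
  by rewrite f0// mulr0.
have ifu := integB onf iu.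
have lfu := integ_locint ifu.
have k1 : integ (fun x => g x * conv f (moll e) x).
  by apply: (supp_conv_integ (ltW e0) lf tm m0).
have k2 : integ (fun x => g x * conv u (moll e) x).
  by apply: (supp_conv_integ (ltW e0) lu tm m0).
have k3 : integ (fun x => g x * f x) by exact: tame_mul m0 tg lf.
have k4 : integ (fun x => g x * u x) by exact: tame_mul m0 tg lu.
have e1 : ∫ (fun x => g x * conv f (moll e) x) - ∫ (fun x => g x * f x) =
    ∫ (fun x => g x * conv (fun y => f y - u y) (moll e) x) +
    ∫ (fun x => g x * (conv u (moll e) x - u x)) + ∫ (fun x => g x * (u x - f x)).
  have -> : ∫ (fun x => g x * conv (fun y => f y - u y) (moll e) x) =
     ∫ (fun x => g x * conv f (moll e) x) - ∫ (fun x => g x * conv u (moll e) x).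
    rewrite -RintB//; apply: Rint_ext => x.
    by rewrite (conv_sub x (ltW e0) lf lu tm); ring.
  have -> : ∫ (fun x => g x * (conv u (moll e) x - u x)) =
     ∫ (fun x => g x * conv u (moll e) x) - ∫ (fun x => g x * u x).
    by rewrite -RintB//; apply: Rint_ext => x; ring.
  have -> : ∫ (fun x => g x * (u x - f x)) = ∫ (fun x => g x * u x) - ∫ (fun x => g x * f x).
    by rewrite -RintB//; apply: Rint_ext => x; ring.
  by rewrite !subrKA.
have b1 : `|∫ (fun x => g x * conv (fun y => f y - u y) (moll e) x)| <= d / 3.
  apply: le_trans (moll_L1 e0 m0 tg hB ifu) _.
  apply: (@le_trans _ _ (B * (d / (3 * B)))); first by rewrite ler_wpM2l// ltW.
  by rewrite le_eqVlt; apply/orP; left; apply/eqP; field; rewrite gt_eqF.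
have b3 : `|∫ (fun x => g x * (u x - f x))| <= d / 3.
  apply: (@le_trans _ _ (B * ∫ (fun z => `|f z - u z|))).
    have iw := integ_norm ifu; rewrite -RintZ//; apply: Rint_abs_le.
    - by apply: measurable_funM => //; apply: measurable_funB; [case: squ|case: sf].
    - exact: integZ.
    - by move=> z; rewrite normrM distrC ler_wpM2r.
  apply: (@le_trans _ _ (B * (d / (3 * B)))); first by rewrite ler_wpM2l// ltW.
  by rewrite le_eqVlt; apply/orP; left; apply/eqP; field; rewrite gt_eqF.
have b2 : `|∫ (fun x => g x * (conv u (moll e) x - u x))| <= d / 3.
  apply: (@le_trans _ _ (∫ (fun x => (2 * L * e) * `|g x|))).
    apply: Rint_abs_le.
    - apply: measurable_funM => //; apply: measurable_funB; last by case: squ.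
      exact: mea_conv (ltW e0) lu tm.
    - exact: integZ.
    - move=> x; rewrite normrM mulrC ler_wpM2r//; apply: conv_unif => //.
        by rewrite !mulr_ge0// ltW.
      move=> h /squareE[h1 h2]; apply: le_trans (hL x h) _.
      by have := ler_wpM2l L0 (lerD h1 h2); rewrite (_ : L * (e + e) = 2 * L * e)//; ring.
  rewrite RintZ// -/Ig.
  apply: (@le_trans _ _ (2 * L * r * Ig)).
    by apply: ler_wpM2r => //; apply: ler_wpM2l => //; rewrite mulr_ge0.
  have -> : 2 * L * r * Ig = d / 3 * ((2 * L) / (2 * L + 1) * (Ig / (Ig + 1))).
    by rewrite /r; field; rewrite !gt_eqF.
  rewrite ler_piMr ?divr_ge0 ?(ltW d0)// mulr_ile1 ?divr_ge0 ?(ltW L1) ?(ltW Ig1) ?mulr_ge0//.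
    by rewrite ler_pdivrMr// mul1r lerDl.
  by rewrite ler_pdivrMr// mul1r lerDl.
rewrite e1; apply: le_trans (ler_normD _ _) _.
apply: le_trans (lerD (ler_normD _ _) (lexx _)) _.
by apply: le_trans (lerD (lerD b1 b2) b3) _; rewrite (_ : d / 3 + d / 3 + d / 3 = d)//; field.
Qed.

End ProductRule.

Section ProductRule2.
Context {R : realType}.
Local Notation P := (measurableTypeR R * measurableTypeR R)%type.
Local Notation integ f := ((@area R).-integrable setT (EFin \o f)).
Local Notation mea f := (@measurable_fun _ _ P R setT f).
Local Notation "'∫' f" := (Rintegral (@area R) setT f) (at level 10, f at level 9).
Local Notation sqi := (@sqint _ P R (@area R)).
Local Notation ile g := (@integ_le _ P R (@area R) _ g).
Local Notation ibnd C := (@integ_bndM _ P R (@area R) C).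
Implicit Types (x y z h : R * R) (n m e t : R) (v : R * R).

Lemma compact_nbhd (K Om : set (R * R)) : compact K -> open Om -> K `<=` Om ->
  exists r : R, 0 < r /\ exists K' : set (R * R), [/\ compact K', K' `<=` Om &
    forall x h, K x -> square r h -> K' (x + h)].
Proof.
move=> cK oO KO.
have /compact_near_coveringP/(_ R 0^'+ (fun (r : R) x => ball x r `<=` Om)) := cK.
have near0 x : K x -> \forall x' \near x & r \near (0 : R)^'+, ball x' r `<=` Om.
  move=> Kx; have [rho /= r0 xO] : exists2 rho : R, 0 < rho & ball x rho `<=` Om.
    by move: oO => /(_ _ (KO x Kx)) /nbhs_ballP [e e0 ?]; exists e.
  exists (ball x (rho / 2), [set r : R | r < rho / 2]); first split => /=.
  - by apply: nbhsx_ballx; rewrite divr_gt0.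
  - by near=> r; near: r; apply: nbhs_right_lt; rewrite divr_gt0.
  - move=> [y r] /= [xy rr]; apply: subset_trans xO => w yw.
    rewrite (splitr rho); apply: ball_triangle xy _; apply: le_ball yw; exact: ltW.
move=> /(_ _ near0) hn.
have [r [r0 hr]] : exists r : R, 0 < r /\ forall x, K x -> ball x r `<=` Om.
  have : \forall r \near (0 : R)^'+, 0 < r /\ (forall x, K x -> ball x r `<=` Om).
    near=> r; split; first by near: r; exact: nbhs_right_gt.
    by near: r; exact: hn.
  by move=> /filter_ex [r hr]; exists r.
exists (r / 2); split; first by rewrite divr_gt0.
exists ((fun w : (R * R) * (R * R) => w.1 + w.2 : R * R) @` (K `*` square (r / 2))); split.
- apply: continuous_compact; last by apply: compact_setX => //; exact: compact_square.
  apply: continuous_subspaceT => w; apply: cvgD; [exact: cvg_fst|exact: cvg_snd].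
- move=> _ [[x h] [Kx /= /squareE[h1 h2]] <-]; rewrite /= in Kx *; apply: (hr x Kx); split; rewrite /ball /=.
    by rewrite opprD addNKr normrN (le_lt_trans h1)// ltr_pdivrMr// ltr_pMr// ltr1n.
  by rewrite opprD addNKr normrN (le_lt_trans h2)// ltr_pdivrMr// ltr_pMr// ltr1n.
- by move=> x h Kx sh; exists (x, h).
Unshelve. all: by end_near. Qed.

Definition unifc (c : P -> R) := forall w : R, 0 < w ->
  exists2 r : R, 0 < r & forall x h, square r h -> `|c (x + h : R * R) - c x| <= w.

Lemma dir_moll_odd e v h : 0 < e -> isdir v ->
  'D_v (moll e : R * R -> R) (- h) = -1 * 'D_v (moll e : R * R -> R) h.
Proof.
move=> e0 dv.
have := is_derive_opp_dir (smooth_dirP h v (@smooth_moll R e)) => /is_derive_line H.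
have : is_derive (- h) v (moll e : R * R -> R) (- 'D_v (moll e : R * R -> R) h).
  apply/is_derive_line; move: H; congr is_derive; apply/funext => t.
  by rewrite -mollN opprD scalerN !opprK.
by case=> _ ->; rewrite mulN1r.
Qed.

Section Rule.
Variables (v : R * R) (Om : set (R * R)) (c cv p pv psi : P -> R).
Hypotheses (dv : isdir v) (oO : open Om) (cc : continuous (c : R * R -> R)) (uc : unifc c).
Hypothesis cvloc : forall K : set (R * R), compact K -> K `<=` Om -> sqi (fun z => \1_K z * cv z).
Hypothesis wc : wd v Om c cv.
Hypotheses (mp : mea p) (bp : forall z, `|p z| <= 1) (spv : sqi pv) (wp : wd v setT p pv).
Hypothesis tpsi : test_function Om psi.

Let supp := closure [set z : R * R | psi z != 0].

Lemma weak_product_rule :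
  ∫ (fun z => c z * (p z * 'D_v (psi : R * R -> R) z + pv z * psi z)) =
  - ∫ (fun z => (p z * psi z) * cv z).
Proof.
have lc : locint c by exact: continuous_locint.
have [_ cS sO] := tpsi; have spsi := test_smooth tpsi.
have [r [r0 [K' [cK' K'O hK']]]] := compact_nbhd cS oO sO.
have [n n0 tn] := test_tame tpsi; have [mpsi [Bp hBp] psi0] := tn.
have tdn := tame_dir dv spsi psi0.
have [N N0 KN] := compact_in_square cK'.
pose cv' z := \1_K' z * cv z.
have scv' : sqi cv' by exact: cvloc.
have cv'0 : offzero N cv'.
  by move=> z nz; rewrite /cv' indicE memNset ?mul0r// => /KN.
have lp : locint p by apply: bounded_locint => // k; exists 1 => z _.
pose g1 z := p z * 'D_v (psi : R * R -> R) z.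
pose g2 z := pv z * psi z.
pose g3 z := p z * psi z.
have bpn : bounded_on (square n) p by exists 1 => z _; exact: bp.
have tg1 : tame n g1 by exact: tameM.
have tg3 : tame n g3 by exact: tameM.
have ig1 := tame_integ n0 tg1; have ig3 := tame_integ n0 tg3.
have ig2 : integ g2.
  have := tame_mul n0 tn (sqi_locint spv).
  by congr (_.-integrable _ (EFin \o _)); apply/funext => z; exact: mulrC.
have g10 : offzero n g1 by case: tg1.
have g20 : offzero n g2 by move=> z nz; rewrite /g2 psi0// mulr0.
have g30 : offzero n g3 by case: tg3.
have lg1 := integ_locint ig1; have lg2 := integ_locint ig2; have lg3 := integ_locint ig3.
pose G z := g1 z + g2 z.
have iG : integ G by exact: integD.
have G0 : offzero n G by move=> z nz; rewrite /G g10// g20// addr0.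
have lG := integ_locint iG.
have lcv' := sqi_locint scv'.
have main e : 0 < e -> e <= r ->
    ∫ (fun x => G x * conv c (moll e) x) = - ∫ (fun x => g3 x * conv cv' (moll e) x).
  move=> e0 er; have e0' := ltW e0; have tm := tame_moll e0; have sm := @smooth_moll R e.
  have [_ _ m0] := tm.
  have tdm := tame_dir dv sm m0.
  have even h : moll e (- h) = 1 * moll e h by rewrite mollN mul1r.
  rewrite (conv_transpose e0' n0 lc tm iG G0 even) mul1r.
  have -> : ∫ (fun y => c y * conv G (moll e) y) =
     - ∫ (fun y => c y * conv g3 ('D_v (moll e : R * R -> R)) y).
    rewrite -RintN; last first.
      have := tame_mul (addr_ge0 n0 e0') (conv_tame e0' n0 lg3 g30 tdm) lc.
      by congr (_.-integrable _ (EFin \o _)); apply/funext => y; exact: mulrC.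
    apply: Rint_ext => y; rewrite -mulrN; congr (_ * _).
    pose q z := psi z * moll e (z - y : R * R).
    have sq1 : smooth (fun z => moll e (z - y : R * R)) by exact: smooth_shift.
    have tq : test_function setT q.
      apply: (@smooth_test_square _ n); first exact: smoothM.
      by move=> z nz; rewrite /q psi0// mul0r.
    have Dq z : 'D_v (q : R * R -> R) z = psi z * 'D_v (moll e : R * R -> R) (z - y : R * R) +
        moll e (z - y : R * R) * 'D_v (psi : R * R -> R) z.
      have := is_deriveM (smooth_dirP z v spsi) (smooth_dirP z v sq1).
      by rewrite dir_shift// => -[_ <-].
    have := wp tq.
    have i1 := conv_integrand e0' lg1 tm y.
    have i2 := conv_integrand e0' lg2 tm y.
    have i3 := conv_integrand e0' lg3 tdm y.
    have -> : ∫ (fun z => p z * 'D_v (q : R * R -> R) z) =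
        conv g3 ('D_v (moll e : R * R -> R)) y + conv g1 (moll e) y.
      by rewrite /conv -RintD//; apply: Rint_ext => z; rewrite Dq /g1 /g3; ring.
    have -> : ∫ (fun z => pv z * q z) = conv g2 (moll e) y.
      by apply: Rint_ext => z; rewrite /q /g2; ring.
    have -> : conv G (moll e) y = conv g1 (moll e) y + conv g2 (moll e) y.
      by rewrite /conv -RintD//; apply: Rint_ext => z; rewrite /G; ring.
    by move=> h; lra.
  have ct := conv_transpose e0' n0 lc tdm ig3 g30 (fun h => dir_moll_odd h e0 dv).
  rewrite mulN1r in ct; rewrite -ct.
  rewrite -RintN; last by apply: (supp_conv_integ e0' lcv' tm n0).
  apply: Rint_ext => x; rewrite -mulrN; case: (pselect (supp x)) => sx; last first.
    by rewrite /g3 (supp0 sx) mulr0 !mul0r.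
  congr (_ * _).
  have sq1 : smooth (fun z => moll e (z - x : R * R)) by exact: smooth_shift.
  have tq : test_function Om (fun z => moll e (z - x : R * R)).
    apply: (smooth_test sq1 cK' K'O) => z nz; apply: m0 => sz; apply: nz.
    rewrite (_ : z = x + (z - x)); last by rewrite addrC subrK.
    by apply: hK' => //; apply: squareS sz.
  have := wc tq; rewrite /conv.
  have -> : ∫ (fun z => c z * 'D_v (fun z : R * R => moll e (z - x : R * R)) z) =
      ∫ (fun y : P => c y * 'D_v (moll e : R * R -> R) (y - x : R * R)).
    by apply: Rint_ext => z; congr (_ * _); exact: (dir_shift (- x) z v (smooth_moll e)).
  move=> ->; congr (- _); apply: Rint_ext => z; rewrite /cv'.
  case: (pselect (K' z)) => kz; first by rewrite indicE mem_set// mul1r.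
  rewrite m0 ?mulr0// => sz; apply: kz.
  rewrite (_ : z = x + (z - x)); last by rewrite addrC subrK.
  by apply: hK' => //; apply: squareS sz.
apply/eqP; rewrite -subr_eq0 opprK -normr_le0; apply/ler_addgt0Pr => d d0; rewrite add0r.
have d2 : 0 < d / 2 by rewrite divr_gt0.
have [r1 r10 h1] := moll_weak_cvg N0 scv' cv'0 n0 tg3 d2.
pose IG := ∫ (fun z => `|G z|); have IG0 : 0 <= IG by apply: Rint_ge0.
have IG1 : 0 < IG + 1 by rewrite ltr_wpDl.
have w0 : 0 < d / (2 * (IG + 1)) by apply: divr_gt0 => //; apply: mulr_gt0.
have [r2 r20 h2] := uc w0.
pose e := Num.min r (Num.min r1 r2).
have e0 : 0 < e by rewrite !lt_min r0 r10 r20.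
have [er er1 er2] : [/\ e <= r, e <= r1 & e <= r2] by rewrite /e !ge_min !lexx !orbT.
have tm := tame_moll e0.
have iGc : integ (fun x => G x * conv c (moll e) x) by apply: (supp_conv_integ (ltW e0) lc tm n0).
have icG : integ (fun z => c z * G z).
  have [C hC] := continuous_bounded_on cc (@compact_square R n).
  have -> : (fun z => c z * G z) = (fun z => (\1_(square n) z * c z) * G z).
    apply/funext => z; case: (pselect (square n z)) => sz; last by rewrite G0// !mulr0.
    by rewrite indicE mem_set// mul1r.
  apply: (ibnd `|C|) => //.
    by apply: measurable_funM; [exact: mea_square|case: lc].
  move=> z; case: (pselect (square n z)) => sz; last by rewrite indicE memNset// mul0r normr0.
  by rewrite indicE mem_set// mul1r (le_trans (hC z sz))// ler_norm.
have b1 : `|∫ (fun z => c z * G z) - ∫ (fun x => G x * conv c (moll e) x)| <= d / 2.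
  apply: (@le_trans _ _ (∫ (fun z => d / (2 * (IG + 1)) * `|G z|))).
    rewrite -RintB//; apply: Rint_abs_le.
    - exact: integ_meas (integB icG iGc).
    - exact/integZ/integ_norm.
    - move=> z; rewrite (_ : c z * G z - _ = - (G z * (conv c (moll e) z - c z))); last by ring.
      rewrite normrN normrM mulrC ler_wpM2r//; apply: conv_unif => //; first exact: ltW.
      by move=> h sh; apply: h2; apply: squareS sh.
  rewrite RintZ; last exact: integ_norm.
  rewrite -/IG (_ : d / (2 * (IG + 1)) * IG = d / 2 * (IG / (IG + 1))); last first.
    by field; rewrite gt_eqF.
  by rewrite ler_piMr ?(ltW d2)// ler_pdivrMr// mul1r lerDl.
have b2 := h1 e e0 er1.
have eG : ∫ (fun z => c z * (p z * 'D_v (psi : R * R -> R) z + pv z * psi z)) = ∫ (fun z => c z * G z) by [].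
have eR : ∫ (fun z => (p z * psi z) * cv z) = ∫ (fun x => g3 x * cv' x).
  apply: Rint_ext => z; rewrite /g3 /cv'; case: (pselect (supp z)) => sz; last first.
    by rewrite (supp0 sz) mulr0 !mul0r.
  rewrite indicE mem_set ?mul1r//; rewrite -(addr0 z); apply: hK' => //.
  by apply/squareE; rewrite /= !normr0 ltW.
have := main e e0 er; rewrite eG eR => hm.
have -> : ∫ (fun z => c z * G z) + ∫ (fun x => g3 x * cv' x) =
   (∫ (fun z => c z * G z) - ∫ (fun x => G x * conv c (moll e) x)) -
   (∫ (fun x => g3 x * conv cv' (moll e) x) - ∫ (fun x => g3 x * cv' x)) by rewrite hm; ring.
by apply: le_trans (ler_normB _ _) _; apply: le_trans (lerD b1 b2) _; rewrite -splitr.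
Qed.

End Rule.
End ProductRule2.

(** * The Beltrami functional and its vanishing *)

Section BeltramiFunctional.
Context {R : realType}.
Local Notation P := (measurableTypeR R * measurableTypeR R)%type.
Local Notation integ f := ((@area R).-integrable setT (EFin \o f)).
Local Notation mea f := (@measurable_fun _ _ P R setT f).
Local Notation "'∫' f" := (Rintegral (@area R) setT f) (at level 10, f at level 9).
Local Notation sqi := (@sqint _ P R (@area R)).
Local Notation ile g := (@integ_le _ P R (@area R) _ g).
Local Notation ibnd C := (@integ_bndM _ P R (@area R) C).
Implicit Types (x y z h : R * R) (n m e t : R) (v : R * R) (psi : P -> R).

Lemma Rint_dir0 psi n v : isdir v -> 0 <= n -> smooth psi -> offzero n psi ->
  ∫ ('D_v (psi : R * R -> R)) = 0.
Proof.
move=> dv n0 sp p0; have tp := smooth_tame sp p0; have tdp := tame_dir dv sp p0.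
have l1 : locint (fun=> 1 : R) by apply: continuous_locint => ?; exact: cst_continuous.
have [_ H] := is_derive_under 0 n0 l1 tp tdp (fun z => smooth_dirP z v sp).
have -> : ∫ ('D_v (psi : R * R -> R)) = ∫ (fun z => 1 * 'D_v (psi : R * R -> R) (z + (0:R) *: v : R * R)).
  by apply: Rint_ext => z; rewrite scale0r addr0 mul1r.
rewrite -H; have -> : (fun s : R => ∫ (fun z => 1 * psi (z + s *: v : R * R))) = cst (∫ psi).
  apply/funext => s /=; rewrite -(Rint_shift (s *: v) (tame_integ n0 tp)).
  by apply: Rint_ext => z; rewrite mul1r.
by rewrite derive_cst.
Qed.

Record coefficient (p px py q qx qy : P -> R) (k : R) : Prop := {
  coef_mp : mea p; coef_mq : mea q;
  coef_k0 : 0 <= k; coef_k1 : k < 1;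
  coef_norm : forall z, p z ^+ 2 + q z ^+ 2 <= k ^+ 2;
  coef_px : sqi px; coef_py : sqi py; coef_qx : sqi qx; coef_qy : sqi qy;
  coef_wpx : wd (1, 0) setT p px; coef_wpy : wd (0, 1) setT p py;
  coef_wqx : wd (1, 0) setT q qx; coef_wqy : wd (0, 1) setT q qy }.

Variables (p px py q qx qy : P -> R) (k : R).
Hypothesis hc : coefficient p px py q qx qy k.

Lemma coef_bp z : `|p z| <= 1.
Proof.
have h := coef_norm hc z; have k0 := coef_k0 hc; have k1 := coef_k1 hc.
rewrite -(@ler_pXn2r _ 2) ?nnegrE// real_normK ?num_real// expr1n.
have : k ^+ 2 <= 1 by rewrite expr_le1// ltW.
have := sqr_ge0 (q z); lra.
Qed.

Lemma coef_bq z : `|q z| <= 1.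
Proof.
have h := coef_norm hc z; have k0 := coef_k0 hc; have k1 := coef_k1 hc.
rewrite -(@ler_pXn2r _ 2) ?nnegrE// real_normK ?num_real// expr1n.
have : k ^+ 2 <= 1 by rewrite expr_le1// ltW.
have := sqr_ge0 (p z); lra.
Qed.

Definition L1op psi : P -> R := fun z => dx psi z - (p z * dx psi z + px z * psi z) -
  (q z * dy psi z + qy z * psi z).
Definition L2op psi : P -> R := fun z => - dy psi z - (p z * dy psi z + py z * psi z) +
  (q z * dx psi z + qx z * psi z).

(* Twice the real part of the distribution
   [dbar f - mu df = dbar f - d(mu f) + f dmu], for [f = a + i b], [mu = p + i q]. *)
Definition Tfun (a b : P -> R) psi := ∫ (fun z => a z * L1op psi z) + ∫ (fun z => b z * L2op psi z).

Definition csmooth psi := smooth psi /\ exists2 n, 0 <= n & offzero n psi.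

Lemma csmooth_test Om psi : test_function Om psi -> csmooth psi.
Proof.
move=> tp; split; first exact: test_smooth tp.
by have [n n0 [_ _ h]] := test_tame tp; exists n.
Qed.

Lemma test_csmooth psi : csmooth psi -> test_function setT psi.
Proof. by move=> [sp [n _ p0]]; exact: smooth_test_square p0. Qed.

Lemma csmoothM psi phi : smooth psi -> csmooth phi -> csmooth (fun z => psi z * phi z).
Proof.
move=> sp [sf [m m0 f0]]; split; first exact: smoothM.
by exists m => // z nz; rewrite f0 ?mulr0.
Qed.

Let parts psi n : 0 <= n -> smooth psi -> offzero n psi ->
  [/\ [/\ integ (dx psi), integ (dy psi), integ (fun z => p z * dx psi z) & integ (fun z => p z * dy psi z)],
      [/\ integ (fun z => q z * dx psi z), integ (fun z => q z * dy psi z),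
          integ (fun z => px z * psi z) & integ (fun z => py z * psi z)] &
      integ (fun z => qx z * psi z) /\ integ (fun z => qy z * psi z)].
Proof.
move=> n0 sp p0; have tp := smooth_tame sp p0; have [tdx tdy] := tame_dxy sp p0.
have [idx idy] := (tame_integ n0 tdx, tame_integ n0 tdy).
have l (g : P -> R) : sqi g -> integ (fun z => g z * psi z).
  move=> sg; have := tame_mul n0 tp (sqi_locint sg).
  by congr (_.-integrable _ (EFin \o _)); apply/funext => z; exact: mulrC.
have b (g f : P -> R) : mea g -> (forall z, `|g z| <= 1) -> integ f -> integ (fun z => g z * f z).
  by move=> mg bg; exact: (ibnd 1).
have [mp mq bp bq] := And4 (coef_mp hc) (coef_mq hc) coef_bp coef_bq.
have [s1 s2 s3 s4] := And4 (coef_px hc) (coef_py hc) (coef_qx hc) (coef_qy hc).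
by split; split; [exact: idx|exact: idy|exact: b idx|exact: b idy|exact: b idx|exact: b idy|
  exact: l s1|exact: l s2|exact: l s3|exact: l s4].
Qed.

Lemma L1op_integ psi : csmooth psi -> integ (L1op psi).
Proof.
move=> [sp [n n0 p0]]; have [[i1 i2 i3 i4] [i5 i6 i7 i8] [i9 i10]] := parts n0 sp p0.
exact: (integB (integB i1 (integD i3 i7)) (integD i6 i10)).
Qed.

Lemma L2op_integ psi : csmooth psi -> integ (L2op psi).
Proof.
move=> [sp [n n0 p0]]; have [[i1 i2 i3 i4] [i5 i6 i7 i8] [i9 i10]] := parts n0 sp p0.
exact: (integD (integB (integN i2) (integD i4 i8)) (integD i5 i9)).
Qed.

Lemma L1op0 n psi : smooth psi -> offzero n psi -> offzero n (L1op psi).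
Proof.
move=> sp p0 z nz; have [[_ _ h1] [_ _ h2]] := tame_dxy sp p0.
by rewrite /L1op p0// h1// h2// !mulr0 !addr0 !subr0.
Qed.

Lemma L2op0 n psi : smooth psi -> offzero n psi -> offzero n (L2op psi).
Proof.
move=> sp p0 z nz; have [[_ _ h1] [_ _ h2]] := tame_dxy sp p0.
by rewrite /L2op p0// h1// h2// !mulr0 !addr0 subr0 oppr0.
Qed.

Lemma Rint_L1op psi : csmooth psi -> ∫ (L1op psi) = 0.
Proof.
move=> cp; have tp := test_csmooth cp; case: cp => sp [n n0 p0].
have [[i1 i2 i3 i4] [i5 i6 i7 i8] [i9 i10]] := parts n0 sp p0.
rewrite /L1op (RintB (integB i1 (integD i3 i7)) (integD i6 i10)) (RintB i1 (integD i3 i7)).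
rewrite (RintD i3 i7) (RintD i6 i10).
rewrite (Rint_dir0 (or_introl erefl) n0 sp p0).
by rewrite (coef_wpx hc tp) (coef_wqy hc tp); ring.
Qed.

Lemma Rint_L2op psi : csmooth psi -> ∫ (L2op psi) = 0.
Proof.
move=> cp; have tp := test_csmooth cp; case: cp => sp [n n0 p0].
have [[i1 i2 i3 i4] [i5 i6 i7 i8] [i9 i10]] := parts n0 sp p0.
rewrite /L2op (RintD (integB (integN i2) (integD i4 i8)) (integD i5 i9)).
rewrite (RintB (integN i2) (integD i4 i8)) (RintN i2) (RintD i4 i8) (RintD i5 i9).
rewrite (Rint_dir0 (or_intror erefl) n0 sp p0).
by rewrite (coef_wpy hc tp) (coef_wqx hc tp); ring.
Qed.

Lemma cont_offzero_integ n (c g : P -> R) : continuous (c : R * R -> R) -> integ g -> offzero n g ->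
  integ (fun z => c z * g z).
Proof.
move=> cc ig g0; have [C hC] := continuous_bounded_on cc (@compact_square R n).
have -> : (fun z => c z * g z) = (fun z => (\1_(square n) z * c z) * g z).
  apply/funext => z; case: (pselect (square n z)) => sz; last by rewrite g0// !mulr0.
  by rewrite indicE mem_set// mul1r.
apply: (ibnd `|C|) => //.
  by apply: measurable_funM; [exact: mea_square|exact: continuous_mea].
move=> z; case: (pselect (square n z)) => sz; last by rewrite indicE memNset// mul0r normr0.
by rewrite indicE mem_set// mul1r (le_trans (hC z sz))// ler_norm.
Qed.

Section Functional.
Variables (a b : P -> R).
Hypotheses (ca : continuous (a : R * R -> R)) (cb : continuous (b : R * R -> R)).

Let iL1 (c : P -> R) psi : continuous (c : R * R -> R) -> csmooth psi -> integ (fun z => c z * L1op psi z).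
Proof.
move=> cc cp; have [sp [n n0 p0]] := cp.
by apply: (cont_offzero_integ (n := n)) => //; [exact: L1op_integ|exact: L1op0].
Qed.

Let iL2 (c : P -> R) psi : continuous (c : R * R -> R) -> csmooth psi -> integ (fun z => c z * L2op psi z).
Proof.
move=> cc cp; have [sp [n n0 p0]] := cp.
by apply: (cont_offzero_integ (n := n)) => //; [exact: L2op_integ|exact: L2op0].
Qed.

Lemma TfunD psi phi : csmooth psi -> csmooth phi ->
  Tfun a b (fun z => psi z + phi z) = Tfun a b psi + Tfun a b phi.
Proof.
move=> cp cf; have [[sp _] [sf _]] := (cp, cf).
have e1 z : dx (fun z => psi z + phi z) z = dx psi z + dx phi z.
  by apply: dxE; apply: (is_deriveD (dxP _) (dxP _)); exact: smooth_differentiable.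
have e2 z : dy (fun z => psi z + phi z) z = dy psi z + dy phi z.
  by apply: dyE; apply: (is_deriveD (dyP _) (dyP _)); exact: smooth_differentiable.
have -> : Tfun a b psi + Tfun a b phi =
   (∫ (fun z => a z * L1op psi z) + ∫ (fun z => a z * L1op phi z)) +
   (∫ (fun z => b z * L2op psi z) + ∫ (fun z => b z * L2op phi z)) by rewrite /Tfun; ring.
rewrite -(RintD (iL1 ca cp) (iL1 ca cf)) -(RintD (iL2 cb cp) (iL2 cb cf)).
by rewrite /Tfun; congr (_ + _); apply: Rint_ext => z; rewrite /L1op /L2op e1 e2; ring.
Qed.

Let S := ∫ (fun z => px z ^+ 2) + ∫ (fun z => py z ^+ 2) + ∫ (fun z => qx z ^+ 2) + ∫ (fun z => qy z ^+ 2).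

Let sum4_14 (x1 x2 x3 x4 : R) : 0 <= x2 -> 0 <= x3 -> x1 + x4 <= x1 + x2 + x3 + x4.
Proof. by move=> *; lra. Qed.

Let sum4_23 (x1 x2 x3 x4 : R) : 0 <= x1 -> 0 <= x4 -> x2 + x3 <= x1 + x2 + x3 + x4.
Proof. by move=> *; lra. Qed.

Lemma Tfun_piece psi (x0 : R * R) (A r w : R) : csmooth psi -> 0 < r -> 0 <= A -> 0 <= w ->
  (forall z, `|psi z| <= A) -> (forall z, `|dx psi z| <= A / r /\ `|dy psi z| <= A / r) ->
  (forall z, ~ square (2 * r) (z - x0) -> psi z = 0) ->
  (forall z, square (2 * r) (z - x0) -> `|a z - a x0| <= w /\ `|b z - b x0| <= w) ->
  `|Tfun a b psi| <= 2 * (w * (A * r * (56 + S))).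
Proof.
move=> cp r0 A0 w0 bpsi bd p0 hw; have [sp [n n0 pn0]] := cp.
have r2 : 0 <= 2 * r by rewrite mulr_ge0// ltW.
pose Q z : R := \1_(square (2 * r)) (z - x0 : R * R).
have iQ : integ Q := integ_shift (- x0) (integ_indic_square r2).
have IQ : ∫ Q = 16 * r ^+ 2.
  rewrite (Rint_shift (- x0) (integ_indic_square r2)).
  rewrite /Rintegral integral_indic//; last exact: measurable_square.
  by rewrite setIT [X in fine X](area_square r2) /=; ring.
have Q1 z : square (2 * r) (z - x0) -> Q z = 1 by move=> h; rewrite /Q indicE mem_set.
have Q0 z : ~ square (2 * r) (z - x0) -> Q z = 0 by move=> h; rewrite /Q indicE memNset.
(* The support condition passes to the derivatives by translating to the origin. *)
have pd0 z : ~ square (2 * r) (z - x0) -> dx psi z = 0 /\ dy psi z = 0.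
  move=> nz; pose phi z := psi (z + x0 : R * R).
  have sphi : smooth phi by exact: smooth_shift.
  have phi0 : offzero (2 * r) phi.
    by move=> y ny; apply: p0; rewrite addrK.
  have [[_ _ h1] [_ _ h2]] := tame_dxy sphi phi0.
  have := h1 _ nz; have := h2 _ nz.
  by rewrite /dx /dy /phi !dir_shift// !subrK.
have Qm (g : P -> R) : sqi g -> integ (fun z => Q z * `|g z|) /\
    ∫ (fun z => Q z * `|g z|) <= r * ∫ (fun z => g z ^+ 2) + 4 * r.
  move=> sg; have [mg ig] := sg.
  have sQ : sqi Q.
    split; first exact: integ_meas iQ.
    have := iQ; congr (_.-integrable _ (EFin \o _)); apply/funext => z.
    by rewrite /Q indicE; case: (_ \in _); rewrite ?expr1n ?expr0n.
  have sga : sqi (fun z => `|g z|).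
    split; first exact: measurableT_comp.
    by have := ig; congr (_.-integrable _ (EFin \o _)); apply/funext => z; rewrite real_normK ?num_real.
  have r4 : 0 < r by []; split; first exact: sqint_mul.
  have := sqint_mul_le r4 sga sQ.
  have -> : ∫ (fun z => `|g z| ^+ 2) = ∫ (fun z => g z ^+ 2).
    by apply: Rint_ext => z; rewrite real_normK ?num_real.
  have -> : ∫ (fun z => Q z ^+ 2) = 16 * r ^+ 2.
    by rewrite -IQ; apply: Rint_ext => z; rewrite /Q indicE; case: (_ \in _); rewrite ?expr1n ?expr0n.
  have -> : (4 * r)^-1 * (16 * r ^+ 2) = 4 * r by field; rewrite gt_eqF.
  rewrite (_ : ∫ (fun z => `|g z| * Q z) = ∫ (fun z => Q z * `|g z|)); last first.
    by apply: Rint_ext => z; rewrite mulrC.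
  exact: le_trans (ler_norm _).
have sq0 (g : P -> R) : 0 <= ∫ (fun z => g z ^+ 2) by apply: Rint_ge0 => z; exact: sqr_ge0.
have main (c L g1 g2 : P -> R) : continuous (c : R * R -> R) -> sqi g1 -> sqi g2 ->
   integ L -> offzero n L -> ∫ L = 0 ->
   (forall z, square (2 * r) (z - x0) -> `|c z - c x0| <= w) ->
   (forall z, `|L z| <= 3 * A / r * Q z + (A * (Q z * `|g1 z|) + A * (Q z * `|g2 z|))) ->
   ∫ (fun z => g1 z ^+ 2) + ∫ (fun z => g2 z ^+ 2) <= S ->
   `|∫ (fun z => c z * L z)| <= w * (A * r * (56 + S)).
  move=> cc sg1 sg2 iL L0 IL hcw bL hS.
  have [iq1 hq1] := Qm _ sg1; have [iq2 hq2] := Qm _ sg2.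
  have icL : integ (fun z => c z * L z) by exact: cont_offzero_integ L0.
  have -> : ∫ (fun z => c z * L z) = ∫ (fun z => (c z - c x0) * L z).
    rewrite -[LHS]subr0 -(mulr0 (c x0)) -IL -RintZ// -RintB//; last exact: integZ.
    by apply: Rint_ext => z; ring.
  have iB : integ (fun z => 3 * A / r * Q z + (A * (Q z * `|g1 z|) + A * (Q z * `|g2 z|))).
    by apply: integD; [exact: integZ|apply: integD; exact: integZ].
  apply: (@le_trans _ _ (∫ (fun z => w * (3 * A / r * Q z + (A * (Q z * `|g1 z|) + A * (Q z * `|g2 z|)))))).
    apply: Rint_abs_le.
    - have := integ_meas (integB icL (integZ (c x0) iL)); congr measurable_fun.
      by apply/funext => z; ring.
    - exact: integZ.
    - move=> z; rewrite normrM; case: (pselect (square (2 * r) (z - x0))) => sz.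
        by rewrite ler_pM// hcw.
      have := bL z; rewrite Q0// !(mul0r, mulr0) !addr0 normr_le0 => /eqP ->.
      by rewrite normr0 !mulr0.
  rewrite RintZ// ler_wpM2l//.
  rewrite RintD; [|exact: integZ|by apply: integD; exact: integZ].
  rewrite RintD; [|exact: integZ|exact: integZ].
  rewrite !RintZ// IQ.
  have -> : 3 * A / r * (16 * r ^+ 2) = 48 * A * r by field; rewrite gt_eqF.
  have h1 := ler_wpM2l A0 hq1; have h2 := ler_wpM2l A0 hq2.
  have h3 : A * r * (∫ (fun z => g1 z ^+ 2) + ∫ (fun z => g2 z ^+ 2)) <= A * r * S.
    by rewrite ler_wpM2l// mulr_ge0// ltW.
  have -> : A * r * (56 + S) = 56 * A * r + A * r * S by ring.
  apply: le_trans (lerD (lexx _) (lerD h1 h2)) _.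
  rewrite (_ : _ + (_ + _) = 56 * A * r + A * r * (∫ (fun z => g1 z ^+ 2) + ∫ (fun z => g2 z ^+ 2))).
    by rewrite lerD2l.
  by ring.
have Ar : 0 <= A / r by rewrite divr_ge0// ltW.
have [bp bq] := (coef_bp, coef_bq).
have bnd z (c1 c2 c3 g1 g2 : R) : `|c1| <= A / r -> `|c2| <= A / r -> `|c3| <= A / r ->
   square (2 * r) (z - x0) ->
   `|c1| + `|c2| + `|c3| + `|g1 * psi z| + `|g2 * psi z| <=
   3 * A / r * Q z + (A * (Q z * `|g1|) + A * (Q z * `|g2|)).
  move=> h1 h2 h3 sz; rewrite Q1// mulr1 !mul1r !normrM.
  have k1 : `|g1| * `|psi z| <= A * `|g1| by rewrite mulrC ler_wpM2r.
  have k2 : `|g2| * `|psi z| <= A * `|g2| by rewrite mulrC ler_wpM2r.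
  have -> : 3 * A / r = A / r + A / r + A / r by field; rewrite gt_eqF.
  lra.
have small (c d : R) : `|c| <= 1 -> `|d| <= A / r -> `|c * d| <= A / r.
  by move=> h1 h2; rewrite normrM -[A / r]mul1r ler_pM.
have tri5 (c1 c2 c3 c4 c5 : R) : `|c1 - (c2 + c3) - (c4 + c5)| <= `|c1| + `|c2| + `|c4| + `|c3| + `|c5|.
  rewrite (_ : c1 - (c2 + c3) - (c4 + c5) = c1 - c2 - c4 - c3 - c5); last by ring.
  by do 4! (apply: le_trans (ler_normB _ _) _; rewrite lerD2r).
rewrite /Tfun; apply: le_trans (ler_normD _ _) _.
have -> : 2 * (w * (A * r * (56 + S))) = w * (A * r * (56 + S)) + w * (A * r * (56 + S)) by ring.
have [s1 s2 s3 s4] := And4 (sq0 px) (sq0 py) (sq0 qx) (sq0 qy).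
apply: lerD.
- apply: (main a (L1op psi) px qy) => //; [by case: hc|by case: hc|exact: L1op_integ|exact: L1op0|exact: Rint_L1op| | |].
  + by move=> z /hw[].
  + move=> z; case: (pselect (square (2 * r) (z - x0))) => sz; last first.
      have [h1 h2] := pd0 _ sz.
      by rewrite /L1op p0// h1 h2 Q0// !(mulr0, mul0r, addr0, subr0) normr0.
    have [h1 h2] := bd z; rewrite /L1op; apply: le_trans (tri5 _ _ _ _ _) _.
    by apply: bnd => //; exact: small.
  + exact: sum4_14.
- apply: (main b (L2op psi) py qx) => //; [by case: hc|by case: hc|exact: L2op_integ|exact: L2op0|exact: Rint_L2op| | |].
  + by move=> z /hw[].
  + move=> z; case: (pselect (square (2 * r) (z - x0))) => sz; last first.
      have [h1 h2] := pd0 _ sz.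
      by rewrite /L2op p0// h1 h2 Q0// !(mulr0, mul0r, addr0, subr0, oppr0) normr0.
    have [h1 h2] := bd z; rewrite /L2op.
    have -> : - dy psi z - (p z * dy psi z + py z * psi z) + (q z * dx psi z + qx z * psi z) =
      - dy psi z - (p z * dy psi z + py z * psi z) - (- q z * dx psi z + - qx z * psi z) by ring.
    apply: le_trans (tri5 _ _ _ _ _) _; rewrite -[`|- qx z * _|]normrN -mulNr opprK.
    by apply: bnd => //; [rewrite normrN|exact: small|apply: small => //; rewrite normrN].
  + exact: sum4_23.
Qed.

End Functional.
End BeltramiFunctional.

Section CoverAndLocal.
Context {R : realType}.
Local Notation P := (measurableTypeR R * measurableTypeR R)%type.
Local Notation integ f := ((@area R).-integrable setT (EFin \o f)).
Local Notation mea f := (@measurable_fun _ _ P R setT f).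
Local Notation "'∫' f" := (Rintegral (@area R) setT f) (at level 10, f at level 9).
Local Notation sqi := (@sqint _ P R (@area R)).
Local Notation ile g := (@integ_le _ P R (@area R) _ g).
Local Notation ibnd C := (@integ_bndM _ P R (@area R) C).
Implicit Types (x y z h : R * R) (n m e t : R) (v : R * R) (psi : P -> R).

Record weak_solution (Om : set (R * R)) (p q a a1 a2 b b1 b2 : P -> R) : Prop := {
  sol_ca : continuous (a : R * R -> R); sol_cb : continuous (b : R * R -> R);
  sol_ua : unifc a; sol_ub : unifc b;
  sol_loc : forall K : set (R * R), compact K -> K `<=` Om ->
    [/\ sqi (fun z => \1_K z * a1 z), sqi (fun z => \1_K z * a2 z),
        sqi (fun z => \1_K z * b1 z) & sqi (fun z => \1_K z * b2 z)];
  sol_wa1 : wd (1, 0) Om a a1; sol_wa2 : wd (0, 1) Om a a2;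
  sol_wb1 : wd (1, 0) Om b b1; sol_wb2 : wd (0, 1) Om b b2;
  sol_eq : {ae (@area R), forall z, Om z ->
    a1 z - b2 z = p z * (a1 z + b2 z) - q z * (b1 z - a2 z) /\
    a2 z + b1 z = p z * (b1 z - a2 z) + q z * (a1 z + b2 z)} }.

Lemma sol_rot Om p q a a1 a2 b b1 b2 : weak_solution Om p q a a1 a2 b b1 b2 ->
  weak_solution Om p q b b1 b2 (fun z => - a z) (fun z => - a1 z) (fun z => - a2 z).
Proof.
move=> h.
have wn v c cv : wd v Om c cv -> isdir v -> continuous (c : R * R -> R) ->
    (forall K : set (R * R), compact K -> K `<=` Om -> sqi (fun z => \1_K z * cv z)) ->
    wd v Om (fun z => - c z) (fun z => - cv z).
  move=> w dv cc lcv psi tp; have [sp [n n0 p0]] := csmooth_test tp.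
  have -> : ∫ (fun z => - c z * 'D_v (psi : R * R -> R) z) = - ∫ (fun z => c z * 'D_v (psi : R * R -> R) z).
    rewrite -RintN; first by apply: Rint_ext => z; rewrite mulNr.
    have td := tame_dir dv sp p0; have [_ _ td0] := td.
    exact: cont_offzero_integ cc (tame_integ n0 td) td0.
  rewrite (w psi tp) -RintN; first by congr (- _); apply: Rint_ext => z; rewrite mulNr.
  have [_ cS sO] := tp; have := sqint_mul (lcv _ cS sO) (tame_sqi n0 (smooth_tame sp p0)).
  congr (_.-integrable _ (EFin \o _)); apply/funext => z.
  case: (pselect (closure [set z : R * R | psi z != 0] z)) => sz.
    by rewrite indicE mem_set// mul1r.
  by rewrite (supp0 sz) !mulr0.
split.
- exact: sol_cb h.
- by move=> z; apply: cvgN; exact: (sol_ca h).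
- exact: sol_ub h.
- move=> w /(sol_ua h)[r r0 hr]; exists r => // x y sy.
  by have := hr x y sy; rewrite -normrN opprB opprK addrC.
- move=> K cK KO; have [h1 h2 h3 h4] := sol_loc h cK KO.
  have ng (g : P -> R) : sqi (fun z => \1_K z * g z) -> sqi (fun z => \1_K z * - g z).
    by move=> /sqintN; congr sqint; apply/funext => z; rewrite mulrN.
  by split => //; exact: ng.
- exact: sol_wb1 h.
- exact: sol_wb2 h.
- apply: wn; [exact: sol_wa1 h|by left|exact: sol_ca h|].
  by move=> K cK KO; have [] := sol_loc h cK KO.
- apply: wn; [exact: sol_wa2 h|by right|exact: sol_ca h|].
  by move=> K cK KO; have [] := sol_loc h cK KO.
- apply: filterS (sol_eq h) => z hz Oz; have [e1 e2] := hz Oz; split; lra.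
Qed.

Lemma Tfun_off p px py q qx qy (k : R) Om a a1 a2 b b1 b2 psi :
  coefficient p px py q qx qy k -> open Om -> weak_solution Om p q a a1 a2 b b1 b2 ->
  test_function Om psi -> Tfun p px py q qx qy a b psi = 0.
Proof.
move=> hc oO hs tp; have cp := csmooth_test tp; have [sp [n n0 p0]] := cp.
have [_ cS sO] := tp; have [l1 l2 l3 l4] := sol_loc hs cS sO.
have loc1 : forall K : set (R * R), compact K -> K `<=` Om -> sqi (fun z => \1_K z * a1 z).
  by move=> K cK KO; have [] := sol_loc hs cK KO.
have loc2 : forall K : set (R * R), compact K -> K `<=` Om -> sqi (fun z => \1_K z * a2 z).
  by move=> K cK KO; have [] := sol_loc hs cK KO.
have loc3 : forall K : set (R * R), compact K -> K `<=` Om -> sqi (fun z => \1_K z * b1 z).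
  by move=> K cK KO; have [] := sol_loc hs cK KO.
have loc4 : forall K : set (R * R), compact K -> K `<=` Om -> sqi (fun z => \1_K z * b2 z).
  by move=> K cK KO; have [] := sol_loc hs cK KO.
have tpt := smooth_tame sp p0; have spsi := tame_sqi n0 tpt.
have ii g : sqi (fun z => \1_(closure [set z : R * R | psi z != 0]) z * g z) -> integ (fun z => g z * psi z).
  move=> sg; have := sqint_mul sg spsi; congr (_.-integrable _ (EFin \o _)); apply/funext => z.
  case: (pselect (closure [set z : R * R | psi z != 0] z)) => sz.
    by rewrite indicE mem_set// mul1r.
  by rewrite (supp0 sz) !mulr0.
have [i1 i2 i3 i4] := And4 (ii _ l1) (ii _ l2) (ii _ l3) (ii _ l4).
have [mp mq bp bq] := And4 (coef_mp hc) (coef_mq hc) (coef_bp hc) (coef_bq hc).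
have ipq (c g : P -> R) : mea c -> (forall z, `|c z| <= 1) -> integ (fun z => g z * psi z) ->
    integ (fun z => (c z * psi z) * g z).
  move=> mc bc ig; have := (ibnd 1 (f := c) mc bc ig); congr (_.-integrable _ (EFin \o _)).
  by apply/funext => z; ring.
have pr v c cv := @weak_product_rule R v Om c cv.
have d1 : isdir ((1, 0) : R * R) by left.
have d2 : isdir ((0, 1) : R * R) by right.
have [[ca cb] [ua ub]] := ((sol_ca hs, sol_cb hs), (sol_ua hs, sol_ub hs)).
have r1 := pr _ _ _ p px psi d1 oO ca ua loc1 (sol_wa1 hs) mp bp (coef_px hc) (coef_wpx hc) tp.
have r2 := pr _ _ _ q qy psi d2 oO ca ua loc2 (sol_wa2 hs) mq bq (coef_qy hc) (coef_wqy hc) tp.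
have r3 := pr _ _ _ p py psi d2 oO cb ub loc4 (sol_wb2 hs) mp bp (coef_py hc) (coef_wpy hc) tp.
have r4 := pr _ _ _ q qx psi d1 oO cb ub loc3 (sol_wb1 hs) mq bq (coef_qx hc) (coef_wqx hc) tp.
have w1 := sol_wa1 hs tp; have w4 := sol_wb2 hs tp.
have [tdx tdy] := tame_dxy sp p0.
have ic (c g : P -> R) : continuous (c : R * R -> R) -> integ g -> offzero n g -> integ (fun z => c z * g z).
  by move=> cc; exact: cont_offzero_integ.
have igp (g : P -> R) : sqi g -> integ (fun z => g z * psi z) by move=> sg; exact: sqint_mul.
have ip (c : P -> R) g : mea c -> (forall z, `|c z| <= 1) -> integ g -> integ (fun z => c z * g z).
  by move=> mc bc; exact: (ibnd 1).
have [idx idy] := (tame_integ n0 tdx, tame_integ n0 tdy).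
have [[_ _ dx0] [_ _ dy0]] := (tdx, tdy).
have o1 (c g : P -> R) : offzero n (fun z => c z * dx psi z + g z * psi z).
  by move=> z nz; rewrite dx0// p0// !mulr0 addr0.
have o2 (c g : P -> R) : offzero n (fun z => c z * dy psi z + g z * psi z).
  by move=> z nz; rewrite dy0// p0// !mulr0 addr0.
have j1 : integ (fun z => a z * dx psi z) by exact: ic.
have j2 : integ (fun z => b z * dy psi z) by exact: ic.
have j3 : integ (fun z => a z * (p z * dx psi z + px z * psi z)).
  by apply: ic => //; apply: integD; [exact: ip|apply: igp; case: hc].
have j4 : integ (fun z => a z * (q z * dy psi z + qy z * psi z)).
  by apply: ic => //; apply: integD; [exact: ip|apply: igp; case: hc].
have j5 : integ (fun z => b z * (p z * dy psi z + py z * psi z)).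
  by apply: ic => //; apply: integD; [exact: ip|apply: igp; case: hc].
have j6 : integ (fun z => b z * (q z * dx psi z + qx z * psi z)).
  by apply: ic => //; apply: integD; [exact: ip|apply: igp; case: hc].
have eT1 : ∫ (fun z => a z * L1op p px q qy psi z) = ∫ (fun z => a z * dx psi z) -
   ∫ (fun z => a z * (p z * dx psi z + px z * psi z)) - ∫ (fun z => a z * (q z * dy psi z + qy z * psi z)).
  rewrite -(RintB j1 j3) -(RintB (integB j1 j3) j4).
  by apply: Rint_ext => z; rewrite /L1op; ring.
have eT2 : ∫ (fun z => b z * L2op p py q qx psi z) = - ∫ (fun z => b z * dy psi z) -
   ∫ (fun z => b z * (p z * dy psi z + py z * psi z)) + ∫ (fun z => b z * (q z * dx psi z + qx z * psi z)).
  rewrite -(RintN j2) -(RintB (integN j2) j5) -(RintD (integB (integN j2) j5) j6).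
  by apply: Rint_ext => z; rewrite /L2op; ring.
rewrite /Tfun eT1 eT2.
have -> : ∫ (fun z => a z * dx psi z) = - ∫ (fun z => a1 z * psi z) := w1.
have -> : ∫ (fun z => b z * dy psi z) = - ∫ (fun z => b2 z * psi z) := w4.
have -> : ∫ (fun z => a z * (p z * dx psi z + px z * psi z)) = - ∫ (fun z => p z * psi z * a1 z) := r1.
have -> : ∫ (fun z => a z * (q z * dy psi z + qy z * psi z)) = - ∫ (fun z => q z * psi z * a2 z) := r2.
have -> : ∫ (fun z => b z * (p z * dy psi z + py z * psi z)) = - ∫ (fun z => p z * psi z * b2 z) := r3.
have -> : ∫ (fun z => b z * (q z * dx psi z + qx z * psi z)) = - ∫ (fun z => q z * psi z * b1 z) := r4.
have [k1 k2 k3 k4] := And4 (ipq _ _ mp bp i1) (ipq _ _ mq bq i2) (ipq _ _ mp bp i4) (ipq _ _ mq bq i3).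
have e3 : ∫ (fun z => a1 z * psi z - b2 z * psi z) =
    ∫ (fun z => (p z * psi z * a1 z + q z * psi z * a2 z) + (p z * psi z * b2 z - q z * psi z * b1 z)).
  apply: Rint_ae.
  - exact: integ_meas (integB i1 i4).
  - exact: integ_meas (integD (integD k1 k2) (integB k3 k4)).
  - apply: filterS (sol_eq hs) => z hz.
    case: (pselect (closure [set z : R * R | psi z != 0] z)) => sz; last first.
      by rewrite (supp0 sz); ring.
    have [e1 _] := hz (sO _ sz).
    have -> : a1 z * psi z - b2 z * psi z = (a1 z - b2 z) * psi z by ring.
    by rewrite e1; ring.
move: e3; rewrite (RintB i1 i4) (RintD (integD k1 k2) (integB k3 k4)) (RintD k1 k2) (RintB k3 k4).
move: (∫ (fun z => a1 z * psi z)) (∫ (fun z => b2 z * psi z)) => x1 x2.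
move: (∫ (fun z => p z * psi z * a1 z)) (∫ (fun z => q z * psi z * a2 z)) => x3 x4.
move: (∫ (fun z => p z * psi z * b2 z)) (∫ (fun z => q z * psi z * b1 z)) => x5 x6.
clear; lra.
Qed.

End CoverAndLocal.

Section Cover.
Context {R : realType}.
Local Notation P := (measurableTypeR R * measurableTypeR R)%type.
Local Notation integ f := ((@area R).-integrable setT (EFin \o f)).
Local Notation mea f := (@measurable_fun _ _ P R setT f).
Local Notation "'∫' f" := (Rintegral (@area R) setT f) (at level 10, f at level 9).
Local Notation sqi := (@sqint _ P R (@area R)).
Local Notation ile g := (@integ_le _ P R (@area R) _ g).
Local Notation ibnd C := (@integ_bndM _ P R (@area R) C).

Lemma hausdorff_cover (s : R) (E : set (R * R)) (e d : R) : 0 < s -> compact E ->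
  hausdorff_measure s E = 0%E -> 0 < e -> 0 < d ->
  exists l : seq ((R * R) * R), [/\ forall i, i \in l -> E i.1 /\ 0 < i.2 <= d,
    \sum_(i <- l) i.2 `^ s <= e &
    forall z, E z -> exists2 i, i \in l & `|z.1 - i.1.1| < i.2 /\ `|z.2 - i.1.2| < i.2].
Proof.
move=> s0 cE hE e0 d0.
pose e1 := Num.min (e / 2) (d `^ s / 2).
have e10 : 0 < e1 by rewrite lt_min !divr_gt0// powR_gt0.
have : (hausdorff_content s 1 E < e1%:E)%E.
  apply: (@le_lt_trans _ _ 0%E); last by rewrite lte_fin.
  rewrite -hE; apply: ereal_sup_ubound; exists 1 => //=; exact: ltr01.
move=> /ereal_inf_lt [_ [U [EU dU] <-] hU].
have dU0 k : (0 <= diam (U k))%E by apply: ereal_sup_ubound; left.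
pose dk k := fine (diam (U k)).
have dkE k : diam (U k) = (dk k)%:E.
  rewrite /dk fineK// ge0_fin_numE//; apply: le_lt_trans (dU k) _; exact: ltry.
have dk0 k : 0 <= dk k by rewrite -lee_fin -dkE.
pose rs k := dk k `^ s + e1 * 2^-1 ^+ k.+1.
have p2 k : 0 < (2^-1 : R) ^+ k by rewrite exprn_gt0// invr_gt0.
have rs0 k : 0 < rs k by rewrite ltr_wpDl ?powR_ge0// mulr_gt0.
pose r k := rs k `^ s^-1.
have r0 k : 0 < r k by rewrite powR_gt0.
have rE k : r k `^ s = rs k by rewrite /r -powRrM mulVf ?gt_eqF// powRr1// ltW.
have dr k : dk k < r k.
  rewrite ltNge; apply/negP => h; have : r k `^ s <= dk k `^ s.
    apply: ge0_ler_powR => //; rewrite ?nnegrE//; exact: ltW.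
  by rewrite rE /rs gerDl leNgt mulr_gt0.
have partial N : \sum_(k < N) rs k <= 2 * e1.
  have h1 : \sum_(k < N) dk k `^ s <= e1.
    have : (\sum_(0 <= k < N) (diam (U k) `^ s) <= e1%:E)%E.
      apply: le_trans (ltW hU); apply: nneseries_lim_ge => k _ _; exact: poweR_ge0.
    rewrite big_mkord (eq_bigr (fun k : 'I_N => (dk k `^ s)%:E)); last first.
      by move=> k _; rewrite dkE poweR_EFin.
    by rewrite sumEFin lee_fin.
  have h2 : \sum_(k < N) (2^-1 : R) ^+ k.+1 = 1 - 2^-1 ^+ N.
    elim: N {h1} => [|N IH]; first by rewrite big_ord0 expr0 subrr.
    by rewrite big_ord_recr /= IH exprS; field.
  rewrite big_split /= -mulr_sumr h2 mulr2n mulrDl !mul1r lerD// ler_piMr ?(ltW e10)//.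
have rd k : r k <= d.
  rewrite leNgt; apply/negP => h; have h1 : d `^ s < r k `^ s.
    by apply: gt0_ltr_powR => //; rewrite ?nnegrE ?ltW.
  have : rs k <= 2 * e1.
    apply: le_trans (partial k.+1); rewrite big_ord_recr /= lerDr sumr_ge0// => i _; exact: ltW.
  rewrite leNgt => /negP; apply; rewrite -rE; apply: le_lt_trans h1.
  have : e1 <= d `^ s / 2 by rewrite /e1 ge_min lexx orbT.
  lra.
pose D := [set k : nat | (U k `&` E) !=set0].
have /choice [x hx] : forall k, exists x : R * R, D k -> (U k `&` E) x.
  by move=> k; case: (pselect (D k)) => [[x hx]|nD]; [exists x|exists (0, 0)].
have [N hN] : exists N : nat, forall z, E z -> exists2 k, (k < N)%N & D k /\ ball (x k) (r k) z.
  suff : \forall N \near \oo, E `<=` (fun z => exists2 k, (k < N)%N & D k /\ ball (x k) (r k) z).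
    by case=> N _ /(_ N (leqnn N)) hN; exists N.
  have /compact_near_coveringP cN := cE.
  apply: (cN nat \oo (fun N z => exists2 k, (k < N)%N & D k /\ ball (x k) (r k) z)) => z Ez.
  have [k [Dk bz]] : exists k, D k /\ ball (x k) (r k) z.
    have [k _ Ukz] := EU _ Ez.
    have Dk : D k by exists z.
    exists k; split => //; have [Ux Ex] := hx k Dk.
    have cd : cdist (x k) z <= dk k.
      rewrite -lee_fin -dkE; apply: ereal_sup_ubound; right; exists (x k) => //; by exists z.
    have c1 (u w : R * R) : `|u.1 - w.1| <= cdist u w.
      rewrite /cdist /cplx /=; case: u w => x1 x2 [z1 z2] /=.
      by rewrite -sqrtr_sqr ler_wsqrtr// lerDl sqr_ge0.
    have c2 (u w : R * R) : `|u.2 - w.2| <= cdist u w.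
      rewrite /cdist /cplx /=; case: u w => x1 x2 [z1 z2] /=.
      by rewrite -sqrtr_sqr ler_wsqrtr// lerDr sqr_ge0.
    split; rewrite /ball /=.
      exact: le_lt_trans (c1 _ _) (le_lt_trans cd (dr k)).
    exact: le_lt_trans (c2 _ _) (le_lt_trans cd (dr k)).
  exists (ball (x k) (r k), [set N | (k < N)%N]) => /=.
    split; first by apply: open_nbhs_nbhs; split => //; exact: ball_open.
    by exists k.+1.
  by case=> y N /= [yb kN]; exists k.
exists [seq (x k, r k) | k <- iota 0 N & `[< D k >]]; split.
- move=> i /mapP [k]; rewrite mem_filter => /andP[/asboolP Dk _] ->.
  by have [_ Ex] := hx k Dk; split => //=; rewrite r0 rd.
- rewrite big_map big_filter /=; apply: (@le_trans _ _ (2 * e1)).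
    apply: le_trans (partial N); rewrite -(big_mkord xpredT rs) /index_iota subn0.
    rewrite [leRHS](bigID (fun k => `[< D k >])) /=.
    rewrite -[leLHS]addr0 lerD//; last by apply: sumr_ge0 => k _; exact: ltW.
    by under eq_bigr do rewrite rE.
  have : e1 <= e / 2 by rewrite /e1 ge_min lexx.
  lra.
- move=> z /hN [k kN [Dk [b1 b2]]]; exists (x k, r k).
    by apply/mapP; exists k => //; rewrite mem_filter mem_iota /= kN andbT; apply/asboolP.
  by rewrite /= distrC; split => //; rewrite distrC.
Qed.

End Cover.

Section Partition.
Context {R : realType}.
Local Notation P := (measurableTypeR R * measurableTypeR R)%type.
Local Notation integ f := ((@area R).-integrable setT (EFin \o f)).
Local Notation mea f := (@measurable_fun _ _ P R setT f).
Local Notation "'∫' f" := (Rintegral (@area R) setT f) (at level 10, f at level 9).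
Local Notation sqi := (@sqint _ P R (@area R)).
Local Notation ile g := (@integ_le _ P R (@area R) _ g).
Local Notation ibnd C := (@integ_bndM _ P R (@area R) C).
Implicit Types (x y z h : R * R) (n m e t : R) (v : R * R) (psi : P -> R).

Lemma area_null (s : R) (E : set (R * R)) : 0 < s -> s <= 2 -> compact E ->
  hausdorff_measure s E = 0%E -> @area R E = 0%E.
Proof.
move=> s0 s2 cE hE; apply/eqP; rewrite eq_le measure_ge0 andbT; apply/lee_addgt0Pr => e e0.
rewrite add0e.
have e4 : 0 < e / 4 by rewrite divr_gt0.
have [l [hl sl cov]] := hausdorff_cover s0 cE hE e4 (@ltr01 R).
pose B (i : (R * R) * R) : set P := (fun z => (z + (- i.1) : R * R)) @^-1` square i.2.
have mB i : measurable (B i).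
  by rewrite -[B i]setTI; apply: measurable_shift => //; exact: measurable_square.
have aB i : i \in l -> (@area R (B i) <= (4 * i.2 `^ s)%:E)%E.
  move=> il; have [_ /andP[i0 i1]] := hl i il.
  have -> : @area R (B i) = ((2 * i.2) ^+ 2)%:E.
    by rewrite -(area_square (ltW i0)) -(area_translate (- i.1) (measurable_square i.2)).
  rewrite lee_fin exprMn; have -> : (2 : R) ^+ 2 = 4 by rewrite expr2; ring.
  rewrite ler_pM2l ?ltr0n//.
  have -> : i.2 ^+ 2 = i.2 `^ 2%:R by rewrite powR_mulrn// ltW.
  by apply: ger_powR => //; rewrite i0.
have mU : measurable (\big[setU/set0]_(i <- l) B i) by exact: bigsetU_measurable.
apply: (@le_trans _ _ (@area R (\big[setU/set0]_(i <- l) B i))).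
  apply: le_measure; rewrite ?inE//.
    by apply: closed_measurable_plane; apply: (@compact_closed (R * R)%type) => //; exact: norm_hausdorff.
  move=> z /cov [i il [h1 h2]]; rewrite -bigcup_seq; exists i => //=.
  by apply/squareE; split; apply: ltW.
apply: (@le_trans _ _ (\sum_(i <- l) @area R (B i))%E).
  elim: l {hl sl cov aB mU} => [|i l IH]; first by rewrite !big_nil measure0.
  rewrite !big_cons; have mUl : measurable (\big[setU/set0]_(j <- l) B j) by exact: bigsetU_measurable.
  by apply: (le_trans (measureU2 (@area R) (mB i) mUl)); exact: leeD.
apply: (@le_trans _ _ (\sum_(i <- l) (4 * i.2 `^ s)%:E)%E).
  by rewrite big_seq [leRHS]big_seq; apply: lee_sum => i il; exact: aB.
rewrite sumEFin lee_fin -mulr_sumr.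
by have := ler_wpM2l (ler0n R 4) sl; lra.
Qed.

Let bm (t : R) : R := expR 4 * bump (t / 2).
Let dbm (t : R) : R := expR 4 * (dbump (t / 2) / 2).

Let bm_ge0 t : 0 <= bm t.
Proof. by rewrite /bm mulr_ge0 ?expR_ge0 ?bump_ge0. Qed.

Let bm_ge1 t : `|t| <= 1 -> 1 <= bm t.
Proof.
move=> t1; have h : `|t / 2| <= 2^-1.
  by rewrite normrM (ger0_norm (_ : 0 <= 2^-1))// ler_piMl.
have := ler_wpM2l (expR_ge0 4) (bump_lb h).
by rewrite -expRD subrr expR0.
Qed.

Let ge2_ge1 t : 2 <= `|t| -> 1 <= `|t / 2|.
Proof. by move=> t2; rewrite normrM (ger0_norm (_ : 0 <= 2^-1))//; lra. Qed.

Let bm0 t : 2 <= `|t| -> bm t = 0.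
Proof. by move=> /ge2_ge1 h; rewrite /bm bump0// mulr0. Qed.

Let is_derive_bm t : is_derive t 1 bm (dbm t).
Proof.
have d1 : is_derive t 1 (fun t : R => t / 2) (2^-1).
  apply: is_derive_eq (is_deriveM (is_derive_id _ _) (is_derive_cst (2^-1 : R) _ _)) _.
  by rewrite /GRing.scale /=; ring.
have d2 : is_derive t 1 (fun t : R => bump (t / 2)) (dbump (t / 2) / 2).
  by apply: (@is_derive1_comp _ bump (fun t => t / 2)) => //; exact: is_derive_bump.
apply: is_derive_eq (is_deriveM (is_derive_cst (expR 4 : R) _ _) d2) _.
by rewrite /GRing.scale /= /dbm; ring.
Qed.

Let bm_bounded : exists2 C : R, 0 <= C & forall t, `|bm t| <= C /\ `|dbm t| <= C.
Proof.
have [C C0 hC] := @bump_bounded R; exists (expR 4 * C) => [|t].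
  by rewrite mulr_ge0 ?expR_ge0.
have [h1 h2] := hC (t / 2).
rewrite /bm /dbm (normrM (expR 4)) (normrM (expR 4) (_ / _)) (normrM (dbump _)) (ger0_norm (expR_ge0 4)).
rewrite !ler_pM2l ?expR_gt0//; split => //.
by apply: le_trans h2; rewrite ler_piMr// ger0_norm ?invr_ge0 ?ler0n// invf_le1 ?ltr0n// ler1n.
Qed.

Definition bmp (i : (R * R) * R) z : R := bm ((z.1 - i.1.1) / i.2) * bm ((z.2 - i.1.2) / i.2).

Lemma smooth_bmp i : smooth (bmp i).
Proof.
have h (f : R * R -> R) c : smooth f -> smooth (fun z => bm ((f z - c) / i.2)).
  move=> sf; apply: smoothZ; apply: smooth_bump.
  apply: smoothM; last exact: smooth_cst.
  apply: smoothM; last exact: smooth_cst.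
  by apply: smoothB => //; exact: smooth_cst.
by apply: smoothM; apply: h; [exact: smooth_fst|exact: smooth_snd].
Qed.

Lemma bmp_ge0 i z : 0 <= bmp i z.
Proof. exact: mulr_ge0. Qed.

Lemma bmp_ge1 i z : 0 < i.2 -> square i.2 (z - i.1) -> 1 <= bmp i z.
Proof.
move=> i0 /squareE [h1 h2]; rewrite -[1]mulr1.
by apply: ler_pM => //; apply: bm_ge1;
  rewrite normrM normfV (gtr0_norm i0) ler_pdivrMr ?mul1r.
Qed.

Lemma bmp0 i z : 0 < i.2 -> ~ square (2 * i.2) (z - i.1) -> bmp i z = 0.
Proof.
move=> i0 h; suff : 2 <= `|(z.1 - i.1.1) / i.2| \/ 2 <= `|(z.2 - i.1.2) / i.2|.
  by case=> /bm0 e; rewrite /bmp e ?mul0r ?mulr0.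
rewrite !normrM !normfV !(gtr0_norm i0) !ler_pdivlMr//.
case: (leP (2 * i.2) `|z.1 - i.1.1|) => [|h1]; first by left.
case: (leP (2 * i.2) `|z.2 - i.1.2|) => [|h2]; first by right.
by exfalso; apply: h; apply/squareE; split; exact: ltW.
Qed.

Lemma bmp_dir : exists2 C : R, 0 <= C & forall i v z, isdir v -> 0 < i.2 ->
  `|'D_v (bmp i) z| <= C / i.2.
Proof.
have [C C0 hC] := bm_bounded; exists (C * C) => [|i v z dv i0]; first exact: mulr_ge0.
have aff (f : R * R -> R) c (d : R) w : is_derive w v f d ->
    is_derive w v (fun w => bm ((f w - c) / i.2)) (dbm ((f w - c) / i.2) * (d / i.2)).
  move=> df; have d1 : is_derive w v (fun w => (f w - c) / i.2) (d / i.2).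
    have h1 := is_deriveB df (is_derive_cst c w v).
    apply: is_derive_eq (is_deriveM h1 (is_derive_cst i.2^-1 _ _)) _.
    by rewrite /GRing.scale /=; ring.
  exact: is_derive_chain (is_derive_bm _) d1.
have d1 := aff _ i.1.1 _ z (is_derive_fst z v).
have d2 := aff _ i.1.2 _ z (is_derive_snd z v).
have := is_deriveM d1 d2; rewrite /GRing.scale /= => d3.
have -> : 'D_v (bmp i) z = bm ((z.1 - i.1.1) / i.2) * (dbm ((z.2 - i.1.2) / i.2) * (v.2 / i.2)) +
   bm ((z.2 - i.1.2) / i.2) * (dbm ((z.1 - i.1.1) / i.2) * (v.1 / i.2)).
  exact: derive_val.
have [[a1 a2] [b1 b2]] := (hC ((z.1 - i.1.1) / i.2), hC ((z.2 - i.1.2) / i.2)).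
have iV : 0 <= i.2^-1 by rewrite invr_ge0 ltW.
have fin (s1 s2 : R) : `|s1| <= C -> `|s2| <= C -> `|s1 * (s2 * (1 / i.2))| <= C * C / i.2.
  move=> h1 h2; rewrite mul1r mulrA normrM (ger0_norm iV) ler_wpM2r// normrM ler_pM//.
by case: dv => ->; rewrite /= mul0r !mulr0 ?addr0 ?add0r; exact: fin.
Qed.

Definition Dsum (N L : R) (l : seq ((R * R) * R)) z : R :=
  N + \sum_(i <- l) (expR (L * bmp i z) - 1).

(* Composing [step] with the soft maximum [ln (N + sum (exp (L b_i) - 1)) / L] of the bumps [b_i]
   keeps the gradient of the size of the largest one, uniformly in the number of bumps. *)
Definition Phi (N L : R) (l : seq ((R * R) * R)) z : R := step (L^-1 * ln (Dsum N L l z)).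

Lemma Dsum_term (L : R) i z : 0 < L -> 0 <= expR (L * bmp i z) - 1.
Proof.
move=> L0; rewrite subr_ge0 -[1]expR0 ler_expR; apply: mulr_ge0; [exact: ltW|exact: bmp_ge0].
Qed.

Lemma Dsum_ge (N L : R) l z : 0 < L -> N <= Dsum N L l z.
Proof. by move=> L0; rewrite lerDl sumr_ge0// => i _; exact: Dsum_term. Qed.

Lemma smooth_Dsum (N L : R) l : smooth (Dsum N L l).
Proof.
apply: smoothD; first exact: smooth_cst.
apply: smooth_sum => i; apply: smoothB; last exact: smooth_cst.
by apply: smooth_exp; apply: smoothZ; exact: smooth_bmp.
Qed.

Lemma smooth_Phi (N L : R) l : 0 < L -> 1 <= N -> smooth (Phi N L l).
Proof.
move=> L0 N1; apply: smooth_step; apply: smoothZ; apply: smooth_ln.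
  by move=> z; apply: lt_le_trans (Dsum_ge N l z L0); exact: lt_le_trans N1.
exact: smooth_Dsum.
Qed.

Lemma Phi_nil (N L : R) z : 0 < L -> 2 * ln N <= L -> Phi N L [::] z = 0.
Proof.
move=> L0 LN; apply: step_le; rewrite /Dsum big_nil addr0 mulrC ler_pdivrMr//.
by rewrite mulrC ler_pdivlMr// mulrC.
Qed.

Lemma Phi_1 (N L : R) l z : 0 < L -> 1 <= N -> (exists2 i, i \in l & 1 <= bmp i z) ->
  Phi N L l z = 1.
Proof.
move=> L0 N1 [i il bi]; apply: step_ge; rewrite mulrC ler_pdivlMr// mul1r.
have D0 : 0 < Dsum N L l z by apply: lt_le_trans (Dsum_ge N l z L0); exact: lt_le_trans N1.
rewrite -[leLHS]expRK ler_ln ?posrE ?expR_gt0//.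
have h : expR L - 1 <= \sum_(i <- l) (expR (L * bmp i z) - 1).
  rewrite (big_rem i)//=; apply: (@le_trans _ _ (expR (L * bmp i z) - 1)).
    by rewrite lerD2r ler_expR ler_pMr.
  by rewrite lerDl sumr_ge0// => j _; exact: Dsum_term.
rewrite /Dsum; lra.
Qed.

Lemma Phi_rcons (N L : R) l i z : bmp i z = 0 -> Phi N L (rcons l i) z = Phi N L l z.
Proof.
by move=> b0; rewrite /Phi /Dsum -cats1 big_cat big_seq1 /= b0 mulr0 expR0 subrr addr0.
Qed.

Lemma Phi_bounds (N L : R) l z : 0 <= Phi N L l z <= 1.
Proof. exact: step_bounds. Qed.

Lemma Phi_dir : exists2 C : R, 0 <= C & forall (N L r : R) l v z, isdir v -> 0 < L -> 1 <= N ->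
  (size l)%:R <= N -> 0 < r -> (forall i, i \in l -> r <= i.2) ->
  `|'D_v (Phi N L l) z| <= C / r.
Proof.
have [C1 C10 hC1] := bmp_dir; have [C2 C20 hC2] := @step_lipschitz R.
exists (C2 * C1) => [|N L r l v z dv L0 N1 sl r0 lr]; first exact: mulr_ge0.
have D0 : 0 < Dsum N L l z by apply: lt_le_trans (Dsum_ge N l z L0); exact: lt_le_trans N1.
have [d2 dd2 bd2] := hC2 (L^-1 * ln (Dsum N L l z)).
pose dD : R := \sum_(i <- l) (L * (expR (L * bmp i z) * 'D_v (bmp i) z)).
have hD : is_derive z v (Dsum N L l) dD.
  rewrite /Dsum /dD; elim: l {sl lr D0 d2 dd2 bd2 dD} => [|i l IH].
    rewrite big_nil; have := is_derive_cst N z v; congr is_derive.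
    by apply/funext => w; rewrite big_nil addr0.
  rewrite big_cons.
  have h1 : is_derive z v (fun w => L * bmp i w) (L * 'D_v (bmp i) z).
    apply: is_derive_eq (is_deriveM (is_derive_cst L _ _) (smooth_dirP z v (smooth_bmp i))) _.
    by rewrite /GRing.scale /=; ring.
  have h2 := is_derive_chain (is_derive_expR (L * bmp i z)) h1.
  have h3 := is_deriveB h2 (is_derive_cst (1 : R) z v).
  have := is_deriveD h3 IH; rewrite subr0.
  have -> : ((expR \o (fun w => L * bmp i w)) - cst 1 + (fun w => N + \sum_(i <- l) (expR (L * bmp i w) - 1)))
    = (fun w => N + \sum_(i <- i :: l) (expR (L * bmp i w) - 1)).
    by apply/funext => w; rewrite big_cons /GRing.add /= /GRing.opp /= addrCA.
  by rewrite mulrCA.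
have h1 := is_derive_chain (is_derive1_ln D0) hD.
have h2 : is_derive z v (fun w => L^-1 * ln (Dsum N L l w)) (L^-1 * ((Dsum N L l z)^-1 * dD)).
  apply: is_derive_eq (is_deriveM (is_derive_cst L^-1 _ _) h1) _.
  by rewrite /GRing.scale /=; ring.
have h3 := is_derive_chain dd2 h2.
have -> : 'D_v (Phi N L l) z = d2 * (L^-1 * ((Dsum N L l z)^-1 * dD)) by exact: derive_val.
have bD : `|dD| <= L * (C1 / r) * Dsum N L l z.
  apply: (@le_trans _ _ (\sum_(i <- l) (L * (C1 / r) * expR (L * bmp i z)))).
    apply: le_trans (ler_norm_sum _ _ _) _; rewrite big_seq [leRHS]big_seq.
    apply: ler_sum => i il; have ri := lr i il; have i0 : 0 < i.2 := lt_le_trans r0 ri.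
    rewrite !normrM (gtr0_norm L0) (gtr0_norm (expR_gt0 _)) -mulrA.
    rewrite ler_pM2l// mulrC ler_pM2r ?expR_gt0//.
    apply: le_trans (hC1 i v z dv i0) _; rewrite ler_wpM2l//.
    by rewrite lef_pV2 ?posrE.
  rewrite -mulr_sumr ler_wpM2l//.
    by apply: mulr_ge0; [exact: ltW|apply: divr_ge0 => //; exact: ltW].
  have -> : \sum_(i <- l) expR (L * bmp i z) = \sum_(i <- l) (expR (L * bmp i z) - 1) + (size l)%:R.
    by rewrite sumrB big_const_seq count_predT iter_addr_0 subrK.
  by rewrite /Dsum addrC lerD2r.
rewrite normrM -mulrA ler_pM// normrM (gtr0_norm (_ : 0 < L^-1)) ?invr_gt0//.
rewrite normrM (gtr0_norm (_ : 0 < (Dsum N L l z)^-1)) ?invr_gt0//.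
rewrite mulrC ler_pdivrMr// mulrC ler_pdivrMr//.
by apply: le_trans bD _; rewrite le_eqVlt; apply/orP; left; apply/eqP; ring.
Qed.

End Partition.

Section Removal.
Context {R : realType}.
Local Notation P := (measurableTypeR R * measurableTypeR R)%type.
Local Notation integ f := ((@area R).-integrable setT (EFin \o f)).
Local Notation mea f := (@measurable_fun _ _ P R setT f).
Local Notation "'∫' f" := (Rintegral (@area R) setT f) (at level 10, f at level 9).
Local Notation sqi := (@sqint _ P R (@area R)).
Local Notation ile g := (@integ_le _ P R (@area R) _ g).
Local Notation ibnd C := (@integ_bndM _ P R (@area R) C).
Implicit Types (x y z h : R * R) (n m e t : R) (v : R * R) (psi : P -> R).

Lemma cdist_le z w : cdist z w <= `|z.1 - w.1| + `|z.2 - w.2|.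
Proof.
rewrite /cdist /cplx /=; case: z w => z1 z2 [w1 w2] /=.
rewrite -(@ler_pXn2r _ 2) ?nnegrE ?sqrtr_ge0 ?addr_ge0// sqr_sqrtr ?addr_ge0 ?sqr_ge0//.
rewrite -(real_normK (num_real (z1 - w1))) -(real_normK (num_real (z2 - w2))).
have : 0 <= `|z1 - w1| * `|z2 - w2| by rewrite mulr_ge0.
by move=> h; rewrite !expr2; nra.
Qed.

Let le_sum3 (x1 x2 x3 : R) : [/\ x1 <= `|x1| + `|x2| + `|x3|, x2 <= `|x1| + `|x2| + `|x3| &
  x3 <= `|x1| + `|x2| + `|x3|].
Proof.
have := ler_norm x1; have := ler_norm x2; have := ler_norm x3.
by have := normr_ge0 x1; have := normr_ge0 x2; have := normr_ge0 x3; split; lra.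
Qed.

Let covered (l : seq ((R * R) * R)) : set (R * R) :=
  [set z | exists2 i, i \in l & `|z.1 - i.1.1| < i.2 /\ `|z.2 - i.1.2| < i.2].

Let open_covered l : open (covered l).
Proof.
have -> : covered l = \bigcup_(i in [set i | i \in l]) ball i.1 i.2.
  apply/seteqP; split => z [i il]; first by move=> h; exists i => //; apply/ball_plane; rewrite !(distrC i.1.1, distrC i.1.2).
  by move=> /ball_plane; rewrite !(distrC i.1.1, distrC i.1.2) => h; exists i.
by apply: bigcup_open => i _; exact: ball_open.
Qed.

Let Phi_compl (N L : R) (l : seq ((R * R) * R)) (E : set (R * R)) psi : 0 < L -> 1 <= N -> (forall i, i \in l -> 0 < i.2) ->
  E `<=` covered l -> csmooth psi -> test_function (~` E) (fun z => (1 - Phi N L l z) * psi z).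
Proof.
move=> L0 N1 hl El [sp [n n0 p0]].
apply: (@smooth_test R _ (square n `&` ~` covered l)).
- apply: smoothM => //; apply: smoothB; [exact: smooth_cst|exact: smooth_Phi].
- have sub : square n `&` ~` covered l `<=` square n by move=> z [].
  apply: subclosed_compact (@compact_square R n) sub.
  by apply: closedI; [exact: closed_square|apply: open_closedC; exact: open_covered].
- by move=> z [_ nc] /El.
- move=> z /not_andP [nz|]; first by rewrite p0 ?mulr0.
  move=> /contrapT [i il [h1 h2]]; rewrite (Phi_1 L0 N1) ?subrr ?mul0r//.
  by exists i => //; apply: bmp_ge1; [exact: hl|apply/squareE; split; exact: ltW].
Qed.

Lemma removal_cutoff (s : R) (E : set (R * R)) (d : R) : 0 < s -> compact E ->
  hausdorff_measure s E = 0%E -> 0 < d ->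
  exists chi : P -> R, [/\ smooth chi, forall z, 0 <= chi z <= 1,
    forall psi, csmooth psi -> test_function (~` E) (fun z => chi z * psi z) &
    forall z, (forall x, E x -> ~ square (2 * d) (z - x)) -> chi z = 1].
Proof.
move=> s0 cE hE d0; have [l [hl _ cov]] := hausdorff_cover s0 cE hE (@ltr01 R) d0.
pose N : R := (size l).+1%:R; have N1 : 1 <= N by rewrite ler1n.
have lnN : 0 <= ln N by rewrite ln_ge0.
pose L : R := 2 * ln N + 1.
have L0 : 0 < L by rewrite ltr_wpDl// mulr_ge0.
have LN : 2 * ln N <= L by rewrite lerDl ler01.
have hl0 i : i \in l -> 0 < i.2 by move=> /hl [_ /andP[]].
exists (fun z => 1 - Phi N L l z); split.
- by apply: smoothB; [exact: smooth_cst|exact: smooth_Phi].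
- by move=> z; have /andP[h1 h2] := Phi_bounds N L l z; apply/andP; split; lra.
- by move=> psi; exact: Phi_compl.
- move=> z hz; suff -> : Phi N L l z = 0 by rewrite subr0.
  rewrite -[RHS](Phi_nil z L0 LN) /Phi /Dsum big_nil big_seq big1 ?addr0// => i il.
  rewrite bmp0 ?mulr0 ?expR0 ?subrr ?hl0// => sq.
  have [Ei /andP[_ id]] := hl i il; apply: (hz _ Ei); apply: squareS sq.
  by rewrite ler_pM2l.
Qed.

Section Vanish.
Variables (p px py q qx qy : P -> R) (k : R) (al M : R) (E : set (R * R)).
Hypothesis hc : coefficient p px py q qx qy k.
Variables (a a1 a2 b b1 b2 : P -> R).
Hypothesis hs : weak_solution (~` E) p q a a1 a2 b b1 b2.
Hypotheses (al0 : 0 < al) (al1 : al < 1) (M0 : 0 <= M) (cE : compact E).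
Hypothesis hE : hausdorff_measure (1 + al) E = 0%E.
Hypothesis La : forall z w : R * R, `|a z - a w| <= M * cdist z w `^ al.
Hypothesis Lb : forall z w : R * R, `|b z - b w| <= M * cdist z w `^ al.
Local Notation T := (Tfun p px py q qx qy a b).

Let holder (c : P -> R) (r : R) x z : (forall z w : R * R, `|c z - c w| <= M * cdist z w `^ al) -> 0 < r ->
  square (2 * r) (z - x) -> `|c z - c x| <= 4 * M * r `^ al.
Proof.
move=> hL r0 /squareE [/= h1 h2]; apply: le_trans (hL z x) _.
rewrite [4 * M]mulrC -mulrA ler_wpM2l//.
apply: (@le_trans _ _ ((4 * r) `^ al)).
  apply: ge0_ler_powR; rewrite ?nnegrE ?(ltW al0)//.
  - by rewrite /cdist /cplx /=; case: z x {h1 h2} => ? ? [? ?] /=; exact: sqrtr_ge0.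
  - by rewrite mulr_ge0// ltW.
  - by apply: le_trans (cdist_le z x) _; lra.
rewrite powRM ?ler0n ?(ltW r0)// ler_wpM2r ?powR_ge0//.
by rewrite ler1_powR ?ler1n// ltW.
Qed.

Let Phi_pieces psi : csmooth psi -> exists2 C : R, 0 <= C &
  forall (N L : R) l, 0 < L -> 1 <= N -> 2 * ln N <= L -> (size l)%:R <= N ->
    (forall i, i \in l -> 0 < i.2 <= 1) -> pairwise (fun i j : (R * R) * R => j.2 <= i.2) l ->
    `|T (fun z => psi z * Phi N L l z)| <= C * \sum_(i <- l) i.2 `^ (1 + al).
Proof.
move=> cp; have [sp [n n0 p0]] := cp; have [Cd Cd0 hCd] := @Phi_dir R.
have tp := smooth_tame sp p0; have [_ [C1 h1] _] := tp.
have [[_ [C2 h2] _] [_ [C3 h3] _]] := tame_dxy sp p0.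
pose B : R := `|C1| + `|C2| + `|C3|.
have B0 : 0 <= B by apply: addr_ge0 => //; apply: addr_ge0.
have hB z : [/\ `|psi z| <= B, `|dx psi z| <= B & `|dy psi z| <= B].
  have [u1 u2 u3] := le_sum3 C1 C2 C3.
  by split; [exact: le_trans (h1 z I) u1|exact: le_trans (h2 z I) u2|exact: le_trans (h3 z I) u3].
pose A : R := B * (1 + 2 * Cd).
have A0 : 0 <= A by rewrite mulr_ge0// addr_ge0// mulr_ge0.
pose S := ∫ (fun z => px z ^+ 2) + ∫ (fun z => py z ^+ 2) + ∫ (fun z => qx z ^+ 2) + ∫ (fun z => qy z ^+ 2).
have S0 : 0 <= S.
  by do 3! (apply: addr_ge0; last by apply: Rint_ge0 => z; exact: sqr_ge0);
    apply: Rint_ge0 => z; exact: sqr_ge0.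
pose C : R := 8 * M * (A * (56 + S)).
have C0 : 0 <= C by apply: mulr_ge0; [exact: mulr_ge0|apply: mulr_ge0 => //; exact: addr_ge0].
exists C => // N L l L0 N1 LN; elim/last_ind: l => [|l i IH] sl hl pl.
  rewrite big_nil mulr0 normr_le0; apply/eqP.
  rewrite (_ : (fun z => psi z * Phi N L [::] z) = (fun=> 0)); last first.
    by apply/funext => z; rewrite Phi_nil// mulr0.
  have z0 : csmooth (fun=> 0 : R) by split; [exact: smooth_cst|exists 0].
  have := TfunD hc (sol_ca hs) (sol_cb hs) z0 z0.
  by rewrite (_ : (fun z => _ + _) = (fun=> 0)); [lra|apply/funext => z; rewrite addr0].
have sll : (size l)%:R <= N by apply: le_trans sl; rewrite size_rcons ler_nat.
have hll j : j \in l -> 0 < j.2 <= 1 by move=> jl; apply: hl; rewrite mem_rcons inE jl orbT.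
have /andP[i0 i1] : 0 < i.2 <= 1 by apply: hl; rewrite mem_rcons mem_head.
move: pl; rewrite pairwise_rcons => /andP[/allP li pl].
have {}IH := IH sll hll pl.
have sP := smooth_Phi l L0 N1; have sP' := smooth_Phi (rcons l i) L0 N1.
pose D z := Phi N L (rcons l i) z - Phi N L l z.
have sD : smooth D by exact: smoothB.
have cpD : csmooth (fun z => psi z * D z).
  have := csmoothM sD cp; congr csmooth; apply/funext => z; exact: mulrC.
have cpP : csmooth (fun z => psi z * Phi N L l z).
  have := csmoothM sP cp; congr csmooth; apply/funext => z; exact: mulrC.
have -> : (fun z => psi z * Phi N L (rcons l i) z) = (fun z => psi z * Phi N L l z + psi z * D z).
  by apply/funext => z; rewrite /D; ring.
rewrite (TfunD hc (sol_ca hs) (sol_cb hs) cpP cpD) -cats1 big_cat big_seq1 /= mulrDr.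
apply: le_trans (ler_normD _ _) _; apply: lerD => //.
have Dv v z : isdir v -> `|'D_v D z| <= 2 * Cd / i.2.
  move=> dv.
  have -> : 'D_v D z = 'D_v (Phi N L (rcons l i)) z - 'D_v (Phi N L l) z.
    by have := is_deriveB (smooth_dirP z v sP') (smooth_dirP z v sP) => ?; exact: derive_val.
  have k1 : `|'D_v (Phi N L (rcons l i)) z| <= Cd / i.2.
    apply: hCd => // j; rewrite mem_rcons inE => /orP[/eqP -> //|]; exact: li.
  have k2 : `|'D_v (Phi N L l) z| <= Cd / i.2 by exact: hCd.
  apply: le_trans (ler_normB _ _) (le_trans (lerD k1 k2) _).
  by rewrite (_ : 2 * Cd / i.2 = Cd / i.2 + Cd / i.2)//; ring.
have D1 z : `|D z| <= 1.
  have /andP[u1 u2] := Phi_bounds N L (rcons l i) z; have /andP[u3 u4] := Phi_bounds N L l z.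
  by rewrite /D ler_norml; apply/andP; split; lra.
have w0 : 0 <= 4 * M * i.2 `^ al by apply: mulr_ge0; [exact: mulr_ge0|exact: powR_ge0].
have iV : 1 <= i.2^-1 by rewrite invf_ge1.
have grad (d1 d2 f g : R) : `|d1| <= B -> `|f| <= B -> `|d2| <= 2 * Cd / i.2 -> `|g| <= 1 ->
    `|f * d2 + g * d1| <= A / i.2.
  move=> k1 k2 k3 k4; apply: le_trans (ler_normD _ _) _; rewrite !normrM.
  have e1 := ler_pM (normr_ge0 _) (normr_ge0 _) k2 k3.
  have e2 := ler_pM (normr_ge0 _) (normr_ge0 _) k4 k1.
  have e3 : B <= B * i.2^-1 by rewrite ler_peMr.
  have -> : A / i.2 = B * (2 * Cd / i.2) + B * i.2^-1 by rewrite /A; ring.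
  by apply: lerD => //; apply: le_trans e2 _; rewrite mul1r.
have pc := Tfun_piece hc (sol_ca hs) (sol_cb hs) (x0 := i.1) (A := A) cpD i0 A0 w0.
apply: le_trans (pc _ _ _ _) _.
- move=> z; rewrite normrM; have [k1 _ _] := hB z.
  apply: (@le_trans _ _ (B * 1)); first by apply: ler_pM.
  by rewrite /A ler_wpM2l// lerDl mulr_ge0.
- move=> z; have [k1 k2 k3] := hB z.
  have [dp dD] := (smooth_differentiable z sp, smooth_differentiable z sD).
  rewrite (dxM dp dD) (dyM dp dD); split; apply: grad => //.
    by have := Dv (1, 0) z (or_introl erefl).
  by have := Dv (0, 1) z (or_intror erefl).
- by move=> z nz; rewrite /D Phi_rcons ?subrr ?mulr0//; exact: bmp0.
- by move=> z sz; split; exact: holder.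
rewrite -/S le_eqVlt; apply/orP; left; apply/eqP.
have -> : i.2 `^ (1 + al) = i.2 * i.2 `^ al.
  by rewrite powRD ?powRr1 ?(ltW i0)// (gt_eqF i0) implybT.
by rewrite /C; ring.
Qed.

Lemma Tfun_zero psi : csmooth psi -> T psi = 0.
Proof.
move=> cp; have [sp _] := cp; have [C C0 hC] := Phi_pieces cp.
apply/eqP; rewrite -normr_le0; apply/ler_addgt0Pr => e e0; rewrite add0r.
have C1 : 0 < C + 1 by rewrite ltr_wpDl.
have e1 : 0 < e / (C + 1) by rewrite divr_gt0.
have s0 : 0 < 1 + al by rewrite addr_gt0.
have [l0 [hl0 sl0 cov0]] := hausdorff_cover s0 cE hE e1 (@ltr01 R).
pose rr (i j : (R * R) * R) := j.2 <= i.2.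
have rt : total rr by move=> i j; exact: le_total.
pose l := sort rr l0.
have hl i : i \in l -> 0 < i.2 <= 1 by rewrite mem_sort => /hl0[].
have cov : E `<=` covered l by move=> z /cov0 [i il hi]; exists i; rewrite ?mem_sort.
have pl : pairwise rr l.
  rewrite -sorted_pairwise; first exact: sort_sorted.
  by move=> i j h /= ij jh; exact: le_trans jh ij.
pose N : R := (size l).+1%:R; have N1 : 1 <= N by rewrite ler1n.
have lnN : 0 <= ln N by rewrite ln_ge0.
pose L : R := 2 * ln N + 1.
have L0 : 0 < L by rewrite ltr_wpDl// mulr_ge0.
have LN : 2 * ln N <= L by rewrite lerDl ler01.
have sP := smooth_Phi l L0 N1.
have cpP : csmooth (fun z => psi z * Phi N L l z).
  have := csmoothM sP cp; congr csmooth; apply/funext => z; exact: mulrC.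
have tQ : test_function (~` E) (fun z => (1 - Phi N L l z) * psi z).
  by apply: Phi_compl => // i /hl /andP[].
have -> : psi = (fun z => psi z * Phi N L l z + (1 - Phi N L l z) * psi z).
  by apply/funext => z; ring.
rewrite (TfunD hc (sol_ca hs) (sol_cb hs) cpP (csmooth_test tQ)).
have oE : open (~` E).
  by apply: closed_openC; apply: (@compact_closed (R * R)%type) => //; exact: norm_hausdorff.
rewrite (Tfun_off hc oE hs tQ) addr0.
have slN : (size l)%:R <= N by rewrite ler_nat.
apply: le_trans (hC N L l L0 N1 LN slN hl pl) _.
have -> : \sum_(i <- l) i.2 `^ (1 + al) = \sum_(i <- l0) i.2 `^ (1 + al).
  by apply: perm_big; rewrite perm_sort.
apply: le_trans (ler_wpM2l C0 sl0) _.
by rewrite mulrCA ler_piMr ?(ltW e0)// ler_pdivrMr// mul1r lerDl ler01.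
Qed.

End Vanish.
End Removal.

(** * The energy estimate *)

Section UniformBounds.
Context {R : realType}.
Local Notation P := (measurableTypeR R * measurableTypeR R)%type.
Local Notation integ f := ((@area R).-integrable setT (EFin \o f)).
Local Notation mea f := (@measurable_fun _ _ P R setT f).
Local Notation "'∫' f" := (Rintegral (@area R) setT f) (at level 10, f at level 9).
Local Notation sqi := (@sqint _ P R (@area R)).
Local Notation ile g := (@integ_le _ P R (@area R) _ g).
Local Notation ibnd C := (@integ_bndM _ P R (@area R) C).
Implicit Types (x y z h : R * R) (n m e t : R) (v : R * R) (psi : P -> R).

Lemma Rint_deriv0 n v (H Hv : P -> R) : 0 <= n -> tame n H -> tame n Hv ->
  (forall z : R * R, is_derive z v H (Hv z)) -> ∫ Hv = 0.
Proof.
move=> n0 tH tHv d.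
have l1 : locint (fun=> 1 : R) by apply: continuous_locint => ?; exact: cst_continuous.
have [_ D] := is_derive_under 0 n0 l1 tH tHv d.
have -> : ∫ Hv = ∫ (fun z => 1 * Hv (z + (0:R) *: v : R * R)).
  by apply: Rint_ext => z; rewrite scale0r addr0 mul1r.
rewrite -D; have -> : (fun s : R => ∫ (fun z => 1 * H (z + s *: v : R * R))) = cst (∫ H).
  apply/funext => s /=; rewrite -(Rint_shift (s *: v) (tame_integ n0 tH)).
  by apply: Rint_ext => z; rewrite mul1r.
by rewrite derive_cst.
Qed.

Lemma tame_bounded n m f : tame n f -> bounded_on (square m) f.
Proof. by move=> [_ [C hC] _]; exists C => z _; exact: hC. Qed.

Lemma tame_tameM n f g : tame n f -> tame n g -> tame n (fun z => f z * g z).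
Proof. by move=> tf; apply: tameM; [case: tf|exact: tame_bounded tf]. Qed.

Lemma tameN n f : tame n f -> tame n (fun z => - f z).
Proof. by move=> /(tameZ (-1)); congr tame; apply/funext => z; rewrite mulN1r. Qed.

Lemma tameB n f g : tame n f -> tame n g -> tame n (fun z => f z - g z).
Proof. by move=> tf /tameN; exact: tameD. Qed.

Lemma jacobian0 n (u ux uy v vx vy vxy : P -> R) : 0 <= n ->
  tame n u -> tame n ux -> tame n uy -> tame n v -> tame n vx -> tame n vy -> tame n vxy ->
  (forall z : R * R, is_derive z ((1, 0) : R * R) u (ux z)) ->
  (forall z : R * R, is_derive z ((0, 1) : R * R) u (uy z)) ->
  (forall z : R * R, is_derive z ((0, 1) : R * R) vx (vxy z)) ->
  (forall z : R * R, is_derive z ((1, 0) : R * R) vy (vxy z)) ->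
  ∫ (fun z => ux z * vy z - uy z * vx z) = 0.
Proof.
move=> n0 tu tux tuy tv tvx tvy tvxy dux duy dvx dvy.
have h1 : ∫ (fun z => u z * vxy z + vy z * ux z) = 0.
  apply: (Rint_deriv0 (n := n) (v := (1, 0)) (H := fun z => u z * vy z)) => //.
  - exact: tame_tameM.
  - by apply: tameD; apply: tame_tameM.
have h2 : ∫ (fun z => u z * vxy z + vx z * uy z) = 0.
  apply: (Rint_deriv0 (n := n) (v := (0, 1)) (H := fun z => u z * vx z)) => //.
  - exact: tame_tameM.
  - by apply: tameD; apply: tame_tameM.
have i1 : integ (fun z => u z * vxy z + vy z * ux z).
  by apply: (tame_integ n0); apply: tameD; exact: tame_tameM.
have i2 : integ (fun z => u z * vxy z + vx z * uy z).
  by apply: (tame_integ n0); apply: tameD; exact: tame_tameM.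
have := RintB i1 i2; rewrite h1 h2 subrr => <-.
by apply: Rint_ext => z; ring.
Qed.

Lemma conv_moll_sq g n e : 0 < e -> 0 <= n -> tame n g ->
  ∫ (fun x => conv g (moll e) x ^+ 2) <= ∫ (fun x => g x ^+ 2).
Proof.
move=> e0 n0 tg; have te := tame_moll e0; have e0' := ltW e0.
have [_ _ g0] := tg; have lg : locint g := integ_locint (tame_integ n0 tg).
have ne0 : 0 <= n + e by exact: addr_ge0.
have tW : tame (n + e) (conv g (moll e)) by exact: conv_tame.
set W := conv g (moll e).
have sW : sqi W := tame_sqi ne0 tW.
have sg : sqi g := tame_sqi n0 tg.
have half : (0 : R) < 2^-1 by [].
have key h : `|conv g W h| <= 2^-1 * ∫ (fun x => g x ^+ 2) + 2^-1 * ∫ (fun x => W x ^+ 2).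
  have := sqint_mul_le half sg (sqi_shift (- h) sW).
  have -> : (4 * 2^-1)^-1 = (2^-1 : R) by field.
  have iW := proj2 sW; have sh := Rint_shift (- h) iW.
  rewrite sh.
  exact.
have := conv_exchange e0' ne0 lg te tW (tame_bounded _ tg).
have -> : ∫ (fun x => W x * conv g (moll e) x) = ∫ (fun x => W x ^+ 2).
  by apply: Rint_ext => x; rewrite expr2.
move=> E; have iM := tame_integ e0' te.
have : ∫ (fun x => W x ^+ 2) <= ∫ (fun h => (2^-1 * ∫ (fun x => g x ^+ 2) + 2^-1 * ∫ (fun x => W x ^+ 2)) * moll e h).
  rewrite {1}E; apply: le_trans (ler_norm _) _; apply: Rint_abs_le.
  - apply: measurable_funM; first by case: te.
    exact: mea_conv ne0 lg tW.
  - exact: integZ.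
  - by move=> h; rewrite normrM (ger0_norm (moll_ge0 e0 h)) mulrC; exact: ler_wpM2r (moll_ge0 e0 h) _ _ (key h).
rewrite (RintZ _ iM) (Rint_moll e0) mulr1; move: (∫ (fun x => W x ^+ 2)) (∫ (fun x => g x ^+ 2)) => u w.
by clear; lra.
Qed.

Variable m : R.
Hypothesis m0 : 0 <= m.
Let m1 : 0 <= m + 1. Proof. exact: addr_ge0. Qed.

(* The weak form of [sup_e |F e|_2 <= C], with Cauchy-Schwarz replaced by its AM-GM version. *)
Definition Bd (F : R -> P -> R) := (forall e, 0 < e -> e <= 1 -> locint (F e)) /\
  exists2 K : R, 0 <= K & forall e t g, 0 < e -> e <= 1 -> 0 < t -> tame (m + 1) g ->
    `|∫ (fun x => g x * F e x)| <= K * (t * ∫ (fun x => g x ^+ 2) + t^-1).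

Let sq0 (g : P -> R) : 0 <= ∫ (fun z => g z ^+ 2).
Proof. by apply: Rint_ge0 => z; exact: sqr_ge0. Qed.

Lemma BdD F G : Bd F -> Bd G -> Bd (fun e z => F e z + G e z).
Proof.
move=> [lF [K1 K10 h1]] [lG [K2 K20 h2]]; split=> [e e0 e1|].
  by apply: locintD; [exact: lF|exact: lG].
exists (K1 + K2) => [|e t g e0 e1 t0 tg]; first exact: addr_ge0.
have i1 := tame_mul m1 tg (lF e e0 e1); have i2 := tame_mul m1 tg (lG e e0 e1).
have -> : ∫ (fun x => g x * (F e x + G e x)) = ∫ (fun x => g x * F e x) + ∫ (fun x => g x * G e x).
  by rewrite -(RintD i1 i2); apply: Rint_ext => x; rewrite mulrDr.
by rewrite mulrDl; apply: le_trans (ler_normD _ _) _; apply: lerD; [exact: h1|exact: h2].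
Qed.

Lemma Bd_ext F G : (forall e, 0 < e -> e <= 1 -> F e = G e) -> Bd F -> Bd G.
Proof.
move=> E [lF [K K0 h]]; split=> [e e0 e1|]; first by rewrite -E//; exact: lF.
by exists K => // e t g e0 e1 t0 tg; rewrite -E//; exact: h.
Qed.

Lemma BdM (w : P -> R) C F : mea w -> (forall z, `|w z| <= C) -> Bd F -> Bd (fun e z => w z * F e z).
Proof.
move=> mw bw [lF [K K0 h]]; have C0 : 0 <= C := le_trans (normr_ge0 _) (bw (0, 0)).
split=> [e e0 e1|]; first by apply: (@locintM _ C) => //; exact: lF.
exists (K * (1 + C ^+ 2)) => [|e t g e0 e1 t0 tg]; first by rewrite mulr_ge0// addr_ge0// sqr_ge0.
have tgw : tame (m + 1) (fun x => w x * g x).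
  by apply: tameM => //; exists C => z _; exact: bw.
have -> : ∫ (fun x => g x * (w x * F e x)) = ∫ (fun x => (w x * g x) * F e x).
  by apply: Rint_ext => x; ring.
apply: le_trans (h e t _ e0 e1 t0 tgw) _; rewrite -mulrA ler_wpM2l//.
have : ∫ (fun x => (w x * g x) ^+ 2) <= C ^+ 2 * ∫ (fun x => g x ^+ 2).
  have [_ ig] := tame_sqi m1 tg; rewrite -(RintZ _ ig); apply: Rint_le.
  - by have [] := tame_sqi m1 tgw.
  - exact: integZ.
  - by move=> z; rewrite exprMn ler_wpM2r ?sqr_ge0// -real_normK ?num_real// lerXn2r ?nnegrE.
have := sq0 g; have tV : 0 <= t^-1 by rewrite invr_ge0 ltW.
move: (∫ (fun x => (w x * g x) ^+ 2)) (∫ (fun x => g x ^+ 2)) => X Y Y0 XY.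
have C2 : 0 <= C ^+ 2 by exact: sqr_ge0.
have h1 : t * X <= t * (C ^+ 2 * Y) by rewrite ler_pM2l.
have h2 : 0 <= t * Y by rewrite mulr_ge0// ltW.
have h3 : 0 <= C ^+ 2 * t^-1 by rewrite mulr_ge0.
have -> : (1 + C ^+ 2) * (t * Y + t^-1) = t * Y + t^-1 + t * (C ^+ 2 * Y) + C ^+ 2 * t^-1 by ring.
lra.
Qed.

Lemma BdN F : Bd F -> Bd (fun e z => - F e z).
Proof.
move=> bF; apply: (@Bd_ext (fun e z => -1 * F e z)) => [e _ _|].
  by apply/funext => z; rewrite mulN1r.
apply: (BdM (w := fun=> -1) (C := 1)) => // z; by rewrite normrN1.
Qed.

Lemma BdB F G : Bd F -> Bd G -> Bd (fun e z => F e z - G e z).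
Proof. by move=> bF /BdN; exact: BdD. Qed.

Lemma Bd_bounded (C : R) F : (forall e, 0 < e -> e <= 1 -> locint (F e)) ->
  (forall e z, 0 < e -> e <= 1 -> square (m + 1) z -> `|F e z| <= C) -> Bd F.
Proof.
move=> lF bF; split=> //; pose I z : R := \1_(square (m + 1)) z.
have sI : sqi (fun z => C * I z).
  apply: (tame_sqi m1); apply: tameZ; split; [exact: mea_square| |].
    by exists 1 => z _; exact: indic_norm_le1.
  by move=> z nz; rewrite /I indicE memNset.
exists (1 + ∫ (fun z => (C * I z) ^+ 2)) => [|e t g e0 e1 t0 tg]; first exact: addr_ge0.
have [mg _ g0] := tg.
have sg : sqi (fun z => `|g z|).
  have [_ ig] := tame_sqi m1 tg; split; first exact: measurableT_comp.
  by have := ig; congr (_.-integrable _ (EFin \o _)); apply/funext => z; rewrite real_normK ?num_real.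
have h : `|∫ (fun x => g x * F e x)| <= ∫ (fun z => `|g z| * (C * I z)).
  apply: Rint_abs_le.
  - by apply: measurable_funM => //; case: (lF e e0 e1).
  - exact: sqint_mul.
  - move=> z; case: (pselect (square (m + 1) z)) => sz; last by rewrite g0// normr0 !mul0r normr0.
    by rewrite normrM ler_wpM2l// /I indicE mem_set// mulr1 bF.
apply: le_trans h _; apply: le_trans (ler_norm _) _; apply: le_trans (sqint_mul_le t0 sg sI) _.
have -> : ∫ (fun z => `|g z| ^+ 2) = ∫ (fun z => g z ^+ 2).
  by apply: Rint_ext => z; rewrite real_normK ?num_real.
have := sq0 g; have := sq0 (fun z => C * I z); have tV : 0 < t^-1 by rewrite invr_gt0.
move: (∫ (fun x => (C * I x) ^+ 2)) (∫ (fun x => g x ^+ 2)) => X Y X0 Y0.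
have -> : (4 * t)^-1 * X = t^-1 * X / 4 by field; rewrite gt_eqF.
have h1 : 0 <= t^-1 * X by rewrite mulr_ge0// ltW.
have h2 : 0 <= X * (t * Y) by rewrite !mulr_ge0// ltW.
have -> : (1 + X) * (t * Y + t^-1) = t * Y + t^-1 + X * (t * Y) + t^-1 * X by ring.
lra.
Qed.

Lemma Bd_convL2 (c w : P -> R) : continuous (c : R * R -> R) -> sqi w ->
  Bd (fun e => conv (fun y => c y * w y) (moll e)).
Proof.
move=> cc sw.
have lG : locint (fun y => c y * w y).
  apply: locint_bndM (sqi_locint sw); first exact: continuous_mea.
  by move=> n; apply: continuous_bounded_on => //; exact: compact_square.
split=> [e e0 _|]; first exact: conv_locint (ltW e0) lG (tame_moll e0).
have m2 : 0 <= m + 2 by exact: addr_ge0.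
pose I z : R := \1_(square (m + 2)) z.
have [C hC] := continuous_bounded_on cc (@compact_square R (m + 2)).
have sG : sqi (fun z => (I z * c z) * w z).
  apply: (@sqint_bndM _ _ _ _ `|C|) => //.
    by apply: measurable_funM; [exact: mea_square|exact: continuous_mea].
  move=> z; case: (pselect (square (m + 2) z)) => sz; last by rewrite /I indicE memNset// mul0r normr0.
  by rewrite /I indicE mem_set// mul1r (le_trans (hC z sz))// ler_norm.
exists (1 + ∫ (fun z => ((I z * c z) * w z) ^+ 2)) => [|e t g e0 e1 t0 tg]; first exact: addr_ge0.
have [mg _ g0] := tg.
have evenm h : moll e (- h) = 1 * moll e h by rewrite mul1r mollN.
rewrite (conv_transpose (ltW e0) m1 lG (tame_moll e0) (tame_integ m1 tg) g0 evenm) mul1r.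
have lg : locint g := integ_locint (tame_integ m1 tg).
have me0 : 0 <= m + 1 + e by rewrite addr_ge0// ltW.
have tW : tame (m + 1 + e) (conv g (moll e)) by exact: conv_tame (ltW e0) m1 lg g0 (tame_moll e0).
have le2 : m + 1 + e <= m + 2 by lra.
have [_ _ W0] := tameS le2 tW.
have -> : ∫ (fun y => c y * w y * conv g (moll e) y) = ∫ (fun y => conv g (moll e) y * ((I y * c y) * w y)).
  apply: Rint_ext => z; case: (pselect (square (m + 2) z)) => sz; last by rewrite W0// mulr0 mul0r.
  by rewrite /I indicE mem_set// mul1r mulrC.
apply: le_trans (sqint_mul_le t0 (tame_sqi me0 tW) sG) _.
have := conv_moll_sq e0 m1 tg; have := sq0 g; have := sq0 (fun z => (I z * c z) * w z).
have tV : 0 < t^-1 by rewrite invr_gt0.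
move: (∫ (fun x => ((I x * c x) * w x) ^+ 2)) (∫ (fun x => g x ^+ 2)) => X Y.
move: (∫ (fun x => conv g (moll e) x ^+ 2)) => Z X0 Y0 ZY.
have -> : (4 * t)^-1 * X = t^-1 * X / 4 by field; rewrite gt_eqF.
have h1 : 0 <= t^-1 * X by rewrite mulr_ge0// ltW.
have h2 : 0 <= X * (t * Y) by rewrite !mulr_ge0// ltW.
have h3 : t * Z <= t * Y by rewrite ler_pM2l.
have -> : (1 + X) * (t * Y + t^-1) = t * Y + t^-1 + X * (t * Y) + t^-1 * X by ring.
lra.
Qed.

Lemma Bd_commutator (c p px py : P -> R) (H : R -> P -> R) (K : R) : continuous (c : R * R -> R) ->
  mea p -> (forall z, `|p z| <= 1) -> sqi px -> sqi py -> wd (1, 0) setT p px -> wd (0, 1) setT p py ->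
  0 <= K -> (forall e, 0 < e -> tame e (H e) /\ forall h, `|H e h| <= K / e ^+ 3) ->
  Bd (fun e x => conv (fun y => c y * p y) (H e) x - p x * conv c (H e) x).
Proof.
move=> cc mp bp spx spy wpx wpy K0 hH; have lc := continuous_locint cc.
have lcp : locint (fun y => c y * p y).
  have := locintM mp bp lc; congr locint; apply/funext => y; exact: mulrC.
split=> [e e0 e1|].
  have [tH _] := hH e e0; have l1 := conv_locint (ltW e0) lcp tH; have l2 := conv_locint (ltW e0) lc tH.
  have := locintD l1 (locintZ (-1) (locintM mp bp l2)); congr locint.
  by apply/funext => x; rewrite mulN1r.
have [C hC] := continuous_bounded_on cc (@compact_square R (m + 1 + 1)).
have hC' z : square (m + 1 + 1) z -> `|c z| <= `|C|.
  by move=> sz; apply: le_trans (hC z sz) (ler_norm _).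
pose S := ∫ (fun z => px z ^+ 2) + ∫ (fun z => py z ^+ 2).
have S0 : 0 <= S by exact: addr_ge0.
exists (8 * K * (`|C| ^+ 2 + S)) => [|e t g e0 e1 t0 tg].
  by apply: mulr_ge0; [exact: mulr_ge0|apply: addr_ge0 => //; exact: sqr_ge0].
have [tH bH] := hH e e0.
have := commutator_bound mp bp spx spy wpx wpy e0 e1 m1 t0 K0 tH bH lc (normr_ge0 C) hC' tg.
move=> /le_trans; apply; rewrite -/S -[leRHS]mulrA.
apply: ler_wpM2l; first exact: mulr_ge0.
have := sq0 g; have tV : 0 < t^-1 by rewrite invr_gt0.
have C2 : 0 <= `|C| ^+ 2 by exact: sqr_ge0.
move: (∫ (fun x => g x ^+ 2)) (`|C| ^+ 2) C2 => Y D D0 Y0.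
have -> : (4 * t)^-1 * S = t^-1 * S / 4 by field; rewrite gt_eqF.
have h1 : 0 <= t^-1 * S by rewrite mulr_ge0// ltW.
have h2 : 0 <= S * (t * Y) by rewrite !mulr_ge0// ltW.
have h3 : 0 <= D * t^-1 by rewrite mulr_ge0// ltW.
have -> : (D + S) * (t * Y + t^-1) = t * (D * Y) + D * t^-1 + S * (t * Y) + t^-1 * S by ring.
lra.
Qed.

End UniformBounds.

Section Energy.
Context {R : realType}.
Local Notation P := (measurableTypeR R * measurableTypeR R)%type.
Local Notation integ f := ((@area R).-integrable setT (EFin \o f)).
Local Notation mea f := (@measurable_fun _ _ P R setT f).
Local Notation "'∫' f" := (Rintegral (@area R) setT f) (at level 10, f at level 9).
Local Notation sqi := (@sqint _ P R (@area R)).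
Local Notation ile g := (@integ_le _ P R (@area R) _ g).
Local Notation ibnd C := (@integ_bndM _ P R (@area R) C).
Implicit Types (x y z h : R * R) (n m e t : R) (v : R * R) (psi : P -> R).

Section Remainder.
Variables (p px py q qx qy : P -> R) (k : R).
Hypothesis hc : coefficient p px py q qx qy k.

Let shift_dx e x y : 0 < e -> dx (fun y : R * R => moll e (y - x)) y = mollx e (y - x).
Proof. by move=> e0; rewrite -(dx_moll e); exact: (dir_shift (- x) y (1, 0) (smooth_moll e)). Qed.

Let shift_dy e x y : 0 < e -> dy (fun y : R * R => moll e (y - x)) y = molly e (y - x).
Proof. by move=> e0; rewrite -(dy_moll e); exact: (dir_shift (- x) y (0, 1) (smooth_moll e)). Qed.

Definition remainder (a b : P -> R) e x : R :=
  - conv a (mollx e) x + conv b (molly e) x + p x * (conv a (mollx e) x + conv b (molly e) x) -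
  q x * (conv b (mollx e) x - conv a (molly e) x).

Lemma Bd_remainder m a b : 0 <= m -> continuous (a : R * R -> R) -> continuous (b : R * R -> R) ->
  (forall psi, csmooth psi -> Tfun p px py q qx qy a b psi = 0) -> Bd m (remainder a b).
Proof.
move=> m0 ca cb T0.
have [K K0 hK] := @moll_grad_bound R.
have hX (e : R) : 0 < e -> tame e (mollx e) /\ forall h, `|mollx e h| <= K / e ^+ 3.
  by move=> e0; split => [|h]; [exact: tame_mollx|have [] := hK e e0 h].
have hY (e : R) : 0 < e -> tame e (molly e) /\ forall h, `|molly e h| <= K / e ^+ 3.
  by move=> e0; split => [|h]; [exact: tame_molly|have [] := hK e e0 h].
have [[mp mq] [bp bq]] := ((coef_mp hc, coef_mq hc), (coef_bp hc, coef_bq hc)).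
have [spx spy sqx sqy] := And4 (coef_px hc) (coef_py hc) (coef_qx hc) (coef_qy hc).
have Kp c H : continuous (c : R * R -> R) ->
    (forall e, 0 < e -> tame e (H e) /\ forall h, `|H e h| <= K / e ^+ 3) ->
    Bd m (fun e x => conv (fun y => c y * p y) (H e) x - p x * conv c (H e) x).
  by move=> cc hH; apply: (Bd_commutator m0 cc mp bp spx spy) hH; case: hc.
have Kq c H : continuous (c : R * R -> R) ->
    (forall e, 0 < e -> tame e (H e) /\ forall h, `|H e h| <= K / e ^+ 3) ->
    Bd m (fun e x => conv (fun y => c y * q y) (H e) x - q x * conv c (H e) x).
  by move=> cc hH; apply: (Bd_commutator m0 cc mq bq sqx sqy) hH; case: hc.
have k1 := Kp a _ ca hX; have k2 := Kq a _ ca hY.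
have k3 := Kp b _ cb hY; have k4 := Kq b _ cb hX.
have l1 := Bd_convL2 m0 ca spx; have l2 := Bd_convL2 m0 ca sqy.
have l3 := Bd_convL2 m0 cb spy; have l4 := Bd_convL2 m0 cb sqx.
have B1 := BdD m0 (BdD m0 k1 k2) (BdB m0 k3 k4).
have B2 := BdD m0 (BdD m0 l1 l2) (BdB m0 l3 l4).
apply: (Bd_ext _ (BdN m0 (BdD m0 B1 B2))) => e e0 _; apply/funext => x.
have [tX tY tM] := And3 (tame_mollx e0) (tame_molly e0) (tame_moll e0).
have cps : csmooth (fun y : P => moll e (y - x)).
  split; first by apply: smooth_shift; exact: smooth_moll.
  have [_ _ h0] := tame_shift (- x) (ltW e0) tM.
  by exists (e + `|(- x).1| + `|(- x).2|) => //; rewrite !addr_ge0// ltW.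
have := T0 _ cps; rewrite /Tfun /L1op /L2op.
have lc c : continuous (c : R * R -> R) -> locint c by exact: continuous_locint.
have lcb c (w : P -> R) : continuous (c : R * R -> R) -> mea w -> (forall z, `|w z| <= 1) ->
    locint (fun y => c y * w y).
  move=> cc mw bw; have := locintM mw bw (lc c cc); congr locint; apply/funext => y; exact: mulrC.
have lcs c w : continuous (c : R * R -> R) -> sqi w -> locint (fun y => c y * w y).
  move=> cc sw; apply: locint_bndM (sqi_locint sw); first exact: continuous_mea.
  by move=> n; apply: continuous_bounded_on => //; exact: compact_square.
have ci c H : locint c -> tame e H -> integ (fun y : P => c y * H (y - x : R * R)).
  by move=> ? ?; exact: conv_integrand (ltW e0) _ _ _.
have [a1 a2 a3 a4] := And4 (ci _ _ (lc _ ca) tX) (ci _ _ (lcb _ _ ca mp bp) tX)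
  (ci _ _ (lcs _ _ ca spx) tM) (ci _ _ (lcb _ _ ca mq bq) tY).
have a5 := ci _ _ (lcs _ _ ca sqy) tM.
have [b1 b2 b3 b4] := And4 (ci _ _ (lc _ cb) tY) (ci _ _ (lcb _ _ cb mp bp) tY)
  (ci _ _ (lcs _ _ cb spy) tM) (ci _ _ (lcb _ _ cb mq bq) tX).
have b5 := ci _ _ (lcs _ _ cb sqx) tM.
have Da := RintB (integB a1 (integD a2 a3)) (integD a4 a5).
rewrite (RintB a1 (integD a2 a3)) (RintD a2 a3) (RintD a4 a5) in Da.
have Db := RintD (integB (integN b1) (integD b2 b3)) (integD b4 b5).
rewrite (RintB (integN b1) (integD b2 b3)) (RintN b1) (RintD b2 b3) (RintD b4 b5) in Db.
have -> : ∫ (fun z => a z * (dx (fun y : R * R => moll e (y - x)) z -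
    (p z * dx (fun y : R * R => moll e (y - x)) z + px z * moll e (z - x)) -
    (q z * dy (fun y : R * R => moll e (y - x)) z + qy z * moll e (z - x)))) =
   conv a (mollx e) x - (conv (fun y => a y * p y) (mollx e) x + conv (fun y => a y * px y) (moll e) x)
    - (conv (fun y => a y * q y) (molly e) x + conv (fun y => a y * qy y) (moll e) x).
  rewrite -[RHS]Da; apply: Rint_ext => y; rewrite (shift_dx x y e0) (shift_dy x y e0); ring.
have -> : ∫ (fun z => b z * (- dy (fun y : R * R => moll e (y - x)) z -
    (p z * dy (fun y : R * R => moll e (y - x)) z + py z * moll e (z - x)) +
    (q z * dx (fun y : R * R => moll e (y - x)) z + qx z * moll e (z - x)))) =
   - conv b (molly e) x - (conv (fun y => b y * p y) (molly e) x + conv (fun y => b y * py y) (moll e) x)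
    + (conv (fun y => b y * q y) (mollx e) x + conv (fun y => b y * qx y) (moll e) x).
  rewrite -[RHS]Db; apply: Rint_ext => y; rewrite (shift_dx x y e0) (shift_dy x y e0); ring.
rewrite /remainder => T1; apply/eqP; rewrite -subr_eq0 -T1; apply/eqP; ring.
Qed.

End Remainder.

Lemma Bd_conv m a : 0 <= m -> continuous (a : R * R -> R) -> Bd m (fun e => conv a (moll e)).
Proof.
move=> m0 ca; have lc := continuous_locint ca.
have [C hC] := continuous_bounded_on ca (@compact_square R (m + 2)).
apply: (@Bd_bounded R m m0 (3 * `|C|)) => [e e0 _|e z e0 e1 sz].
  exact: conv_locint (ltW e0) lc (tame_moll e0).
have hC' y : square (m + 2) y -> `|a y| <= `|C|.
  by move=> sy; apply: le_trans (hC y sy) (ler_norm _).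
have sz2 : square (m + 2) z by apply: squareS sz; lra.
have C2 : 0 <= 2 * `|C| by rewrite mulr_ge0.
have h : `|conv a (moll e) z - a z| <= 2 * `|C|.
  apply: conv_unif => // h /squareE [h1 h2].
  have sh : square (m + 2) (z + h).
    move/squareE : sz => [z1 z2]; apply/squareE; split; apply: le_trans (ler_normD _ _) _ => /=; lra.
  by apply: le_trans (ler_normB _ _) _; rewrite mulr2n mulrDl !mul1r lerD// hC'.
have := hC' z sz2; have := ler_normD (conv a (moll e) z - a z) (a z); rewrite subrK; lra.
Qed.

Lemma cut_derivable m (t : R) : exists d : R, is_derive t 1 (cut m) d.
Proof.
have [C C0 hC] := @step_lipschitz R.
have [d1 h1 _] := hC (m + 1 - t); have [d2 h2 _] := hC (m + 1 + t).
have e1 : is_derive t (1 : R) (fun t : R => step (m + 1 - t)) (d1 * -1).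
  apply: (@is_derive1_comp _ step (fun t => m + 1 - t)) => //.
  by apply: is_derive_eq (is_deriveB (is_derive_cst (m + 1 : R) _ _) (is_derive_id _ _)) _; rewrite sub0r.
have e2 : is_derive t (1 : R) (fun t : R => step (m + 1 + t)) (d2 * 1).
  apply: (@is_derive1_comp _ step (fun t => m + 1 + t)) => //.
  by apply: is_derive_eq (is_deriveD (is_derive_cst (m + 1 : R) _ _) (is_derive_id _ _)) _; rewrite add0r.
by eexists; exact: is_deriveM e1 e2.
Qed.

Lemma cutoff_mixed m : exists ex ey exy : P -> R,
  [/\ [/\ tame (m + 1) ex, tame (m + 1) ey & tame (m + 1) exy],
    forall z : R * R, is_derive z ((1, 0) : R * R) (cutoff m : R * R -> R) (ex z),
    forall z : R * R, is_derive z ((0, 1) : R * R) (cutoff m : R * R -> R) (ey z),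
    forall z : R * R, is_derive z ((0, 1) : R * R) (ex : R * R -> R) (exy z) &
    forall z : R * R, is_derive z ((1, 0) : R * R) (ey : R * R -> R) (exy z)].
Proof.
have /choice [d hd] := cut_derivable m.
have d1 z : is_derive z ((1, 0) : R * R) (fun w : R * R => cut m w.1) (d z.1).
  have := is_derive_chain (hd z.1) (is_derive_fst z (1, 0)); by rewrite mulr1.
have d2 z : is_derive z ((0, 1) : R * R) (fun w : R * R => cut m w.2) (d z.2).
  have := is_derive_chain (hd z.2) (is_derive_snd z (0, 1)); by rewrite mulr1.
have c1 (f : R -> R) z : is_derive z ((0, 1) : R * R) (fun w : R * R => f w.1) 0.
  apply/is_derive_line; have := is_derive_cst (f z.1) (0 : R) (1 : R); congr is_derive.
  by apply/funext => s /=; rewrite [_ *: _]mulr0 add0r.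
have c2 (f : R -> R) z : is_derive z ((1, 0) : R * R) (fun w : R * R => f w.2) 0.
  apply/is_derive_line; have := is_derive_cst (f z.2) (0 : R) (1 : R); congr is_derive.
  by apply/funext => s /=; rewrite [_ *: _]mulr0 add0r.
have hx z : is_derive z ((1, 0) : R * R) (cutoff m : R * R -> R) (d z.1 * cut m z.2).
  apply: is_derive_eq (is_deriveM (d1 z) (c2 (cut m) z)) _.
  by rewrite /GRing.scale /= mulr0 add0r mulrC.
have hy z : is_derive z ((0, 1) : R * R) (cutoff m : R * R -> R) (cut m z.1 * d z.2).
  apply: is_derive_eq (is_deriveM (c1 (cut m) z) (d2 z)) _.
  by rewrite /GRing.scale /= mulr0 addr0.
have hxy z : is_derive z ((0, 1) : R * R) (fun z : R * R => d z.1 * cut m z.2) (d z.1 * d z.2).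
  apply: is_derive_eq (is_deriveM (c1 d z) (d2 z)) _.
  by rewrite /GRing.scale /= mulr0 addr0.
have hyx z : is_derive z ((1, 0) : R * R) (fun z : R * R => cut m z.1 * d z.2) (d z.1 * d z.2).
  apply: is_derive_eq (is_deriveM (d1 z) (c2 d z)) _.
  by rewrite /GRing.scale /= mulr0 add0r mulrC.
have sc := @smooth_cutoff R m; have z0 := @cutoff0 R m.
have [tx ty] := tame_dxy sc z0; have [_ _ x0] := tx.
have [_ txy] := tame_dxy (smooth_dx sc) x0.
exists (fun z => d z.1 * cut m z.2), (fun z => cut m z.1 * d z.2), (fun z => d z.1 * d z.2).
have ex : dx (cutoff m) = (fun z => d z.1 * cut m z.2) by apply/funext => z; exact: dxE.
have ey : dy (cutoff m) = (fun z => cut m z.1 * d z.2) by apply/funext => z; exact: dyE.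
have exy : dy (dx (cutoff m)) = (fun z => d z.1 * d z.2).
  by apply/funext => z; rewrite ex; exact: dyE.
split=> //; split; [rewrite -ex|rewrite -ey|rewrite -exy].
- exact: tx.
- exact: ty.
- exact: txy.
Qed.

Lemma conformal_young (P1 S1 P2 S2 p q k : R) : 0 <= k -> p ^+ 2 + q ^+ 2 <= k ^+ 2 ->
  P1 * (p * P2 - q * S2) + S1 * (p * S2 + q * P2) <=
  k / 2 * (P1 ^+ 2 + S1 ^+ 2 + P2 ^+ 2 + S2 ^+ 2).
Proof.
move=> k0 hk; set N1 := P1 ^+ 2 + S1 ^+ 2; set N2 := P2 ^+ 2 + S2 ^+ 2.
have N10 : 0 <= N1 by apply: addr_ge0; exact: sqr_ge0.
have N20 : 0 <= N2 by apply: addr_ge0; exact: sqr_ge0.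
have E : P1 ^+ 2 + S1 ^+ 2 + P2 ^+ 2 + S2 ^+ 2 = N1 + N2 by rewrite /N1 /N2; ring.
rewrite E; apply: le_trans (ler_norm _) _.
have r0 : 0 <= k / 2 * (N1 + N2) by apply: mulr_ge0; [exact: divr_ge0|exact: addr_ge0].
rewrite -(@ler_pXn2r _ 2) ?nnegrE// real_normK ?num_real//.
have h1 : (P1 * (p * P2 - q * S2) + S1 * (p * S2 + q * P2)) ^+ 2 <= (p ^+ 2 + q ^+ 2) * (N1 * N2).
  rewrite -subr_ge0.
  have -> : (p ^+ 2 + q ^+ 2) * (N1 * N2) - (P1 * (p * P2 - q * S2) + S1 * (p * S2 + q * P2)) ^+ 2 =
    (p * (S1 * P2 - P1 * S2) - q * (P1 * P2 + S1 * S2)) ^+ 2 by rewrite /N1 /N2; ring.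
  exact: sqr_ge0.
have h2 : (p ^+ 2 + q ^+ 2) * (N1 * N2) <= k ^+ 2 * (N1 * N2) by apply: ler_wpM2r => //; exact: mulr_ge0.
apply: le_trans h1 (le_trans h2 _).
rewrite -subr_ge0.
have -> : (k / 2 * (N1 + N2)) ^+ 2 - k ^+ 2 * (N1 * N2) = (k / 2 * (N1 - N2)) ^+ 2 by field.
exact: sqr_ge0.
Qed.

End Energy.

Section EnergyBound.
Context {R : realType}.
Local Notation P := (measurableTypeR R * measurableTypeR R)%type.
Local Notation integ f := ((@area R).-integrable setT (EFin \o f)).
Local Notation mea f := (@measurable_fun _ _ P R setT f).
Local Notation "'∫' f" := (Rintegral (@area R) setT f) (at level 10, f at level 9).
Local Notation sqi := (@sqint _ P R (@area R)).
Local Notation ile g := (@integ_le _ P R (@area R) _ g).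
Local Notation ibnd C := (@integ_bndM _ P R (@area R) C).
Implicit Types (x y z h : R * R) (n e t : R) (v : R * R) (psi : P -> R).

Let absorb (k X1 X2 X3 X4 V1 V2 c1 c2 c : R) : X3 + X4 = X1 + X2 ->
  V1 + V2 <= k / 2 * (X1 + X2 + X3 + X4) -> X1 - V1 <= (1 - k) / 2 * X1 + c1 ->
  X2 - V2 <= (1 - k) / 2 * X2 + c2 -> c1 + c2 <= c -> (X1 + X2) * (1 - k) <= 2 * c.
Proof.
move=> E; rewrite (_ : X1 + X2 + X3 + X4 = 2 * (X1 + X2)); last by rewrite -!addrA E; ring.
lra.
Qed.

Let sum4_le (x1 x2 x3 x4 : R) : 0 <= x1 -> 0 <= x2 -> 0 <= x3 -> 0 <= x4 ->
  [/\ x1 <= x1 + x2 + x3 + x4, x2 <= x1 + x2 + x3 + x4, x3 <= x1 + x2 + x3 + x4 & x4 <= x1 + x2 + x3 + x4].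
Proof. by move=> *; split; lra. Qed.

Section Localized.
Variables (m : R) (ex ey exy : P -> R).
Hypothesis m0 : 0 <= m.
Hypotheses (tex : tame (m + 1) ex) (tey : tame (m + 1) ey) (texy : tame (m + 1) exy).
Hypothesis dex : forall z : R * R, is_derive z ((1, 0) : R * R) (cutoff m : R * R -> R) (ex z).
Hypothesis dey : forall z : R * R, is_derive z ((0, 1) : R * R) (cutoff m : R * R -> R) (ey z).
Hypothesis dexy : forall z : R * R, is_derive z ((0, 1) : R * R) (ex : R * R -> R) (exy z).
Hypothesis deyx : forall z : R * R, is_derive z ((1, 0) : R * R) (ey : R * R -> R) (exy z).
Let m1 : 0 <= m + 1. Proof. exact: addr_ge0. Qed.

Definition loc e (c : P -> R) z := cutoff m z * conv c (moll e) z.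
Definition loc_dx e (c : P -> R) z := cutoff m z * - conv c (mollx e) z + conv c (moll e) z * ex z.
Definition loc_dy e (c : P -> R) z := cutoff m z * - conv c (molly e) z + conv c (moll e) z * ey z.
Definition loc_dxy e (c : P -> R) z := cutoff m z * conv c (mollxy e) z - conv c (mollx e) z * ey z -
  conv c (molly e) z * ex z + conv c (moll e) z * exy z.

Section OneFunction.
Variables (c : P -> R) (e : R).
Hypotheses (cc : continuous (c : R * R -> R)) (e0 : 0 < e).
Let lc : locint c. Proof. exact: continuous_locint. Qed.

Let dA z : is_derive z ((1, 0) : R * R) (conv c (moll e) : R * R -> R) (- conv c (mollx e) z).
Proof. exact: conv_derive (ltW e0) lc (tame_moll e0) (tame_mollx e0) (@is_derive_mollx R e). Qed.

Let dB z : is_derive z ((0, 1) : R * R) (conv c (moll e) : R * R -> R) (- conv c (molly e) z).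
Proof. exact: conv_derive (ltW e0) lc (tame_moll e0) (tame_molly e0) (@is_derive_molly R e). Qed.

Let dAB z : is_derive z ((0, 1) : R * R) (conv c (mollx e) : R * R -> R) (- conv c (mollxy e) z).
Proof. exact: conv_derive (ltW e0) lc (tame_mollx e0) (tame_mollxy e0) (@is_derive_mollx_y R e). Qed.

Let dBA z : is_derive z ((1, 0) : R * R) (conv c (molly e) : R * R -> R) (- conv c (mollxy e) z).
Proof. exact: conv_derive (ltW e0) lc (tame_molly e0) (tame_mollxy e0) (@is_derive_molly_x R e). Qed.

Let dU z : is_derive z ((1, 0) : R * R) (loc e c : R * R -> R) (loc_dx e c z).
Proof. exact: is_deriveM (dex z) (dA z). Qed.

Let dV z : is_derive z ((0, 1) : R * R) (loc e c : R * R -> R) (loc_dy e c z).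
Proof. exact: is_deriveM (dey z) (dB z). Qed.

Let dUV z : is_derive z ((0, 1) : R * R) (loc_dx e c : R * R -> R) (loc_dxy e c z).
Proof.
apply: is_derive_eq (is_deriveD (is_deriveM (dey z) (is_deriveN (dAB z))) (is_deriveM (dB z) (dexy z))) _.
by rewrite /GRing.scale /loc_dxy ?fctE /=; ring.
Qed.

Let dVU z : is_derive z ((1, 0) : R * R) (loc_dy e c : R * R -> R) (loc_dxy e c z).
Proof.
apply: is_derive_eq (is_deriveD (is_deriveM (dex z) (is_deriveN (dBA z))) (is_deriveM (dA z) (deyx z))) _.
by rewrite /GRing.scale /loc_dxy ?fctE /=; ring.
Qed.

Let tc H (f : P -> R) : tame e H -> tame (m + 1) f -> tame (m + 1) (fun z => conv c H z * f z).
Proof.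
move=> tH tf; apply: tameM => //; first exact: mea_conv (ltW e0) lc tH.
exact: (@conv_bounded R c H e (ltW e0) lc tH (m + 1) m1).
Qed.

Let tet := @tame_cutoff R m.

Lemma tame_loc : [/\ tame (m + 1) (loc e c), tame (m + 1) (loc_dx e c), tame (m + 1) (loc_dy e c) & tame (m + 1) (loc_dxy e c)].
Proof.
have [t1 t2 t3 t4] := And4 (tame_moll e0) (tame_mollx e0) (tame_molly e0) (tame_mollxy e0).
have E (f g : P -> R) : (forall z, g z = f z) -> tame (m + 1) f -> tame (m + 1) g.
  by move=> fg; congr tame; apply/funext => z.
split.
- by apply: E (tc t1 tet) => z; rewrite /loc mulrC.
- by apply: E (tameB (tc t1 tex) (tc t2 tet)) => z; rewrite /loc_dx; ring.
- by apply: E (tameB (tc t1 tey) (tc t3 tet)) => z; rewrite /loc_dy; ring.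
- apply: E (tameD (tameB (tameB (tc t4 tet) (tc t2 tey)) (tc t3 tex)) (tc t1 texy)) => z.
  by rewrite /loc_dxy; ring.
Qed.

Lemma loc_dx_parts psi : smooth psi -> offzero m psi ->
  ∫ (fun z => conv c (moll e) z * dx psi z) = - ∫ (fun z => loc_dx e c z * psi z).
Proof.
move=> sp p0; have [tU tUx _ _] := tame_loc.
have le1 : m <= m + 1 by rewrite lerDl.
have tp := tameS le1 (smooth_tame sp p0).
have [tdm _] := tame_dxy sp p0; have td := tameS le1 tdm; have [_ _ d0] := tdm.
have i1 := tame_integ m1 (tame_tameM tU td); have i2 := tame_integ m1 (tame_tameM tUx tp).
have D0 : ∫ (fun z => loc e c z * dx psi z + psi z * loc_dx e c z) = 0.
  apply: (Rint_deriv0 m1 (H := fun z => loc e c z * psi z) (v := (1, 0))).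
  - exact: tame_tameM.
  - by apply: tameD; apply: tame_tameM.
  - by move=> z; exact: is_deriveM (dU z) (smooth_dirP z (1, 0) sp).
have -> : ∫ (fun z => conv c (moll e) z * dx psi z) = ∫ (fun z => loc e c z * dx psi z).
  apply: Rint_ext => z; case: (pselect (square m z)) => sz; last by rewrite d0// !mulr0.
  by rewrite /loc cutoff1// mul1r.
apply/eqP; rewrite -addr_eq0 -(RintD i1 i2) -[X in _ == X]D0; apply/eqP; apply: Rint_ext => z.
by rewrite (mulrC (psi z)).
Qed.

Lemma loc_dy_parts psi : smooth psi -> offzero m psi ->
  ∫ (fun z => conv c (moll e) z * dy psi z) = - ∫ (fun z => loc_dy e c z * psi z).
Proof.
move=> sp p0; have [tU _ tUy _] := tame_loc.
have le1 : m <= m + 1 by rewrite lerDl.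
have tp := tameS le1 (smooth_tame sp p0).
have [_ tdm] := tame_dxy sp p0; have td := tameS le1 tdm; have [_ _ d0] := tdm.
have i1 := tame_integ m1 (tame_tameM tU td); have i2 := tame_integ m1 (tame_tameM tUy tp).
have D0 : ∫ (fun z => loc e c z * dy psi z + psi z * loc_dy e c z) = 0.
  apply: (Rint_deriv0 m1 (H := fun z => loc e c z * psi z) (v := (0, 1))).
  - exact: tame_tameM.
  - by apply: tameD; apply: tame_tameM.
  - by move=> z; exact: is_deriveM (dV z) (smooth_dirP z (0, 1) sp).
have -> : ∫ (fun z => conv c (moll e) z * dy psi z) = ∫ (fun z => loc e c z * dy psi z).
  apply: Rint_ext => z; case: (pselect (square m z)) => sz; last by rewrite d0// !mulr0.
  by rewrite /loc cutoff1// mul1r.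
apply/eqP; rewrite -addr_eq0 -(RintD i1 i2) -[X in _ == X]D0; apply/eqP; apply: Rint_ext => z.
by rewrite (mulrC (psi z)).
Qed.

Lemma loc_derivatives z : [/\ is_derive z ((1, 0) : R * R) (loc e c : R * R -> R) (loc_dx e c z),
  is_derive z ((0, 1) : R * R) (loc e c : R * R -> R) (loc_dy e c z),
  is_derive z ((0, 1) : R * R) (loc_dx e c : R * R -> R) (loc_dxy e c z) &
  is_derive z ((1, 0) : R * R) (loc_dy e c : R * R -> R) (loc_dxy e c z)].
Proof. by []. Qed.

End OneFunction.

Variables (p px py q qx qy : P -> R) (k : R).
Hypothesis hc : coefficient p px py q qx qy k.

Lemma Bd_loc a b : continuous (a : R * R -> R) -> continuous (b : R * R -> R) ->
  (forall psi, csmooth psi -> Tfun p px py q qx qy a b psi = 0) ->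
  Bd m (fun e z => loc_dx e a z - loc_dy e b z - p z * (loc_dx e a z + loc_dy e b z) + q z * (loc_dx e b z - loc_dy e a z)).
Proof.
move=> ca cb T0; have B0 := Bd_remainder hc m0 ca cb T0.
have [[mp mq] [bp bq]] := ((coef_mp hc, coef_mq hc), (coef_bp hc, coef_bq hc)).
have Bt (w : P -> R) F : tame (m + 1) w -> Bd m F -> Bd m (fun e z => w z * F e z).
  by move=> [mw [C hC] _]; apply: BdM => // z; exact: hC.
have [Ba Bb] := (Bd_conv m0 ca, Bd_conv m0 cb).
have [B1 B2] := (Bt _ _ tex Ba, Bt _ _ tey Bb); have [B3 B4] := (Bt _ _ tex Bb, Bt _ _ tey Ba).
have Bp := BdM m0 mp bp (BdD m0 B1 B2); have Bq := BdM m0 mq bq (BdB m0 B3 B4).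
have B := BdD m0 (Bt _ _ (@tame_cutoff R m) B0) (BdD m0 (BdB m0 (BdB m0 B1 B2) Bp) Bq).
apply: (Bd_ext _ B) => e _ _; apply/funext => z.
by rewrite /loc_dx /loc_dy /remainder; ring.
Qed.

Let sq0 (g : P -> R) : 0 <= ∫ (fun z => g z ^+ 2).
Proof. by apply: Rint_ge0 => z; exact: sqr_ge0. Qed.

Lemma energy_bound a b : continuous (a : R * R -> R) -> continuous (b : R * R -> R) ->
  (forall psi, csmooth psi -> Tfun p px py q qx qy a b psi = 0) ->
  (forall psi, csmooth psi -> Tfun p px py q qx qy b (fun z => - a z) psi = 0) ->
  exists2 C : R, 0 <= C & forall e, 0 < e -> e <= 1 ->
    ∫ (fun z => loc_dx e a z ^+ 2) + ∫ (fun z => loc_dy e a z ^+ 2) +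
    ∫ (fun z => loc_dx e b z ^+ 2) + ∫ (fun z => loc_dy e b z ^+ 2) <= C.
Proof.
move=> ca cb T1 T2.
have cna : continuous ((fun z => - a z) : R * R -> R) by move=> z; apply: cvgN; exact: ca.
have [_ [K1 K10 h1]] := Bd_loc ca cb T1; have [_ [K2 K20 h2]] := Bd_loc cb cna T2.
have [k0 k1] := (coef_k0 hc, coef_k1 hc).
pose K : R := K1 + K2 + 1; have K0 : 0 < K by rewrite ltr_wpDl ?addr_ge0.
pose t0 : R := (1 - k) / (2 * K).
have t00 : 0 < t0 by apply: divr_gt0; [rewrite subr_gt0|exact: mulr_gt0].
exists (2 * K * t0^-1 / (1 - k)) => [|e e0 e1].
  apply: divr_ge0; last by rewrite subr_ge0 ltW.
  by apply: mulr_ge0; [apply: mulr_ge0 => //; exact: ltW|rewrite invr_ge0 ltW].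
have [tu tux tuy tuxy] := tame_loc ca e0; have [tv tvx tvy tvxy] := tame_loc cb e0.
pose P1 z := loc_dx e a z - loc_dy e b z; pose S1 z := loc_dy e a z + loc_dx e b z.
pose P2 z := loc_dx e a z + loc_dy e b z; pose S2 z := loc_dx e b z - loc_dy e a z.
have [tP1 tS1 tP2 tS2] : [/\ tame (m + 1) P1, tame (m + 1) S1, tame (m + 1) P2 & tame (m + 1) S2].
  by split; [exact: tameB|exact: tameD|exact: tameD|exact: tameB].
have nc H z : tame e H -> conv (fun z => - a z) H z = - conv a H z.
  move=> tH; rewrite /conv -(RintN (conv_integrand (ltW e0) (continuous_locint ca) tH z)).
  by apply: Rint_ext => y; rewrite mulNr.
have nx z : loc_dx e (fun z => - a z) z = - loc_dx e a z.
  by rewrite /loc_dx (nc _ _ (tame_mollx e0)) (nc _ _ (tame_moll e0)); ring.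
have ny z : loc_dy e (fun z => - a z) z = - loc_dy e a z.
  by rewrite /loc_dy (nc _ _ (tame_molly e0)) (nc _ _ (tame_moll e0)); ring.
have [[mp mq] [bp bq]] := ((coef_mp hc, coef_mq hc), (coef_bp hc, coef_bq hc)).
have tpq (w f : P -> R) : mea w -> (forall z, `|w z| <= 1) -> tame (m + 1) f -> tame (m + 1) (fun z => w z * f z).
  by move=> mw bw tf; apply: tameM => //; exists 1 => z _; exact: bw.
pose W1 z := p z * P2 z - q z * S2 z; pose W2 z := p z * S2 z + q z * P2 z.
have tW1 : tame (m + 1) W1 by apply: tameB; exact: tpq.
have tW2 : tame (m + 1) W2 by apply: tameD; exact: tpq.
have it f : tame (m + 1) f -> integ f by exact: tame_integ.
have [j1 j2 j3 j4] := And4 (it _ (tame_sq tP1)) (it _ (tame_sq tS1)) (it _ (tame_sq tP2)) (it _ (tame_sq tS2)).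
have [j5 j6] := (it _ (tame_tameM tP1 tW1), it _ (tame_tameM tS1 tW2)).
have e1' : ∫ (fun z => P1 z * (P1 z - W1 z)) = ∫ (fun z => P1 z ^+ 2) - ∫ (fun z => P1 z * W1 z).
  by rewrite -(RintB j1 j5); apply: Rint_ext => z; ring.
have e2' : ∫ (fun z => S1 z * (S1 z - W2 z)) = ∫ (fun z => S1 z ^+ 2) - ∫ (fun z => S1 z * W2 z).
  by rewrite -(RintB j2 j6); apply: Rint_ext => z; ring.
have f1 := h1 e t0 P1 e0 e1 t00 tP1; have f2 := h2 e t0 S1 e0 e1 t00 tS1.
have g1 : `|∫ (fun z => P1 z * (P1 z - W1 z))| <= K1 * (t0 * ∫ (fun z => P1 z ^+ 2) + t0^-1).
  apply: le_trans f1; rewrite le_eqVlt; apply/orP; left; apply/eqP; congr (`|_|); apply: Rint_ext => z.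
  by rewrite /P1 /W1 /P2 /S2; ring.
have g2 : `|∫ (fun z => S1 z * (S1 z - W2 z))| <= K2 * (t0 * ∫ (fun z => S1 z ^+ 2) + t0^-1).
  apply: le_trans f2; rewrite le_eqVlt; apply/orP; left; apply/eqP; congr (`|_|); apply: Rint_ext => z.
  by rewrite nx ny /S1 /W2 /P2 /S2; ring.
have J := jacobian0 m1 tu tux tuy tv tvx tvy tvxy (fun z => let: And4 h _ _ _ := loc_derivatives ca e0 z in h)
  (fun z => let: And4 _ h _ _ := loc_derivatives ca e0 z in h)
  (fun z => let: And4 _ _ h _ := loc_derivatives cb e0 z in h)
  (fun z => let: And4 _ _ _ h := loc_derivatives cb e0 z in h).
have iJ : integ (fun z => loc_dx e a z * loc_dy e b z - loc_dy e a z * loc_dx e b z).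
  by apply: it; apply: tameB; exact: tame_tameM.
have J2 : ∫ (fun z => P2 z ^+ 2) + ∫ (fun z => S2 z ^+ 2) = ∫ (fun z => P1 z ^+ 2) + ∫ (fun z => S1 z ^+ 2).
  have i12 := integD j1 j2.
  have := RintD i12 (integZ 4 iJ); rewrite (RintZ _ iJ) J mulr0 addr0 (RintD j1 j2) => <-.
  by rewrite -(RintD j3 j4); apply: Rint_ext => z; rewrite /P1 /P2 /S1 /S2; ring.
have iall := integZ (k / 2) (integD (integD (integD j1 j2) j3) j4).
have Y : ∫ (fun z => P1 z * W1 z) + ∫ (fun z => S1 z * W2 z) <= k / 2 *
    (∫ (fun z => P1 z ^+ 2) + ∫ (fun z => S1 z ^+ 2) + ∫ (fun z => P2 z ^+ 2) + ∫ (fun z => S2 z ^+ 2)).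
  rewrite -(RintD j5 j6) -(RintD j1 j2) -(RintD (integD j1 j2) j3) -(RintD (integD (integD j1 j2) j3) j4).
  rewrite -RintZ; last exact: integD (integD (integD j1 j2) j3) j4.
  apply: Rint_le => //; first exact: integD.
  by move=> z; apply: conformal_young => //; exact: coef_norm hc z.
have [u1 u2 u3 u4] := And4 (it _ (tame_sq tux)) (it _ (tame_sq tuy)) (it _ (tame_sq tvx)) (it _ (tame_sq tvy)).
have -> : ∫ (fun z => loc_dx e a z ^+ 2) + ∫ (fun z => loc_dy e a z ^+ 2) +
    ∫ (fun z => loc_dx e b z ^+ 2) + ∫ (fun z => loc_dy e b z ^+ 2) =
    ∫ (fun z => P1 z ^+ 2) + ∫ (fun z => S1 z ^+ 2).
  rewrite -(RintD u1 u2) -(RintD (integD u1 u2) u3) -(RintD (integD (integD u1 u2) u3) u4).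
  have i12 := integD j1 j2.
  have := RintD i12 (integZ 2 iJ); rewrite (RintZ _ iJ) J mulr0 addr0 (RintD j1 j2) => <-.
  by apply: Rint_ext => z; rewrite /P1 /S1; ring.
move: g1 g2 Y; rewrite {}e1' {}e2'; move: J2 (sq0 P1) (sq0 S1).
move: (∫ (fun z => P1 z ^+ 2)) (∫ (fun z => S1 z ^+ 2)) (∫ (fun z => P2 z ^+ 2)) (∫ (fun z => S2 z ^+ 2)).
move: (∫ (fun z => P1 z * W1 z)) (∫ (fun z => S1 z * W2 z)) => V1 V2 X1 X2 X3 X4 J2 X10 X20.
move=> /ler_normlP [_ g1] /ler_normlP[_ g2] Y.
have Kt : K * t0 = (1 - k) / 2 by rewrite /t0; field; rewrite gt_eqF.
have tV : 0 < t0^-1 by rewrite invr_gt0.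
have a1 : K1 * (t0 * X1) <= K * t0 * X1.
  rewrite mulrA ler_wpM2r// ler_wpM2r ?(ltW t00)//.
  by rewrite /K -addrA lerDl addr_ge0.
have a2 : K2 * (t0 * X2) <= K * t0 * X2.
  rewrite mulrA ler_wpM2r// ler_wpM2r ?(ltW t00)//.
  by rewrite /K addrAC lerDr addr_ge0.
rewrite Kt in a1 a2.
have k10 : 0 < 1 - k by rewrite subr_gt0.
rewrite ler_pdivlMr// -mulrA; apply: (absorb J2 Y (c1 := K1 * t0^-1) (c2 := K2 * t0^-1)).
- by apply: le_trans g1 _; rewrite mulrDr lerD2r.
- by apply: le_trans g2 _; rewrite mulrDr lerD2r.
- by rewrite -mulrDl ler_wpM2r ?(ltW tV)// /K lerDl.
Qed.

Let moll_approx (c psi : P -> R) (B : R) : continuous (c : R * R -> R) -> unifc c ->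
  (exists2 n, 0 <= n & tame n psi) ->
  (forall e, 0 < e -> e <= 1 -> `|∫ (fun z => conv c (moll e) z * psi z)| <= B) ->
  `|∫ (fun z => c z * psi z)| <= B.
Proof.
move=> cc uc [n n0 tp] hB; apply/ler_addgt0Pr => d d0.
have ip := integ_norm (tame_integ n0 tp).
set J := ∫ (fun z => `|psi z|).
have J0 : 0 <= J by exact: Rint_ge0.
have w0 : 0 < d / (J + 1) by rewrite divr_gt0// ltr_wpDl.
have [r r0 hr] := uc _ w0; pose e := Num.min r 1.
have e0 : 0 < e by rewrite lt_min r0 ltr01.
have [er e1] : e <= r /\ e <= 1 by rewrite /e !ge_min !lexx orbT.
have lc := continuous_locint cc; have lcv := conv_locint (ltW e0) lc (tame_moll e0).
have i1 := tame_mul n0 tp lc; have i2 := tame_mul n0 tp lcv.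
have h : `|∫ (fun z => psi z * c z - psi z * conv c (moll e) z)| <= d.
  apply: (@le_trans _ _ (∫ (fun z => d / (J + 1) * `|psi z|))).
    apply: Rint_abs_le; [exact: integ_meas (integB i1 i2)|exact: integZ|].
    move=> z; rewrite -mulrBr normrM mulrC ler_wpM2r// distrC.
    apply: (conv_unif e0 lc (ltW w0)) => h sh; apply: hr; exact: squareS er _ sh.
  by rewrite RintZ// mulrAC ler_pdivrMr ?ltr_wpDl// ler_pM2l// lerDl.
move: h; rewrite (RintB i1 i2) => h.
have -> : ∫ (fun z => c z * psi z) = ∫ (fun z => psi z * c z) by apply: Rint_ext => z; rewrite mulrC.
have := hB e e0 e1.
have -> : ∫ (fun z => conv c (moll e) z * psi z) = ∫ (fun z => psi z * conv c (moll e) z).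
  by apply: Rint_ext => z; rewrite mulrC.
move: h; move: (∫ (fun z => psi z * c z)) (∫ (fun z => psi z * conv c (moll e) z)) => u w h k0.
by rewrite -[u](subrK w) addrC; apply: le_trans (ler_normD _ _) _; exact: lerD.
Qed.

Lemma loc_weak_bound a b : continuous (a : R * R -> R) -> continuous (b : R * R -> R) ->
  unifc a -> unifc b ->
  (forall psi, csmooth psi -> Tfun p px py q qx qy a b psi = 0) ->
  (forall psi, csmooth psi -> Tfun p px py q qx qy b (fun z => - a z) psi = 0) ->
  exists2 C : R, 0 <= C & forall c v psi t, c = a \/ c = b -> isdir v -> smooth psi -> offzero m psi -> 0 < t ->
    `|∫ (fun z => c z * 'D_v (psi : R * R -> R) z)| <= t * ∫ (fun z => psi z ^+ 2) + (4 * t)^-1 * C.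
Proof.
move=> ca cb ua ub T1 T2; have [C C0 hC] := energy_bound ca cb T1 T2.
exists C => // c v psi t hcab dv sp p0 t0.
have cc : continuous (c : R * R -> R) by case: hcab => ->.
have uc : unifc c by case: hcab => ->.
have tdir := tame_dir dv sp p0.
apply: moll_approx => //; first by exists m.
move=> e e0 e1; have [tu tux tuy tuxy] := tame_loc cc e0.
have hE := hC e e0 e1.
have le1 : m <= m + 1 by rewrite lerDl.
have tp := tameS le1 (smooth_tame sp p0); have spsi := tame_sqi m1 tp.
have fin (g : P -> R) : tame (m + 1) g -> ∫ (fun z => g z ^+ 2) <= C ->
    `|- ∫ (fun z => g z * psi z)| <= t * ∫ (fun z => psi z ^+ 2) + (4 * t)^-1 * C.
  move=> tg gC; rewrite normrN.
  have -> : ∫ (fun z => g z * psi z) = ∫ (fun z => psi z * g z) by apply: Rint_ext => z; rewrite mulrC.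
  apply: le_trans (sqint_mul_le t0 spsi (tame_sqi m1 tg)) _; rewrite lerD2l ler_wpM2l//.
  by rewrite invr_ge0 mulr_ge0// ltW.
have [s1 s2] := (sq0 (loc_dx e a), sq0 (loc_dy e a)); have [s3 s4] := (sq0 (loc_dx e b), sq0 (loc_dy e b)).
have [k1 k2 k3 k4] := sum4_le s1 s2 s3 s4.
case: dv => ->.
  rewrite (loc_dx_parts cc e0 sp p0); apply: fin => //; apply: le_trans hE.
  by case: hcab => ->; [exact: k1|exact: k3].
rewrite (loc_dy_parts cc e0 sp p0); apply: fin => //; apply: le_trans hE.
by case: hcab => ->; [exact: k2|exact: k4].
Qed.

End Localized.

Lemma weak_bound p px py q qx qy k a b m : coefficient p px py q qx qy k -> 0 <= m ->
  continuous (a : R * R -> R) -> continuous (b : R * R -> R) -> unifc a -> unifc b ->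
  (forall psi, csmooth psi -> Tfun p px py q qx qy a b psi = 0) ->
  (forall psi, csmooth psi -> Tfun p px py q qx qy b (fun z => - a z) psi = 0) ->
  exists2 C : R, 0 <= C & forall c v psi t, c = a \/ c = b -> isdir v -> smooth psi -> offzero m psi -> 0 < t ->
    `|∫ (fun z => c z * 'D_v (psi : R * R -> R) z)| <= t * ∫ (fun z => psi z ^+ 2) + (4 * t)^-1 * C.
Proof.
move=> hc m0 ca cb ua ub T1 T2.
have [ex [ey [exy [[t1 t2 t3] d1 d2 d3 d4]]]] := @cutoff_mixed R m.
exact: (loc_weak_bound m0 t1 t2 t3 d1 d2 d3 d4 hc ca cb ua ub T1 T2).
Qed.

End EnergyBound.

(** * Extension across the set *)

Section Extension.
Context {R : realType}.
Local Notation P := (measurableTypeR R * measurableTypeR R)%type.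
Local Notation integ f := ((@area R).-integrable setT (EFin \o f)).
Local Notation mea f := (@measurable_fun _ _ P R setT f).
Local Notation "'∫' f" := (Rintegral (@area R) setT f) (at level 10, f at level 9).
Local Notation sqi := (@sqint _ P R (@area R)).
Local Notation ile g := (@integ_le _ P R (@area R) _ g).
Local Notation ibnd C := (@integ_bndM _ P R (@area R) C).
Implicit Types (x y z h : R * R) (n m e t : R) (v : R * R) (psi : P -> R).

Lemma fatou_integ (F : nat -> P -> R) (f : P -> R) (C : R) : (forall k, integ (F k)) -> mea f ->
  (forall k z, 0 <= F k z) -> (forall k, ∫ (F k) <= C) ->
  (forall z, F k z @[k --> \oo] --> f z) -> integ f.
Proof.
move=> iF mf F0 FC Ff.
have f0 z : 0 <= f z.
  have lf := cvg_lim (@Rhausdorff R) (Ff z); rewrite -lf.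
  by apply: limr_ge; [apply/cvg_ex; exists (f z)|apply: nearW => k; exact: F0].
apply/integrableP; split; first exact/measurable_EFinP.
have mF k : measurable_fun setT (fun z => (F k z)%:E) by apply/measurable_EFinP; exact: integ_meas (iF k).
have F0' k z : setT z -> (0 <= (F k z)%:E)%E by rewrite lee_fin.
have fat := @fatou _ P R (@area R) setT measurableT (fun k z => (F k z)%:E) mF F0'.
apply: (@le_lt_trans _ _ C%:E); last exact: ltry.
have -> : (\int[@area R]_z `|(EFin \o f) z|)%E = (\int[@area R]_z limn_einf (fun k => (F k z)%:E))%E.
  apply: eq_integral => z _ /=; rewrite ger0_norm//.
  have : (F k z)%:E @[k --> \oo] --> (f z)%:E by apply: cvg_EFin; [apply: nearW|exact: Ff].
  by move=> /cvg_limn_einf_sup [-> _].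
apply: le_trans fat _.
rewrite limn_einf_lim; apply: lime_le; first by apply: is_cvg_einfs.
apply: nearW => k; apply: ge_ereal_inf; exists (\int[@area R]_z (F k z)%:E)%E; first by exists k => /=.
have fi := integrable_fin_num measurableT (iF k).
by rewrite -(fineK fi) lee_fin; exact: FC.
Qed.

Lemma removal_seq (s : R) (E : set (R * R)) : 0 < s -> compact E -> hausdorff_measure s E = 0%E ->
  exists chi : nat -> P -> R, [/\ forall k, smooth (chi k), forall k z, 0 <= chi k z <= 1,
    forall k psi, csmooth psi -> test_function (~` E) (fun z => chi k z * psi z) &
    forall z, ~ E z -> \forall k \near \oo, chi k z = 1].
Proof.
move=> s0 cE hE.
have /choice [chi hchi] : forall k : nat, exists chi : P -> R, [/\ smooth chi, forall z, 0 <= chi z <= 1,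
    forall psi, csmooth psi -> test_function (~` E) (fun z => chi z * psi z) &
    forall z, (forall x, E x -> ~ square (2 * k.+1%:R^-1) (z - x)) -> chi z = 1].
  by move=> k; apply: removal_cutoff s0 cE hE _; rewrite invr_gt0.
exists chi; split=> [k|k|k|z Ez]; [by case: (hchi k)|by case: (hchi k)|by case: (hchi k)|].
have cl : closed E by apply: (@compact_closed (R * R)%type) => //; exact: norm_hausdorff.
have : nbhs z (~` E) by apply: open_nbhs_nbhs; split => //; exact: closed_openC.
move=> /nbhs_ballP [r /= r0 hr].
have r2 : 0 < r / 4 by rewrite divr_gt0.
near=> k; have [_ _ _] := hchi k; apply => x Ex /squareE [/= h1 h2].
have kr : k.+1%:R^-1 < r / 4 by near: k; exact: near_infty_natSinv_lt (PosNum r2).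
have kr2 : 2 / k.+1%:R < r.
    apply: (@lt_trans _ _ (2 * (r / 4))); first by rewrite ltr_pM2l.
    by clear -r0; lra.
  have : ball z r x by apply/ball_plane; split; [exact: le_lt_trans h1 kr2|exact: le_lt_trans h2 kr2].
by move=> /hr.
Unshelve. all: by end_near.
Qed.

Variables (s : R) (E : set (R * R)).
Hypotheses (s0 : 0 < s) (s2 : s <= 2) (cE : compact E) (hE : hausdorff_measure s E = 0%E).
Variables (v : R * R) (c cv : P -> R).
Hypotheses (dv : isdir v) (cc : continuous (c : R * R -> R)) (mcv : mea cv).
Hypothesis loc : forall K : set (R * R), compact K -> K `<=` ~` E -> sqi (fun z => \1_K z * cv z).
Hypothesis wc : wd v (~` E) c cv.
Hypothesis bnd : forall m, 0 <= m -> exists2 C : R, 0 <= C & forall psi t, smooth psi -> offzero m psi -> 0 < t ->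
  `|∫ (fun z => c z * 'D_v (psi : R * R -> R) z)| <= t * ∫ (fun z => psi z ^+ 2) + (4 * t)^-1 * C.

Let aeE : {ae (@area R), forall z, ~ E z}.
Proof.
exists E; split.
- by apply: closed_measurable_plane; apply: (@compact_closed (R * R)%type) => //; exact: norm_hausdorff.
- exact: area_null s0 s2 cE hE.
- by move=> z /= /contrapT.
Qed.

Let cvint psi : test_function (~` E) psi -> integ (fun z => cv z * psi z).
Proof.
move=> tp; have [sp [n n0 p0]] := csmooth_test tp; have [_ cS sO] := tp.
have := sqint_mul (loc cS sO) (tame_sqi n0 (smooth_tame sp p0)).
congr (_.-integrable _ (EFin \o _)); apply/funext => z.
case: (pselect (closure [set z : R * R | psi z != 0] z)) => sz.
  by rewrite indicE mem_set// mul1r.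
by rewrite (supp0 sz) !mulr0.
Qed.

Lemma extension_sqi m : 0 <= m -> sqi (fun z => \1_(square m) z * cv z).
Proof.
move=> m0; have m1 : 0 <= m + 1 by exact: addr_ge0.
have [chi [schi bchi tchi lchi]] := removal_seq s0 cE hE.
have [C C0 hC] := bnd m1.
have nchi k z : `|chi k z| <= 1.
  by have /andP[h1 h2] := bchi k z; rewrite ger0_norm.
have loc1 k m' : sqi (fun z => \1_(square m') z * (chi k z * cv z)).
  have cps : csmooth (cutoff m' : P -> R).
    split; first exact: smooth_cutoff.
    exists (`|m'| + 1) => [|z nz]; first by exact: addr_ge0.
    by apply: cutoff0 => sz; apply: nz; apply: squareS sz; rewrite lerD2r ler_norm.
  have tp := tchi k _ cps; have [_ cS sO] := tp.
  have : sqi (fun z => (\1_(square m') z * chi k z) *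
      (\1_(closure [set z : R * R | chi k z * cutoff m' z != 0]) z * cv z)).
    apply: (@sqint_bndM _ _ _ _ 1) (loc cS sO).
      by apply: measurable_funM; [exact: mea_square|exact: smooth_mea].
    by move=> z; rewrite normrM -[1]mulr1 ler_pM// indic_norm_le1.
  congr sqint; apply/funext => z; case: (pselect (square m' z)) => sz; last first.
    by rewrite [\1_(square m') z]indicE memNset// !mul0r.
  case: (pselect (closure [set z : R * R | chi k z * cutoff m' z != 0] z)) => uz.
    by rewrite [\1_(closure _) z]indicE mem_set// mul1r mulrA.
  have := supp0 uz; rewrite /= cutoff1// mulr1 => ->.
  by rewrite !(mul0r, mulr0).
have loc2 k : ∫ (fun z => (\1_(square m) z * (chi k z * cv z)) ^+ 2) <= C.
  pose G z := \1_(square m) z * (chi k z * cv z).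
  have G0 : offzero m G by move=> z nz; rewrite /G indicE memNset// mul0r.
  have half : (0 : R) < 2^-1 by [].
  have hg (g : P -> R) : smooth g -> offzero (m + 1) g ->
     `|∫ (fun z => chi k z * cv z * g z)| <= 2^-1 * ∫ (fun z => g z ^+ 2) + 2^-1 * C.
    move=> sg g0; have cg : csmooth g by split => //; exists (m + 1).
    have tp := tchi k _ cg.
    have sp : smooth (fun z => chi k z * g z) by exact: smoothM.
    have p0 : offzero (m + 1) (fun z => chi k z * g z) by move=> z nz; rewrite g0// mulr0.
    have := hC _ _ sp p0 half; rewrite (wc tp) normrN.
    have -> : ∫ (fun z => cv z * (chi k z * g z)) = ∫ (fun z => chi k z * cv z * g z).
      by apply: Rint_ext => z; ring.
    have -> : (4 * 2^-1)^-1 = (2^-1 : R) by field.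
    move=> /le_trans; apply; rewrite lerD2r ler_wpM2l//.
    apply: Rint_le.
    - by have [] := tame_sqi m1 (smooth_tame sp p0).
    - by have [] := tame_sqi m1 (smooth_tame sg g0).
    - move=> z; rewrite exprMn ler_piMl ?sqr_ge0// -real_normK ?num_real//.
      by rewrite expr_le1.
  have := extend_bound m0 (ltW half) (loc1 k (m + 1)) hg (loc1 k m) G0.
  have -> : ∫ (fun z => chi k z * cv z * (\1_(square m) z * (chi k z * cv z))) = ∫ (fun z => G z ^+ 2).
    apply: Rint_ext => z; rewrite /G; case: (pselect (square m z)) => sz.
      by rewrite indicE mem_set// !mul1r expr2.
    by rewrite indicE memNset// !mul0r mulr0 expr0n.
  rewrite ger0_norm; last by apply: Rint_ge0 => z; exact: sqr_ge0.
  by rewrite -/G; lra.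
have mE : measurable (~` E : set P).
  apply: measurableC; apply: closed_measurable_plane.
  by apply: (@compact_closed (R * R)%type) => //; exact: norm_hausdorff.
split; first by apply: measurable_funM => //; exact: mea_square.
have i1 : integ (fun z => \1_(~` E) z * (\1_(square m) z * cv z) ^+ 2).
  apply: (@fatou_integ (fun k z => \1_(~` E) z * (\1_(square m) z * (chi k z * cv z)) ^+ 2) _ C).
  + move=> k; apply: (ibnd 1); [exact: mea_indic|exact: indic_norm_le1|by case: (loc1 k m)].
  + apply: measurable_funM; first exact: mea_indic.
    by apply: measurable_funX; apply: measurable_funM => //; exact: mea_square.
  + by move=> k z; rewrite mulr_ge0 ?sqr_ge0// indicE.
  + move=> k; apply: le_trans (loc2 k); apply: Rint_le.
    * by apply: (ibnd 1); [exact: mea_indic|exact: indic_norm_le1|case: (loc1 k m)].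
    * by case: (loc1 k m).
    * by move=> z; rewrite ler_piMl ?sqr_ge0// indicE; case: (_ \in _).
  + move=> z; apply: cvg_near_cst; case: (pselect (E z)) => Ez.
      by apply: nearW => k; rewrite indicE memNset ?mul0r//; exact.
    by apply: filterS (lchi z Ez) => k ->; rewrite mul1r.
apply: integ_ae i1 _.
- by apply: measurable_funX; apply: measurable_funM => //; exact: mea_square.
- by apply: filterS aeE => z Ez; rewrite [\1_(~` E) z]indicE mem_set// mul1r.
Qed.

Lemma extension_locint : locint cv.
Proof.
split=> // n n0; have tI : tame n (\1_(square n) : P -> R).
  split; [exact: mea_square|by exists 1 => z _; exact: indic_norm_le1|].
  by move=> z nz; rewrite indicE memNset.
have := sqint_mul (tame_sqi n0 tI) (extension_sqi n0).
congr (_.-integrable _ (EFin \o _)); apply/funext => z.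
by rewrite indicE; case: (_ \in _); rewrite ?mul0r ?mul1r.
Qed.

Lemma extension_wd : wd v setT c cv.
Proof.
move=> psi tpsi; have cps := csmooth_test tpsi; have [sp [n n0 p0]] := cps.
have [chi [schi bchi tchi lchi]] := removal_seq s0 cE hE.
have [C C0 hC] := bnd n0.
have tp := smooth_tame sp p0; have spsi := tame_sqi n0 tp.
have icp := tame_mul n0 tp extension_locint.
have icp' : integ (fun z => cv z * psi z).
  by have := icp; congr (_.-integrable _ (EFin \o _)); apply/funext => z; exact: mulrC.
pose om k z := 1 - chi k z.
have som k : smooth (om k) by apply: smoothB => //; exact: smooth_cst.
have bom k z : `|om k z| <= 1.
  by have /andP[h1 h2] := bchi k z; rewrite ger0_norm /om; lra.
have lom z : ~ E z -> om k z @[k --> \oo] --> (0 : R).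
  by move=> Ez; apply: cvg_near_cst; apply: filterS (lchi z Ez) => k; rewrite /om => ->; exact: subrr.
have l1 : ∫ (fun z => om k z * (psi z * cv z)) @[k --> \oo] --> (0 : R).
  apply: (@dct0 _ _ (fun z => `|psi z * cv z|)).
  - move=> k; apply: measurable_funM; [exact: smooth_mea|exact: integ_meas icp].
  - exact: integ_norm.
  - by move=> k z; rewrite normrM ler_piMl.
  - apply: filterS aeE => z Ez; rewrite -(mul0r (psi z * cv z)); apply: cvgM (lom z Ez) (cvg_cst _).
have l2 : ∫ (fun z => (om k z * psi z) ^+ 2) @[k --> \oo] --> (0 : R).
  apply: (@dct0 _ _ (fun z => psi z ^+ 2)).
  - by move=> k; apply: measurable_funX; apply: measurable_funM; exact: smooth_mea.
  - by case: spsi.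
  - move=> k z; rewrite ger0_norm; last exact: sqr_ge0.
    rewrite exprMn ler_piMl ?sqr_ge0//; by rewrite -real_normK ?num_real// expr_le1.
  - apply: filterS aeE => z Ez; rewrite -(mul0r (psi z ^+ 2)) -[X in X * _](expr0n R 2).
    have -> : (fun k => (om k z * psi z) ^+ 2) = (fun k => om k z * (om k z * psi z ^+ 2)).
      by apply/funext => k; ring.
    rewrite expr0n /= mul0r -[X in _ --> X](mul0r (0 : R)); apply: cvgM; first exact: lom.
    by rewrite -[X in _ --> X](mul0r (psi z ^+ 2)); apply: cvgM (lom z Ez) (cvg_cst _).
apply/eqP; rewrite -addr_eq0 -normr_le0; apply/ler_addgt0Pr => d d0; rewrite add0r.
pose t : R := C / d + 1; have t0 : 0 < t by rewrite ltr_wpDl ?divr_ge0// ltW.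
have d2 : 0 < d / 4 by rewrite divr_gt0.
have dt : 0 < d / (4 * t) by rewrite divr_gt0// mulr_gt0.
have [k [k1 k2]] : exists k, `|∫ (fun z => om k z * (psi z * cv z))| <= d / 4 /\
    `|∫ (fun z => (om k z * psi z) ^+ 2)| <= d / (4 * t).
  have /cvgrPdist_le/(_ _ d2) c1 := l1; have /cvgrPdist_le/(_ _ dt) c2 := l2.
  have := filterI c1 c2 => -[N _ /(_ N (leqnn N))] [/= h1 h2].
  by exists N; move: h1 h2; rewrite !sub0r !normrN.
have sop : smooth (fun z => om k z * psi z) by exact: smoothM.
have op0 : offzero n (fun z => om k z * psi z) by move=> z nz; rewrite p0// mulr0.
have tcp := tchi k _ cps; have cpp := csmooth_test tcp; have [scp _] := cpp.
have cp0 : offzero n (fun z => chi k z * psi z) by move=> z nz; rewrite p0// mulr0.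
have split1 z : 'D_v (psi : R * R -> R) z =
    'D_v (fun z : R * R => om k z * psi z) z + 'D_v (fun z : R * R => chi k z * psi z) z.
  have E0 : (psi : R * R -> R) = (fun z => om k z * psi z + chi k z * psi z).
    by apply/funext => w; rewrite /om; ring.
  have ? := is_deriveD (smooth_dirP z v sop) (smooth_dirP z v scp).
  by rewrite [in LHS]E0; exact: derive_val.
have ic (g : P -> R) : tame n g -> integ (fun z => c z * g z).
  move=> tg; have := tame_mul n0 tg (continuous_locint cc).
  by congr (_.-integrable _ (EFin \o _)); apply/funext => z; exact: mulrC.
have i1 := ic _ (tame_dir dv sop op0); have i2 := ic _ (tame_dir dv scp cp0).
have E1 : ∫ (fun z => c z * 'D_v (psi : R * R -> R) z) =
    ∫ (fun z => c z * 'D_v (fun z : R * R => om k z * psi z) z) - ∫ (fun z => cv z * (chi k z * psi z)).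
  rewrite -(wc tcp) -(RintD i1 i2); apply: Rint_ext => z; rewrite split1; ring.
have i3 := cvint tcp.
have E2 : ∫ (fun z => cv z * psi z) = ∫ (fun z => om k z * (psi z * cv z)) + ∫ (fun z => cv z * (chi k z * psi z)).
  rewrite -RintD//; first by apply: Rint_ext => z; rewrite /om; ring.
  have := integB icp' i3; congr (_.-integrable _ (EFin \o _)); apply/funext => z; rewrite /om; ring.
have bb := hC _ t sop op0 t0.
have sq0 : 0 <= ∫ (fun z => (om k z * psi z) ^+ 2) by apply: Rint_ge0 => z; exact: sqr_ge0.
rewrite E1 E2; move: bb k1 k2; rewrite (ger0_norm sq0) {sq0}.
move: (∫ (fun z => c z * 'D_v (fun z : R * R => om k z * psi z) z)) (∫ (fun z => om k z * (psi z * cv z))).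
move: (∫ (fun z => cv z * (chi k z * psi z))) (∫ (fun z => (om k z * psi z) ^+ 2)) => x1 x2 x3 x4 b1 b2 b3.
have -> : x3 - x1 + (x4 + x1) = x3 + x4 by ring.
have h1 : t * x2 <= d / 4.
  apply: le_trans (ler_wpM2l (ltW t0) b3) _; rewrite le_eqVlt; apply/orP; left; apply/eqP.
  by field; rewrite gt_eqF.
have h2 : (4 * t)^-1 * C <= d / 4.
  rewrite mulrC ler_pdivrMr ?mulr_gt0//.
  have -> : d / 4 * (4 * t) = d * (C / d) + d by rewrite /t; field; rewrite gt_eqF.
  by rewrite mulrCA divff ?gt_eqF// mulr1 lerDl; exact: ltW.
apply: le_trans (ler_normD _ _) (le_trans (lerD (le_trans b1 (lerD h1 h2)) b2) _).
by rewrite -subr_ge0 (_ : d - _ = d / 4) ?(ltW d2)//; field.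
Qed.

End Extension.

Section RealRemoval.
Context {R : realType}.
Local Notation P := (measurableTypeR R * measurableTypeR R)%type.
Local Notation integ f := ((@area R).-integrable setT (EFin \o f)).
Local Notation mea f := (@measurable_fun _ _ P R setT f).
Local Notation "'∫' f" := (Rintegral (@area R) setT f) (at level 10, f at level 9).
Local Notation sqi := (@sqint _ P R (@area R)).
Local Notation ile g := (@integ_le _ P R (@area R) _ g).
Local Notation ibnd C := (@integ_bndM _ P R (@area R) C).

Lemma real_removal p px py q qx qy (k al M : R) (E : set (R * R)) (a a1 a2 b b1 b2 : P -> R) :
  coefficient p px py q qx qy k -> 0 < al -> al < 1 -> 0 <= M -> compact E ->
  hausdorff_measure (1 + al) E = 0%E ->
  (forall z w : R * R, `|a z - a w| <= M * cdist z w `^ al) ->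
  (forall z w : R * R, `|b z - b w| <= M * cdist z w `^ al) ->
  mea a1 -> mea a2 -> mea b1 -> mea b2 ->
  weak_solution (~` E) p q a a1 a2 b b1 b2 -> weak_solution setT p q a a1 a2 b b1 b2.
Proof.
move=> hc al0 al1 M0 cE hE La Lb ma1 ma2 mb1 mb2 hs.
have T1 := Tfun_zero hc hs al0 al1 M0 cE hE La Lb.
have Lna z w : `|- a z - - a w| <= M * cdist z w `^ al by rewrite -opprD normrN.
have T2 := Tfun_zero hc (sol_rot hs) al0 al1 M0 cE hE Lb Lna.
have [[ca cb] [ua ub]] := ((sol_ca hs, sol_cb hs), (sol_ua hs, sol_ub hs)).
have s0 : 0 < 1 + al by rewrite addr_gt0.
have s2 : 1 + al <= 2 by rewrite -[2]/(1 + 1) lerD2l ltW.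
have bnd (c : P -> R) (v : R * R) (m : R) : c = a \/ c = b -> isdir v -> 0 <= m -> exists2 C : R, 0 <= C &
    forall (psi : P -> R) t, smooth psi -> offzero m psi -> 0 < t ->
    `|∫ (fun z => c z * 'D_v (psi : R * R -> R) z)| <= t * ∫ (fun z => psi z ^+ 2) + (4 * t)^-1 * C.
  move=> hcab dv m0; have [C C0 hC] := weak_bound hc m0 ca cb ua ub T1 T2.
  by exists C => // psi t sp p0 t0; exact: hC.
have ext (v : R * R) (c cv : P -> R) : c = a \/ c = b -> isdir v -> mea cv ->
    (forall K : set (R * R), compact K -> K `<=` ~` E -> sqi (fun z => \1_K z * cv z)) ->
    wd v (~` E) c cv ->
    (forall K : set (R * R), compact K -> sqi (fun z => \1_K z * cv z)) /\ wd v setT c cv.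
  move=> hcab dv mcv loc wc.
  have cc : continuous (c : R * R -> R) by case: hcab => ->.
  have bc m := bnd c v m hcab dv.
  split; last exact (extension_wd s0 s2 cE hE dv cc mcv loc wc bc).
  move=> K cK; have [n n0 Kn] := compact_in_square cK.
  have sn := extension_sqi s0 s2 cE hE mcv loc wc bc n0.
  have mK : measurable (K : set P).
    by apply: closed_measurable_plane; apply: (@compact_closed (R * R)%type) => //; exact: norm_hausdorff.
  have : sqi (fun z => \1_K z * (\1_(square n) z * cv z)).
    by apply: (@sqint_bndM _ _ _ _ 1) sn; [exact: mea_indic|exact: indic_norm_le1].
  congr sqint; apply/funext => z; case: (pselect (K z)) => Kz.
    by rewrite [\1_(square n) z]indicE (mem_set (Kn _ Kz)) mul1r.
  by rewrite [\1_K z]indicE memNset// !mul0r.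
have [l1 w1] := ext (1, 0) a a1 (or_introl erefl) (or_introl erefl) ma1
  (fun K cK KO => let: And4 h _ _ _ := sol_loc hs cK KO in h) (sol_wa1 hs).
have [l2 w2] := ext (0, 1) a a2 (or_introl erefl) (or_intror erefl) ma2
  (fun K cK KO => let: And4 _ h _ _ := sol_loc hs cK KO in h) (sol_wa2 hs).
have [l3 w3] := ext (1, 0) b b1 (or_intror erefl) (or_introl erefl) mb1
  (fun K cK KO => let: And4 _ _ h _ := sol_loc hs cK KO in h) (sol_wb1 hs).
have [l4 w4] := ext (0, 1) b b2 (or_intror erefl) (or_intror erefl) mb2
  (fun K cK KO => let: And4 _ _ _ h := sol_loc hs cK KO in h) (sol_wb2 hs).
split=> // [K cK _|]; first by split; [exact: l1|exact: l2|exact: l3|exact: l4].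
have aeE : {ae (@area R), forall z, ~ E z}.
  exists E; split.
  - by apply: closed_measurable_plane; apply: (@compact_closed (R * R)%type) => //; exact: norm_hausdorff.
  - exact: area_null s0 s2 cE hE.
  - by move=> z /= /contrapT.
by apply: filterS2 aeE (sol_eq hs) => z Ez h _; exact: h.
Qed.

End RealRemoval.

(** * Passage between the complex and the real formulation *)

Section NonMeasurable.
Import HBNNSimple.
Context d (T : measurableType d) (R : realType) (mu : {measure set T -> \bar R}).

Let ge0_integral_ae_le (f g : T -> \bar R) : (forall z, (0 <= f z)%E) -> (forall z, (0 <= g z)%E) ->
  {ae mu, forall z, f z = g z} -> (\int[mu]_z f z <= \int[mu]_z g z)%E.
Proof.
move=> f0 g0 [N [mN N0 fgN]]; rewrite ge0_integralTE//.
apply: ge_ereal_sup => _ [h /= hf <-].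
have mNC : measurable (~` N) by exact: measurableC.
pose h' := proj_nnsfun h mNC.
have h'E z : h' z = h z * \1_(~` N) z by [].
have -> : sintegral mu h = sintegral mu h'.
  rewrite -!integralT_nnsfun; apply: ge0_ae_eq_integral => //.
  - by apply/measurable_EFinP; exact: measurable_funP.
  - by apply/measurable_EFinP; exact: measurable_funP.
  - by move=> z _; rewrite lee_fin.
  - by move=> z _; rewrite lee_fin.
  exists N; split=> // z hz; apply: contrapT => Nz; apply: hz => _.
  change ((h z)%:E = (h' z)%:E).
  by rewrite h'E indicE mem_set// mulr1.
rewrite (ge0_integralTE mu g0); apply: ereal_sup_ubound; exists h' => // z.
change ((h' z)%:E <= g z)%E; rewrite h'E indicE; case: (pselect (N z)) => Nz.
  by rewrite memNset ?mulr0//=; exact.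
have <- : f z = g z by apply: contrapT => fg; exact: Nz (fgN _ fg).
by rewrite mem_set// mulr1.
Qed.

(* No measurability is needed: the library integral of an arbitrary nonnegative function is a
   supremum over the simple functions below it, which may be set to [0] on a null set. *)
Lemma integral_ae (D : set T) (f g : T -> \bar R) :
  {ae mu, forall z, (f \_ D)%E z = g z} -> (\int[mu]_(z in D) f z = \int[mu]_z g z)%E.
Proof.
move=> fg; rewrite integral_mkcond (integralE mu setT (f \_ D)%E) (integralE mu setT g).
congr (_ - _)%E; apply/eqP; rewrite eq_le !ge0_integral_ae_le//.
all: by apply: filterS fg => z; rewrite ?funeposE ?funenegE => ->.
Qed.

Lemma Rintegral_ae (D : set T) (f g : T -> R) : {ae mu, forall z, D z} ->
  {ae mu, forall z, D z -> f z = g z} -> \int[mu]_(z in D) f z = \int[mu]_z g z.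
Proof.
move=> aD fg; rewrite /Rintegral; congr fine; apply: integral_ae.
by apply: filterS2 aD fg => z Dz /(_ Dz); rewrite /patch mem_set// => ->.
Qed.

End NonMeasurable.

Section Translation.
Context {R : realType}.
Local Notation P := (measurableTypeR R * measurableTypeR R)%type.
Local Notation integ f := ((@area R).-integrable setT (EFin \o f)).
Local Notation mea f := (@measurable_fun _ _ P R setT f).
Local Notation "'∫' f" := (Rintegral (@area R) setT f) (at level 10, f at level 9).
Local Notation sqi := (@sqint _ P R (@area R)).
Local Notation ile g := (@integ_le _ P R (@area R) _ g).
Local Notation ibnd C := (@integ_bndM _ P R (@area R) C).
Implicit Types (x y z h : R * R) (n m e t : R) (v : R * R) (psi : P -> R).

Let closed_compact (K : set (R * R)) : compact K -> closed K.
Proof. by apply: (@compact_closed (R * R)%type); exact: norm_hausdorff. Qed.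

Lemma measurable_compact (K : set (R * R)) : compact K -> measurable (K : set P).
Proof. by move=> /closed_compact; exact: closed_measurable_plane. Qed.

Lemma borel_rep (F : P -> R) (E : set (R * R)) : compact E ->
  (forall K : set (R * R), compact K -> K `<=` ~` E ->
     exists2 g : P -> R, mea g & {ae (@area R), forall z, K z -> F z = g z}) ->
  exists2 g : P -> R, mea g & {ae (@area R), forall z, ~ E z -> F z = g z}.
Proof.
move=> cE H.
pose B (k : nat) : set (R * R) := \bigcup_(x in E) ball x k.+1%:R^-1.
pose K (k : nat) : set (R * R) := square k%:R `&` ~` B k.
have cK k : compact (K k).
  have sub : K k `<=` square k%:R by move=> z [].
  apply: subclosed_compact (@compact_square R k%:R) sub.
  apply: closedI; first exact: closed_square.
  by apply: open_closedC; apply: bigcup_open => x _; exact: ball_open.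
have KE k : K k `<=` ~` E.
  by move=> z [_ nb] Ez; apply: nb; exists z => //; exact: ballxx.
have /choice [g hg] : forall k, exists g : P -> R, mea g /\ {ae (@area R), forall z, K k z -> F z = g z}.
  by move=> k; have [g mg ag] := H _ (cK k) (KE k); exists g.
pose G k z : \bar R := (\1_(K k) z * g k z)%:E.
have mG k : measurable_fun setT (G k : P -> \bar R).
  apply/measurable_EFinP; apply: measurable_funM; last by case: (hg k).
  by apply: mea_indic; exact: measurable_compact.
exists (fun z => fine (limn_esup (fun k => G k z))).
  apply: (measurableT_comp (f := fine) (g := fun z : P => limn_esup (fun k => G k z))).
    exact: fine_measurable.
  exact: measurable_fun_limn_esup.
have := @ae_foralln _ P R (@area R) (fun k z => K k z -> F z = g k z) (fun k => proj2 (hg k)).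
apply: filterS => z hz Ez.
suff -> : limn_esup (fun k => G k z) = (F z)%:E by [].
have : nbhs z (~` E) by apply: open_nbhs_nbhs; split => //; exact: closed_openC (closed_compact cE).
move=> /nbhs_ballP [r /= r0 hr].
have ev : \forall k \near \oo, K k z.
  have [m m0 sm] := @compact_in_square R [set z] (@compact_set1 _ z).
  near=> k; split.
    apply: (@squareS R m); last exact: sm.
    by near: k; exact: nbhs_infty_ger.
  move=> [x Ex xz]; apply: (hr x) => //; apply: ball_sym; apply: le_ball xz.
  by apply: ltW; near: k; exact: near_infty_natSinv_lt (PosNum r0).
have : G k z @[k --> \oo] --> (F z)%:E.
  apply: cvg_near_cst; apply: filterS ev => k Kz.
  by rewrite /G indicE mem_set// mul1r (hz k Kz).
by move=> /cvg_limn_einf_sup [_ ->].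
Unshelve. all: by end_near.
Qed.

Lemma normc_sq (z : R[i]) : Normc.normc z ^+ 2 = complex.Re z ^+ 2 + complex.Im z ^+ 2.
Proof. by case: z => x y /=; rewrite sqr_sqrtr// addr_ge0 ?sqr_ge0. Qed.

Lemma normc_Re (z : R[i]) : `|complex.Re z| <= Normc.normc z.
Proof. by case: z => x y /=; rewrite -sqrtr_sqr ler_wsqrtr// lerDl sqr_ge0. Qed.

Lemma normc_Im (z : R[i]) : `|complex.Im z| <= Normc.normc z.
Proof. by case: z => x y /=; rewrite -sqrtr_sqr ler_wsqrtr// lerDr sqr_ge0. Qed.

Lemma L2_sqi (D : set P) (f : R * R -> R[i]) (g1 g2 : P -> R) : measurable D -> mea g1 -> mea g2 ->
  {ae (@area R), forall z, D z -> f z = Complex (g1 z) (g2 z)} ->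
  (\int[@area R]_(z in D) (Normc.normc (f z) ^+ 2)%:E < +oo)%E ->
  sqi (fun z => \1_D z * g1 z) /\ sqi (fun z => \1_D z * g2 z).
Proof.
move=> mD mg1 mg2 fg fin.
have mDg g : mea g -> mea (fun z => \1_D z * g z).
  by move=> mg; apply: measurable_funM => //; exact: mea_indic.
have iS : integ (fun z => (\1_D z * g1 z) ^+ 2 + (\1_D z * g2 z) ^+ 2).
  apply/integrableP; split.
    by apply/measurable_EFinP; apply: measurable_funD; apply: measurable_funX; exact: mDg.
  apply: le_lt_trans fin; rewrite le_eqVlt; apply/orP; left; apply/eqP; symmetry.
  apply: integral_ae; apply: filterS fg => z hz; rewrite /patch.
  case: (pselect (D z)) => Dz; last first.
    by rewrite memNset// /= indicE memNset// !mul0r !expr0n /= addr0 normr0.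
  rewrite mem_set// /= indicE mem_set// !mul1r (hz Dz) normc_sq /=.
  by rewrite ger0_norm// addr_ge0 ?sqr_ge0.
split; (split; first exact: mDg); apply: (ile _) iS _ => [|z].
- by apply: measurable_funX; exact: mDg.
- by rewrite ger0_norm ?sqr_ge0// lerDl sqr_ge0.
- by apply: measurable_funX; exact: mDg.
- by rewrite ger0_norm ?sqr_ge0// lerDr sqr_ge0.
Qed.

Lemma weak_wd (D : set (R * R)) v (f fv : R * R -> R[i]) (a b av bv : P -> R) :
  {ae (@area R), forall z, D z} ->
  {ae (@area R), forall z, D z -> f z = Complex (a z) (b z)} ->
  {ae (@area R), forall z, D z -> fv z = Complex (av z) (bv z)} ->
  (forall phi, test_function D phi ->
    cintegral D (fun z => f z * ('D_v phi z)%:C%C) = - cintegral D (fun z => fv z * (phi z)%:C%C)) ->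
  wd v D a av /\ wd v D b bv.
Proof.
move=> aD hf hfv H.
have Re1 (z : R[i]) (r : R) : complex.Re (z * r%:C%C) = complex.Re z * r by case: z => x y /=; ring.
have Im1 (z : R[i]) (r : R) : complex.Im (z * r%:C%C) = complex.Im z * r by case: z => x y /=; ring.
have I (w : R * R -> R[i]) (c : R[i] -> R) (g psi : P -> R) :
    (forall (z : R[i]) (r : R), c (z * r%:C%C) = c z * r) ->
    {ae (@area R), forall z, D z -> c (w z) = g z} ->
    \int[@area R]_(z in D) c (w z * (psi z)%:C%C) = ∫ (fun z => g z * psi z).
  move=> cM wg; apply: Rintegral_ae => //; apply: filterS wg => z hz Dz.
  by rewrite cM hz.
have ae1 (w : R * R -> R[i]) (x y : P -> R) : {ae (@area R), forall z, D z -> w z = Complex (x z) (y z)} ->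
    {ae (@area R), forall z, D z -> complex.Re (w z) = x z} /\
    {ae (@area R), forall z, D z -> complex.Im (w z) = y z}.
  by move=> h; split; apply: filterS h => z hz Dz; rewrite hz.
have [[fa fb] [fva fvb]] := (ae1 _ _ _ hf, ae1 _ _ _ hfv).
split=> psi tp; have E := H psi tp.
- have := congr1 (@complex.Re R) E; rewrite /cintegral /=.
  by rewrite (I _ (@complex.Re R) a)// (I _ (@complex.Re R) av).
- have := congr1 (@complex.Im R) E; rewrite /cintegral /=.
  by rewrite (I _ (@complex.Im R) b)// (I _ (@complex.Im R) bv).
Qed.

Lemma wd_weak v (f : R * R -> R[i]) (av bv : P -> R) :
  wd v setT (fun z => complex.Re (f z)) av -> wd v setT (fun z => complex.Im (f z)) bv ->
  forall phi, test_function setT phi ->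
    cintegral setT (fun z => f z * ('D_v phi z)%:C%C) =
    - cintegral setT (fun z => Complex (av z) (bv z) * (phi z)%:C%C).
Proof.
move=> wa wb phi tp; rewrite /cintegral; apply/eqP; rewrite eq_complex /=; apply/andP; split; apply/eqP.
- have := wa phi tp; congr (_ = - _); apply: Rint_ext => z.
    by case: (f z) => x y /=; ring.
  by rewrite /=; ring.
- have := wb phi tp; congr (_ = - _); apply: Rint_ext => z.
    by case: (f z) => x y /=; ring.
  by rewrite /=; ring.
Qed.

Lemma beltrami_real (a1 b1 a2 b2 p q : R) :
  (Complex a1 b1 + 'i%C * Complex a2 b2) / 2%:R =
    Complex p q * ((Complex a1 b1 - 'i%C * Complex a2 b2) / 2%:R) <->
  a1 - b2 = p * (a1 + b2) - q * (b1 - a2) /\ a2 + b1 = p * (b1 - a2) + q * (a1 + b2).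
Proof.
have two : (2%:R : R[i])^-1 != 0 by rewrite invr_eq0 pnatr_eq0.
rewrite mulrA; split=> [/(mulIf two) E|[e1 e2]].
  have := congr1 (@complex.Re R) E; have := congr1 (@complex.Im R) E => /= e2 e1.
  by split; [move: e1|move: e2] => e; lra.
congr (_ / _); apply/eqP; rewrite eq_complex /=; apply/andP; split; apply/eqP; lra.
Qed.

Lemma holder_unifc (al M : R) (a : P -> R) : 0 < al -> 0 <= M ->
  (forall z w : R * R, `|a z - a w| <= M * cdist z w `^ al) -> unifc a.
Proof.
move=> al0 M0 h w w0.
pose d : R := (w / (M + 1)) `^ al^-1.
have M1 : 0 < M + 1 by rewrite ltr_wpDl.
have wM : 0 < w / (M + 1) by rewrite divr_gt0.
have d0 : 0 < d by rewrite powR_gt0.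
exists (d / 2) => [|x y /squareE [h1 h2]]; first by rewrite divr_gt0.
apply: le_trans (h _ _) _.
have cd0 : 0 <= cdist (x + y : R * R) x.
  by rewrite /cdist /cplx /=; exact: sqrtr_ge0.
have cd : cdist (x + y : R * R) x <= d.
  apply: le_trans (cdist_le _ _) _.
  have -> : (x + y : R * R).1 - x.1 = y.1 by rewrite /= addrC addKr.
  have -> : (x + y : R * R).2 - x.2 = y.2 by rewrite /= addrC addKr.
  by lra.
have : cdist (x + y : R * R) x `^ al <= w / (M + 1).
  have -> : w / (M + 1) = d `^ al by rewrite /d -powRrM mulVf ?gt_eqF// powRr1// ltW.
  by apply: ge0_ler_powR; rewrite ?nnegrE ?(ltW al0) ?(ltW d0).
move=> k; apply: le_trans (ler_wpM2l M0 k) _.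
by rewrite mulrCA ler_piMr ?(ltW w0)// ler_pdivrMr// mul1r lerDl ler01.
Qed.

Lemma unifc_continuous (a : P -> R) : unifc a -> continuous (a : R * R -> R).
Proof.
move=> ua z; apply/cvgrPdist_le => w w0; have [r r0 hr] := ua w w0.
apply: (filterS _ (@nbhsx_ballx R (R * R)%type z r r0)) => y /ball_plane [h1 h2]; rewrite distrC.
have -> : y = (z + (y - z) : R * R) by rewrite addrC subrK.
by apply: hr; apply/squareE; rewrite /= !(distrC y.1, distrC y.2); split; exact: ltW.
Qed.

End Translation.

Section Conclusion.
Context {R : realType}.
Local Notation P := (measurableTypeR R * measurableTypeR R)%type.
Local Notation integ f := ((@area R).-integrable setT (EFin \o f)).
Local Notation mea f := (@measurable_fun _ _ P R setT f).
Local Notation "'∫' f" := (Rintegral (@area R) setT f) (at level 10, f at level 9).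
Local Notation sqi := (@sqint _ P R (@area R)).
Local Notation ile g := (@integ_le _ P R (@area R) _ g).
Local Notation ibnd C := (@integ_bndM _ P R (@area R) C).

Lemma clipped_rep (mu : R * R -> R[i]) : beltrami_coefficient mu ->
  exists p q : P -> R, exists k : R, [/\ mea p /\ mea q, 0 <= k < 1,
    forall z, p z ^+ 2 + q z ^+ 2 <= k ^+ 2 & {ae (@area R), forall z, mu z = Complex (p z) (q z)}].
Proof.
move=> [[g [m1 m2 mae]] hess].
have [k [/andP[k0 k1] hk]] : exists k : R, 0 <= k < 1 /\ {ae (@area R), forall z, Normc.normc (mu z) <= k}.
  have sae := @ess_sup_ge _ P R (@area R) (fun z => (Normc.normc (mu z))%:E).
  move: hess sae; case: (ess_sup _ _) => [s|//|] s1 sae.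
  - exists (Num.max 0 s); split; first by rewrite le_max lexx gt_max ltr01 -lte_fin.
    by apply: filterS sae => z; rewrite lee_fin => h; rewrite le_max h orbT.
  - exists 0; split; first by rewrite lexx ltr01.
    by apply: filterS sae => z.
have mr : mea (fun z => complex.Re (g z)) := m1.
have mi : mea (fun z => complex.Im (g z)) := m2.
pose N z := complex.Re (g z) ^+ 2 + complex.Im (g z) ^+ 2.
have mN : mea N by apply: measurable_funD; exact: measurable_funX.
pose A : set P := N @^-1` `]-oo, k ^+ 2].
have mA : measurable A by rewrite -[A]setTI; apply: mN => //; exact: measurable_itv.
exists (fun z => \1_A z * complex.Re (g z)), (fun z => \1_A z * complex.Im (g z)), k; split.
- by split; apply: measurable_funM => //; exact: mea_indic.
- by rewrite k0.
- move=> z; rewrite indicE; case: (boolP (z \in A)) => [|_].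
    by rewrite inE /A /= in_itv /= !mul1r.
  by rewrite !mul0r expr0n /= addr0 sqr_ge0.
- apply: filterS2 mae hk => z /(_ I) E; rewrite E => hz.
  have Az : A z.
    rewrite /A /= in_itv /= /N -normc_sq lerXn2r ?nnegrE//.
    by apply: le_trans (normr_ge0 _) (normc_Re (g z)).
  by rewrite indicE mem_set// !mul1r; case: (g z).
Qed.

Lemma L2_rep (f : R * R -> R[i]) : L2 setT f -> exists u w : P -> R,
  [/\ sqi u, sqi w & {ae (@area R), forall z, f z = Complex (u z) (w z)}].
Proof.
move=> [[g [m1 m2 mae]] fin].
have mr : mea (fun z => complex.Re (g z)) := m1.
have mi : mea (fun z => complex.Im (g z)) := m2.
have fE : {ae (@area R), forall z, [set: P] z -> f z = Complex (complex.Re (g z)) (complex.Im (g z))}.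
  by apply: filterS mae => z h _; rewrite (h I); case: (g z).
have [s1 s2] := L2_sqi measurableT mr mi fE fin.
exists (fun z => complex.Re (g z)), (fun z => complex.Im (g z)); split.
- by have := s1; congr sqint; apply/funext => z; rewrite indicT mul1r.
- by have := s2; congr sqint; apply/funext => z; rewrite indicT mul1r.
- by apply: filterS fE => z; exact.
Qed.

Lemma L2loc_rep (E : set (R * R)) (f : R * R -> R[i]) : compact E -> L2loc (~` E) f ->
  exists u w : P -> R, [/\ mea u, mea w,
    {ae (@area R), forall z, ~ E z -> f z = Complex (u z) (w z)} &
    forall K : set (R * R), compact K -> K `<=` ~` E ->
      sqi (fun z => \1_K z * u z) /\ sqi (fun z => \1_K z * w z)].
Proof.
move=> cE Lf.
have [u mu hu] : exists2 u : P -> R, mea u & {ae (@area R), forall z, ~ E z -> complex.Re (f z) = u z}.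
  apply: borel_rep => // K cK KE; have [[g [m1 m2 mae]] _] := Lf K cK KE.
  exists (fun z => complex.Re (g z)); first exact: m1.
  by apply: filterS mae => z h Kz; rewrite h.
have [w mw hw] : exists2 w : P -> R, mea w & {ae (@area R), forall z, ~ E z -> complex.Im (f z) = w z}.
  apply: borel_rep => // K cK KE; have [[g [m1 m2 mae]] _] := Lf K cK KE.
  exists (fun z => complex.Im (g z)); first exact: m2.
  by apply: filterS mae => z h Kz; rewrite h.
have fE : {ae (@area R), forall z, ~ E z -> f z = Complex (u z) (w z)}.
  by apply: filterS2 hu hw => z h1 h2 Ez; rewrite -(h1 Ez) -(h2 Ez); case: (f z).
exists u, w; split=> // K cK KE; have [_ fin] := Lf K cK KE.
apply: (L2_sqi (measurable_compact cK) mu mw _ fin).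
by apply: filterS fE => z h Kz; apply: h; exact: KE.
Qed.

Lemma L2_of_sqi (f : R * R -> R[i]) (K : set (R * R)) : compact K ->
  mea (fun z => complex.Re (f z)) -> mea (fun z => complex.Im (f z)) ->
  sqi (fun z => \1_K z * complex.Re (f z)) -> sqi (fun z => \1_K z * complex.Im (f z)) -> L2 K f.
Proof.
move=> cK m1 m2 [_ s1] [_ s2]; split.
  by exists f; split; [exact: m1|exact: m2|exact: aeW].
have /integrableP[_] := integD s1 s2; apply: le_lt_trans.
rewrite le_eqVlt; apply/orP; left; apply/eqP; apply: integral_ae; apply: aeW => z; rewrite /patch.
case: (pselect (K z)) => Kz; last first.
  by rewrite memNset// /= indicE memNset// !mul0r !expr0n /= addr0 normr0.
have nn : 0 <= complex.Re (f z) ^+ 2 + complex.Im (f z) ^+ 2 by apply: addr_ge0; exact: sqr_ge0.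
by rewrite mem_set// /= indicE mem_set// !mul1r normc_sq (ger0_norm nn).
Qed.

Lemma continuous_sqi (c : P -> R) (K : set (R * R)) : continuous (c : R * R -> R) -> compact K ->
  sqi (fun z => \1_K z * c z).
Proof.
move=> cc cK; have [n n0 Kn] := compact_in_square cK; have [C hC] := continuous_bounded_on cc cK.
apply: (tame_sqi n0); split.
- apply: measurable_funM; last exact: continuous_mea.
  by apply: mea_indic; exact: measurable_compact.
- exists `|C| => z _; case: (pselect (K z)) => Kz; last by rewrite indicE memNset// mul0r normr0.
  by rewrite indicE mem_set// mul1r (le_trans (hC z Kz))// ler_norm.
- by move=> z nz; rewrite indicE memNset ?mul0r// => /Kn.
Qed.

End Conclusion.

Unset Implicit Arguments.

Theorem corollary14 (R : realType) (alpha : R) (mu : R * R -> R[i])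
    (E : set (R * R)) :
  0 < alpha -> alpha < 1 ->
  beltrami_coefficient mu -> W12 mu -> compactly_supported mu ->
  compact E -> hausdorff_measure (1 + alpha) E = 0%E ->
  removable alpha mu E.
Proof.
move=> al0 al1 hmu [mux [muy [_ Lmux Lmuy wmx wmy]]] _ cE hE f [M0 hL] [fx [fy [[_ Lfx Lfy wx wy] hB]]].
have [p [q [k [[mp mq] /andP[k0 k1] hpq muE]]]] := clipped_rep hmu.
have [px [qx [spx sqx muxE]]] := L2_rep Lmux.
have [py [qy [spy sqy muyE]]] := L2_rep Lmuy.
have aeT : {ae (@area R), forall z, [set: R * R] z} by exact: aeW.
have inT (Q : R * R -> Prop) : {ae (@area R), forall z, Q z} -> {ae (@area R), forall z, [set: R * R] z -> Q z}.
  by apply: filterS.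
have [wpx wqx] := weak_wd aeT (inT _ muE) (inT _ muxE) wmx.
have [wpy wqy] := weak_wd aeT (inT _ muE) (inT _ muyE) wmy.
have hc : coefficient p px py q qx qy k by [].
have [a1 [b1 [ma1 mb1 fxE l1]]] := L2loc_rep cE Lfx.
have [a2 [b2 [ma2 mb2 fyE l2]]] := L2loc_rep cE Lfy.
have s0 : 0 < 1 + alpha by rewrite addr_gt0.
have s2 : 1 + alpha <= 2 by rewrite -[2]/(1 + 1) lerD2l ltW.
have aeE : {ae (@area R), forall z, (~` E) z}.
  exists E; split; [exact: measurable_compact|exact: area_null s0 s2 cE hE|].
  by move=> z /= /contrapT.
have fE : {ae (@area R), forall z, (~` E) z -> f z = Complex (complex.Re (f z)) (complex.Im (f z))}.
  by apply: aeW => z _; case: (f z).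
have [wa1 wb1] := weak_wd aeE fE fxE wx.
have [wa2 wb2] := weak_wd aeE fE fyE wy.
pose M := `|M0|.
have hM z w : Normc.normc (f z - f w) <= M * cdist z w `^ alpha.
  by apply: le_trans (hL z w) _; rewrite ler_wpM2r ?powR_ge0// ler_norm.
have La z w : `|complex.Re (f z) - complex.Re (f w)| <= M * cdist z w `^ alpha.
  apply: le_trans (hM z w); apply: le_trans (normc_Re (f z - f w)).
  by case: (f z) (f w) => ? ? [? ?].
have Lb z w : `|complex.Im (f z) - complex.Im (f w)| <= M * cdist z w `^ alpha.
  apply: le_trans (hM z w); apply: le_trans (normc_Im (f z - f w)).
  by case: (f z) (f w) => ? ? [? ?].
have Mge0 : 0 <= M by exact: normr_ge0.
have ua := holder_unifc al0 Mge0 La; have ub := holder_unifc al0 Mge0 Lb.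
have ca := unifc_continuous ua; have cb := unifc_continuous ub.
have hs : weak_solution (~` E) p q (fun z => complex.Re (f z)) a1 a2 (fun z => complex.Im (f z)) b1 b2.
  split=> //.
    move=> K cK KE; have [u1 u2] := l1 K cK KE; have [u3 u4] := l2 K cK KE.
    by split.
  have h : {ae (@area R), forall z, mu z = Complex (p z) (q z) /\
      (~ E z -> wirt_bar fx fy z = mu z * wirt fx fy z)} by apply: filterS2 muE hB.
  apply: filterS3 h fxE fyE => z [hm hb] hx hy Ez.
  apply/beltrami_real; have := hb Ez; rewrite /wirt /wirt_bar (hx Ez) (hy Ez) hm.
  exact.
have hs' := real_removal hc al0 al1 Mge0 cE hE La Lb ma1 ma2 mb1 mb2 hs.
exists f; split=> //.
exists (fun z => Complex (a1 z) (b1 z)), (fun z => Complex (a2 z) (b2 z)); split.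
  split.
  - move=> K cK _; apply: L2_of_sqi => //; [exact: continuous_mea|exact: continuous_mea| |].
      exact: (continuous_sqi ca).
    exact: (continuous_sqi cb).
  - by move=> K cK KT; have [? ? ? ?] := sol_loc hs' cK KT; exact: L2_of_sqi.
  - by move=> K cK KT; have [? ? ? ?] := sol_loc hs' cK KT; exact: L2_of_sqi.
  - exact: wd_weak (sol_wa1 hs') (sol_wb1 hs').
  - exact: wd_weak (sol_wa2 hs') (sol_wb2 hs').
apply: filterS2 muE (sol_eq hs') => z hm h zT; rewrite /wirt /wirt_bar hm.
by apply/beltrami_real; exact: h.
Qed.
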